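(* Let $\alpha\in(0,1)$, let $\Gamma=(\Gamma(1),\ldots,\Gamma(d))$ be a $d$-dimensional analytic fractional Brownian motion of index $\alpha$ on the closed upper half-plane $\bar{\Pi}^+$, with iterated integrals $\boldsymbol{\Gamma}^n_{ts}(i_1,\ldots,i_n)$, and let $V_1,\ldots,V_d$ be linear vector fields on $\mathbb{C}^r$. Then, for all $s,t\in\bar{\Pi}^+$ and every deterministic value $y_s\in\mathbb{C}^r$ at $s$, the series $$y_s+\sum_{n=1}^{\infty}\ \sum_{1\le i_1,\ldots,i_n\le d}\left[V_{i_1}\cdots V_{i_n}\mathrm{Id}\right](y_s)\,\boldsymbol{\Gamma}^n_{ts}(i_1,\ldots,i_n)$$ converges in $L^2(\Omega)$. Furthermore, for a deterministic initial condition $y_0\in\mathbb{C}^r$ at time $0$, the solution $(y_t)_{t\in\bar{\Pi}^+}$ of the differential equation $dy(t)=\sum_{i=1}^d V_i(y(t))\,d\Gamma_t(i)$, defined as the limit of this series (with $s=0$), has finite variance. More precisely, there exists a constant $C$ such that $$\mathbb{E}|y_t-y_s|^2\le C|t-s|^{2\alpha},\qquad s,t\in\bar{\Pi}^+.$$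
   Context: Notation: $\Pi^+=\{x+\mathrm{i}y : x\in\mathbb{R},\ y>0\}$ and $\bar{\Pi}^+=\Pi^+\cup\mathbb{R}$. Analytic fractional Brownian motion (afBm) of index $\alpha\in(0,1)$: let $(\Gamma'_z)_{z\in\Pi^+}$ be a centered complex Gaussian process on a complete probability space $(\Omega,\mathcal{F},\mathbb{P})$, with sample paths analytic on $\Pi^+$ and covariance $$\mathbb{E}[\Gamma'_z\Gamma'_w]=0,\qquad \mathbb{E}[\Gamma'_z\overline{\Gamma'_w}]=\frac{\alpha(1-2\alpha)}{2\cos\pi\alpha}\,(-\mathrm{i}(z-\bar w))^{2\alpha-2},$$ with the principal branch of the power (note $\mathrm{Re}(-\mathrm{i}(z-\bar w))>0$) and with the prefactor extended by continuity at $\alpha=1/2$. Set $\Gamma_z=\int_\gamma\Gamma'_u\,du$ for any continuous path $\gamma$ in $\Pi^+$ from $0$ to $z$; $\Gamma$ is analytic on $\Pi^+$ and extends almost surely to boundary points $t\in\mathbb{R}$ as a limit from inside $\Pi^+$. A $d$-dimensional afBm $\Gamma=(\Gamma(1),\ldots,\Gamma(d))$ has $d$ independent components, each distributed as this process. Iterated integrals: for $s,t\in\Pi^+$, $$\boldsymbol{\Gamma}^n_{ts}(i_1,\ldots,i_n)=\int_s^t d\Gamma_{t_1}(i_1)\int_s^{t_1}d\Gamma_{t_2}(i_2)\cdots\int_s^{t_{n-1}}d\Gamma_{t_n}(i_n),$$ the integrals being taken along any path in $\Pi^+$ (by analyticity the result is path-independent). For $s,t\in\bar{\Pi}^+$,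 $\boldsymbol{\Gamma}^n_{ts}(i_1,\ldots,i_n)$ is the limit in $L^2(\Omega)$ as $\varepsilon\to0^+$ of $\boldsymbol{\Gamma}^n_{t+\mathrm{i}\varepsilon,\,s+\mathrm{i}\varepsilon}(i_1,\ldots,i_n)$. Linear vector fields: each $V_i$ is identified with an $r\times r$ complex matrix, $V_i(y)=V_iy$, and $[V_{i_1}\cdots V_{i_n}\mathrm{Id}](y)=V_{i_1}V_{i_2}\cdots V_{i_n}y$ (product of matrices).
   Formalization: The estimate E|y_t-y_s|^2 ≤ C|t-s|^{2α} is proved with a constant C depending on a bound M for |s| and |t|; a single C for all s,t in the closed half-plane is impossible, e.g. for y_t = y_0 exp(vΓ_t) with v and y_0 nonzero. *)

(* Defs.v *)
From HB Require Import structures.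
From mathcomp Require Import all_boot all_order all_algebra.
From mathcomp.real_closed Require Import complex.
From mathcomp Require Import all_classical all_reals all_analysis.

Set Implicit Arguments.
Unset Strict Implicit.
Unset Printing Implicit Defensive.
Import Order.TTheory GRing.Theory Num.Theory.
Import numFieldNormedType.Exports.
Import ComplexField.Normc.

Local Open Scope classical_set_scope.
Local Open Scope ring_scope.
Local Open Scope complex_scope.

Section complex_plane.
Context {R : realType}.
Local Notation C := R[i].

Definition upper_half : set C := [set z | 0 < complex.Im z].
Definition closed_upper_half : set C := [set z | 0 <= complex.Im z].

(* Principal argument, with values in (-pi, pi] for w != 0. *)
Definition carg (w : C) : R :=
  let a := acos (complex.Re w / normc w) in
  if 0 <= complex.Im w then a else - a.

Definition cpow (w : C) (a : R) : C :=
  (normc w `^ a)%:C * (cos (a * carg w) +i* sin (a * carg w)).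

Definition analytic_at (f : C -> C) (z : C) : Prop :=
  exists2 rho : R, 0 < rho & exists a : nat -> C, forall h : C, normc h < rho ->
    normc (f (z + h) - \sum_(k < N) a k * h ^+ k) @[N --> \oo] --> (0 : R).

Definition cintegral01 (g : R -> C) : C :=
  (\int[lebesgue_measure]_(u in `[0, 1]) complex.Re (g u))
  +i* (\int[lebesgue_measure]_(u in `[0, 1]) complex.Im (g u)).

(* Integral of f(u) du along the straight segment from a to b. *)
Definition segint (f : C -> C) (a b : C) : C :=
  (b - a) * cintegral01 (fun u : R => f (a + u%:C * (b - a))).

(* Iterated integral
     int_s^t f_{i_1}(t_1) dt_1 int_s^{t_1} f_{i_2}(t_2) dt_2 ...
   for I = [:: i_1; i_2; ...]. For analytic f_i on the half-plane, which is
   convex, it does not depend on the path, so the straight segment is used. *)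
Fixpoint iterint (d : nat) (f : 'I_d -> C -> C) (I : seq 'I_d) (t s : C) : C :=
  if I is i :: I' then segint (fun u => f i u * iterint f I' u s) s t else 1.

(* The prefactor alpha (1 - 2 alpha) / (2 cos (pi alpha)) tends to 1 / (2 pi)
   when alpha tends to 1/2. *)
Definition afbm_const (alpha : R) : R :=
  if alpha == 2^-1 then (2 * pi)^-1
  else alpha * (1 - 2 * alpha) / (2 * cos (pi * alpha)).

Definition afbm_kernel (alpha : R) (z w : C) : C :=
  (afbm_const alpha)%:C * cpow (- (0 +i* 1) * (z - conjc w)) (2 * alpha - 2).

Definition vnorm2 (r : nat) (v : 'cV[C]_r) : R := \sum_i normc (v i 0) ^+ 2.

End complex_plane.

Section random_variables.
Context {d0 : measure_display} {T : measurableType d0} {R : realType}.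
Variable P : probability T R.
Local Notation C := R[i].

Definition cmeasurable (X : T -> C) : Prop :=
  measurable_fun setT (fun x => complex.Re (X x)) /\
  measurable_fun setT (fun x => complex.Im (X x)).

Definition vmeasurable (r : nat) (Y : T -> 'cV[C]_r) : Prop :=
  forall i, cmeasurable (fun x => Y x i 0).

Definition cmean (X : T -> C) : C :=
  (\int[P]_x complex.Re (X x)) +i* (\int[P]_x complex.Im (X x)).

Definition csqmean (X : T -> C) : \bar R := (\int[P]_x (normc (X x) ^+ 2)%:E)%E.

Definition vsqmean (r : nat) (Y : T -> 'cV[C]_r) : \bar R :=
  (\int[P]_x (vnorm2 (Y x))%:E)%E.

Definition square_integrable (r : nat) (Y : T -> 'cV[C]_r) : Prop :=
  vmeasurable Y /\ (vsqmean Y < +oo)%E.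

(* The law N(0, sigma^2), including the degenerate case sigma = 0, for which
   normal_prob takes a junk value. *)
Definition centered_normal (X : T -> R) : Prop :=
  measurable_fun setT X /\
  exists sigma : R, forall A : set R, measurable A ->
    P (X @^-1` A) = if sigma == 0 then \d_(0 : R) A else normal_prob 0 sigma A.

(* All real linear combinations of real and imaginary parts are centered
   normal; these are the real parts of the complex linear combinations. *)
Definition centered_gaussian (D : set C) (X : C -> T -> C) : Prop :=
  forall (n : nat) (a z : 'I_n -> C), (forall k, D (z k)) ->
    centered_normal (fun x => complex.Re (\sum_k a k * X (z k) x)).

Definition process_events (D : set C) (X : C -> T -> C) : set (set T) :=
  <<s [set A | exists2 z, D z & exists2 B : set R, measurable B &
         A = (fun x => complex.Re (X z x)) @^-1` B \/
         A = (fun x => complex.Im (X z x)) @^-1` B] >>.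

(* Since setT is an event of every process, the product rule over the whole
   index set contains the one over subfamilies. *)
Definition independent_processes (d : nat) (D : set C)
    (X : 'I_d -> C -> T -> C) : Prop :=
  forall A : 'I_d -> set T, (forall i, process_events D (X i) (A i)) ->
    P (\bigcap_(i in [set: 'I_d]) A i) = (\prod_(i < d) P (A i))%E.

(* X' is the process Gamma' on the open half-plane and X is Gamma. *)
Record afbm1 (alpha : R) (X' X : C -> T -> C) : Prop := {
  afbm1_gaussian : centered_gaussian upper_half X' ;
  afbm1_analytic : forall x z, upper_half z -> analytic_at (X'^~ x) z ;
  afbm1_pseudocov : forall z w, upper_half z -> upper_half w ->
    cmean (fun x => X' z x * X' w x) = 0 ;
  afbm1_cov : forall z w, upper_half z -> upper_half w ->
    cmean (fun x => X' z x * conjc (X' w x)) = afbm_kernel alpha z w ;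
  afbm1_path : {ae P, forall x, forall z, upper_half z ->
    X z x = segint (X'^~ x) 0 z} ;
  afbm1_boundary : forall t : R, {ae P, forall x, forall e : R, 0 < e ->
    exists2 delta : R, 0 < delta & forall z, upper_half z ->
      normc (z - t%:C) < delta -> normc (X z x - X t%:C x) < e} }.

(* Gamma(i) is a.s. an integral of Gamma'(i), so independence of the components
   is expressed on the derivatives. *)
Record afBm (alpha : R) (d : nat) := AfBm {
  afbm_deriv : 'I_d -> C -> T -> C ;
  afbm_process :> 'I_d -> C -> T -> C ;
  afbm_component : forall i, afbm1 alpha (afbm_deriv i) (afbm_process i) ;
  afbm_indep : independent_processes upper_half afbm_deriv }.

(* Iterated integrals of Gamma in the open half-plane, dGamma_u being
   Gamma'_u du. *)
Definition afbm_iterint (alpha : R) (d : nat) (Gamma : afBm alpha d)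
    (I : seq 'I_d) (t s : C) (x : T) : C :=
  iterint (fun i u => afbm_deriv Gamma i u x) I t s.

(* GG I t s is a version of the n-th order iterated integral bold Gamma^n_{ts}
   with multi-index I of length n, on the closed half-plane. *)
Definition is_afbm_iterint (alpha : R) (d : nat) (Gamma : afBm alpha d)
    (GG : seq 'I_d -> C -> C -> T -> C) : Prop :=
  forall I t s, closed_upper_half t -> closed_upper_half s ->
    cmeasurable (GG I t s) /\
    csqmean (fun x =>
      afbm_iterint Gamma I (t + (0 +i* eps)) (s + (0 +i* eps)) x - GG I t s x)
      @[eps --> (0 : R)^'+] --> 0%E.

Definition L2_limit (r : nat) (S : nat -> T -> 'cV[C]_r) (Y : T -> 'cV[C]_r)
    : Prop :=
  vmeasurable Y /\ vsqmean (fun x => S N x - Y x) @[N --> \oo] --> 0%E.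

Definition L2_convergent (r : nat) (S : nat -> T -> 'cV[C]_r) : Prop :=
  (forall N, square_integrable (S N)) /\
  exists2 Y, square_integrable Y & L2_limit S Y.

(* Partial sum, up to order N, of the series started from y at s. *)
Definition series_sum (d r : nat) (V : 'I_d -> 'M[C]_r)
    (GG : seq 'I_d -> C -> C -> T -> C) (t s : C) (y : 'cV[C]_r)
    (N : nat) (x : T) : 'cV[C]_r :=
  y + \sum_(1 <= n < N.+1) \sum_(I : n.-tuple 'I_d)
        GG I t s x *: ((\big[mulmx/1%:M]_(i <- I) V i) *m y).

Definition is_solution (d r : nat) (V : 'I_d -> 'M[C]_r)
    (GG : seq 'I_d -> C -> C -> T -> C) (y0 : 'cV[C]_r)
    (y : C -> T -> 'cV[C]_r) : Prop :=
  forall t, closed_upper_half t -> L2_limit (series_sum V GG t 0 y0) (y t).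

End random_variables.

(* Main.v *)
(* Everything is done path by path and then averaged.  By Goursat's lemma the
   integrals along straight segments are primitives, so the iterated integrals
   W_I are holomorphic in their upper endpoint, with W_{iI}' = f_i W_I.  By
   induction on the length n of I, along a path of cost A = int sum_i |f_i| |du|
   starting where |W_J| <= L^|J| / |J|! for all J, the increment of W_I is at
   most ((L + A)^n - L^n) / n!.

   Now Gamma'_u is Gaussian with standard deviation of order (Im u)^(alpha - 1),
   which is integrable down to the boundary.  Climbing from s to an apex at
   height |t - s| above the midpoint of s and t and going down to t, Jensen's
   inequality for y |-> exp(y^2) shows that the cost of the path is subgaussian
   of scale |t - s|^alpha.  With the deterministic estimate this gives
   E|Gamma^n_{ts}|^2 <= C^n |t - s|^(2 n alpha) n / (n - 1)!.  Letting eps -> 0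
   extends the bound to the boundary, and the factorial makes the series
   converge in L^2. *)
Require Import Defs.
From HB Require Import structures.
From mathcomp Require Import all_boot all_order all_algebra.
From mathcomp.real_closed Require Import complex.
From mathcomp Require Import all_classical all_reals all_analysis.
From mathcomp Require Import measurable_realfun ring lra.
Set Implicit Arguments.
Unset Strict Implicit.
Unset Printing Implicit Defensive.
Import Order.TTheory GRing.Theory Num.Theory.
Import numFieldNormedType.Exports.
Import ComplexField.Normc.
Local Open Scope classical_set_scope.
Local Open Scope ring_scope.
Local Open Scope complex_scope.

(** * Complex differentiation and segment integrals *)

(** The weight (Im u)^(alpha - 1) blows up at the boundary, so the cost of a horizontal segment of
    small height is out of control. On a segment whose height changes by at least |t - s| / 2 the
    weight integrates to a bound that does not depend on how low the segment starts; hence the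
    detour through an apex. An increment is carried by two paths, one from the base point to s, of
    cost A, and one from s to t, of cost B. From ((A + B)^n - A^n) / n! one factor B splits off, and
    its square yields |t - s|^(2 alpha), while A + B only has to stay bounded. This is where the
    constant obtained for the solution depends on the size of s and t. The paths depend on the end
    points only and the cost involves all components at once, so one random variable controls all
    words. Squaring the pathwise bound puts ((n - 1)!)^2 in the denominator, and the moment of order
    2n costs n!, because x^n <= n! exp(x); the quotient is n / (n - 1)!. *)

Section complex_facts.
Context {R : realType}.
Local Notation C := R[i].
Implicit Types (z w : C) (x y : R).

Lemma complex_ReD z w : complex.Re (z + w) = complex.Re z + complex.Re w.
Proof. by case: z; case: w. Qed.

Lemma complex_ImD z w : complex.Im (z + w) = complex.Im z + complex.Im w.
Proof. by case: z; case: w. Qed.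

Lemma complex_ReN z : complex.Re (- z) = - complex.Re z.
Proof. by case: z. Qed.

Lemma complex_ImN z : complex.Im (- z) = - complex.Im z.
Proof. by case: z. Qed.

Lemma complex_ReM z w : complex.Re (z * w) =
  complex.Re z * complex.Re w - complex.Im z * complex.Im w.
Proof. by case: z; case: w. Qed.

Lemma complex_ImM z w : complex.Im (z * w) =
  complex.Re z * complex.Im w + complex.Im z * complex.Re w.
Proof. by case: z => a b; case: w => c d /=; ring. Qed.

Lemma complex_Re_real x : complex.Re x%:C = x. Proof. by []. Qed.

Lemma complex_Im_real x : complex.Im x%:C = 0. Proof. by []. Qed.

Definition ReImE :=
  (complex_ReD, complex_ImD, complex_ReN, complex_ImN, complex_ReM, complex_ImM,
   complex_Re_real, complex_Im_real).

Lemma normc_sqr z : normc z ^+ 2 = complex.Re z ^+ 2 + complex.Im z ^+ 2.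
Proof. by case: z => a b /=; rewrite sqr_sqrtr// addr_ge0 ?sqr_ge0. Qed.

Lemma normc_ge0 z : 0 <= normc z.
Proof. by case: z => a b /=; rewrite sqrtr_ge0. Qed.
Hint Resolve normc_ge0 : core.

Lemma normc_real x : normc x%:C = `|x|.
Proof. by rewrite /= expr0n/= addr0 sqrtr_sqr. Qed.

Lemma Re_le_normc z : `|complex.Re z| <= normc z.
Proof.
by rewrite -(@ler_pXn2r _ 2)// ?nnegrE// normc_sqr real_normK ?num_real// lerDl sqr_ge0.
Qed.

Lemma Im_le_normc z : `|complex.Im z| <= normc z.
Proof.
by rewrite -(@ler_pXn2r _ 2)// ?nnegrE// normc_sqr real_normK ?num_real// lerDr sqr_ge0.
Qed.

Lemma normc_le_ReIm z : normc z <= `|complex.Re z| + `|complex.Im z|.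
Proof.
rewrite -(@ler_pXn2r _ 2)// ?nnegrE ?addr_ge0// normc_sqr sqrrD.
by rewrite !real_normK ?num_real// -addrA [_ *+ 2 + _]addrC addrA lerDl mulrn_wge0 ?mulr_ge0.
Qed.

Lemma normcB z w : normc (z - w) = normc (w - z).
Proof. by rewrite -(opprB w z) normcN. Qed.

Lemma normcX z n : normc (z ^+ n) = normc z ^+ n.
Proof. by elim: n => [|n ih]; rewrite ?expr0 ?normc1// !exprS normcM ih. Qed.

Lemma normc_sum (I : Type) (r : seq I) (P : pred I) (F : I -> C) :
  normc (\sum_(i <- r | P i) F i) <= \sum_(i <- r | P i) normc (F i).
Proof.
elim/big_ind2 : _ => //; first by rewrite normc0.
by move=> a b c e ab ce; rewrite (le_trans (le_normcD _ _))// lerD.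
Qed.

(** Reduces bounds on the modulus of a complex increment to bounds on a real part. *)
Lemma normc_rotate z : exists c : C, normc c = 1 /\ complex.Re (c * z) = normc z.
Proof.
have [->|z0] := eqVneq z 0.
  by exists 1; rewrite normc1 mulr0 normc0.
have n0 : normc z != 0 by apply: contra_neq z0 => /eq0_normc.
exists ((normc z)^-1%:C * conjc z); split.
  rewrite normcM normc_real ger0_norm ?invr_ge0//.
  suff -> : normc (conjc z) = normc z by rewrite mulVf.
  by case: (z) => a b /=; rewrite sqrrN.
rewrite !ReImE mul0r subr0.
have -> : complex.Re (conjc z) = complex.Re z by case: (z).
have -> : complex.Im (conjc z) = - complex.Im z by case: (z).
rewrite mul0r addr0 mulrN mulNr opprK -!mulrA -mulrDr -!expr2 -normc_sqr.
by rewrite expr2 mulrA mulVf// mul1r.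
Qed.

End complex_facts.
#[global] Hint Resolve normc_ge0 : core.

(** * Real calculus on the unit interval *)

Section real_calculus.
Context {R : realType}.
Local Notation mu := (@lebesgue_measure R).

(** This form without division matches [cderiv], so a complex derivative passes to real and
    imaginary parts by comparing moduli. *)
Lemma is_derive_le_normP (f : R -> R) (x l : R) :
  (forall e : R, 0 < e -> exists2 r : R, 0 < r &
     forall h, `|h| < r -> `|f (x + h) - f x - l * h| <= e * `|h|) ->
  is_derive x 1 f l.
Proof.
move=> H; have cv : h^-1 *: (f (h *: (1:R) + x) - f x) @[h --> 0^'] --> l.
  apply/cvgrPdist_le => e e0; have [r r0 Hr] := H e e0.
  near=> h.
  have h0 : h != 0 by near: h; exact: nbhs_dnbhs_neq.
  have hr : `|h| < r by near: h; apply: dnbhs0_lt.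
  have := Hr h hr; rewrite -ler_pdivrMr ?normr_gt0// -normrV ?unitfE// -normrM.
  rewrite distrC [h *: _]mulr1 [h + x]addrC.
  congr (`|_| <= _); rewrite /GRing.scale/=.
  by rewrite mulrBl mulfK// mulrC.
have dv : derivable f x 1 by apply/cvg_ex; exists l.
by split=> //; exact/cvg_lim.
Unshelve. all: by end_near. Qed.

Lemma is_derive_affine (p q u : R) : is_derive u (1 : R) (fun x => p + q * x) q.
Proof.
apply: is_derive_le_normP => e e0; exists 1 => // h _.
have -> : p + q * (u + h) - (p + q * u) - q * h = 0 by ring.
by rewrite normr0 mulr_ge0// ltW.
Qed.

Lemma derive_le_increment (f df : R -> R) (a b : R) : a <= b ->
  (forall x : R, x \in `[a, b] -> is_derive x 1 f (df x)) ->
  (forall x : R, x \in `[a, b] -> 0 <= df x) -> f a <= f b.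
Proof.
move=> ab fd df0.
have io (x : R) : x \in `]a, b[ -> x \in `[a, b] by exact: subset_itv_oo_cc.
apply: (@ger0_derive1_ndecr R f a b) => //.
- by move=> x /io/fd[].
- by move=> x /io xab; rewrite derive1E; have [_ ->] := fd x xab; exact: df0.
- by apply: derivable_within_continuous => x /fd[].
Qed.

Lemma FTC2_closed (F f : R -> R) :
  (forall x : R, x \in `[0, 1] -> is_derive x 1 F (f x)) -> continuous f ->
  \int[mu]_(x in `[0, 1]) f x = F 1 - F 0.
Proof.
move=> Ff cf.
have io (x : R) : x \in `]0, 1[ -> x \in `[0, (1:R)] by exact: subset_itv_oo_cc.
have cF (x : R) : x \in `[0, 1] -> {for x, continuous F}.
  by move=> /Ff[dF _]; apply/differentiable_continuous/derivable1_diffP.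
rewrite /Rintegral (@continuous_FTC2 _ f F 0 1)//.
- by apply: continuous_subspaceT.
- split=> [x /io/Ff[]//| |].
  + by apply: cvg_at_right_filter; apply: cF; rewrite bound_itvE.
  + by apply: cvg_at_left_filter; apply: cF; rewrite bound_itvE.
- by move=> x /io/Ff[_ <-]; rewrite derive1E.
Qed.

Lemma antiderivative_exists (f : R -> R) : continuous f ->
  exists F : R -> R, forall x : R, x \in `[0, 1] -> is_derive x 1 F (f x).
Proof.
move=> cf; exists (fun y => \int[mu]_(t in `[-1, y]) f t) => x /andP[x0 x1].
have := @continuous_FTC1_closed R f (-1) x 2.
rewrite /= !bnd_simp in x0 x1.
case.
- by rewrite (le_lt_trans x1)// ltr1n.
- apply: continuous_compact_integrable; first exact: segment_compact.
  exact: continuous_subspaceT.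
- by rewrite (lt_le_trans _ x0)// ltrN10.
- exact: cf.
by move=> d1; rewrite derive1E => <-; exact: DeriveDef.
Qed.

Lemma integrable01 (f : R -> R) : continuous f -> mu.-integrable `[0, 1] (EFin \o f).
Proof.
move=> cf; apply: continuous_compact_integrable; first exact: segment_compact.
exact: continuous_subspaceT.
Qed.

(** Composition with this projection turns continuity along a segment into continuity on the whole
    line, which is what [FTC2_closed] and [integrable01] ask for, without changing integrals over
    [0, 1]. *)
Definition clamp (x : R) := Num.max 0 (Num.min 1 x).

Lemma clamp_id x : x \in `[0, 1] -> clamp x = x.
Proof. by move=> /andP[]; rewrite /= !bnd_simp /clamp => x0 x1; rewrite min_r// max_r. Qed.

Lemma clamp_itv x : clamp x \in `[0, 1].
Proof. by rewrite in_itv/= /clamp le_max lexx/= ge_max ler01/= ge_min lexx. Qed.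

Lemma clamp_lip x y : `|clamp x - clamp y| <= `|x - y|.
Proof.
rewrite ler_norml.
have := ler_norm (x - y); have := ler_norm (y - x); rewrite distrC.
move: `|x - y| => N yx xy; apply/andP.
rewrite /clamp /Num.max /Num.min.
by repeat case: ifPn; rewrite -?leNgt; move=> *; split; lra.
Qed.

Lemma continuous_clamp_comp (f : R -> R) :
  (forall x : R, x \in `[0, 1] -> forall e : R, 0 < e -> exists2 r : R, 0 < r &
     forall y, y \in `[0, 1] -> `|y - x| < r -> `|f y - f x| <= e) ->
  continuous (f \o clamp).
Proof.
move=> H x; apply/cvgrPdist_le => e e0.
have [r r0 Hr] := H (clamp x) (clamp_itv x) e e0.
near=> y; rewrite /= distrC; apply: Hr; first exact: clamp_itv.
apply: (le_lt_trans (clamp_lip _ _)); rewrite distrC.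
near: y; exact: (@cvgr_dist_lt R R^o _ (nbhs x) _ id x cvg_id r r0).
Unshelve. all: by end_near. Qed.

End real_calculus.

(** * Complex derivatives and derivatives along paths *)

Section complex_calculus.
Context {R : realType}.
Local Notation C := R[i].
Implicit Types (f g : C -> C) (a b z w l : C) (F : R -> C).

Definition ccontinuous_at f z := forall e : R, 0 < e -> exists2 r : R, 0 < r &
  forall h, normc h < r -> normc (f (z + h) - f z) <= e.

(** Written with the real-valued [normc], so that all estimates are inequalities between real
    numbers. *)
Definition cderiv f z l := forall e : R, 0 < e -> exists2 r : R, 0 < r &
  forall h, normc h < r -> normc (f (z + h) - f z - l * h) <= e * normc h.

Lemma cderiv_continuous f z l : cderiv f z l -> ccontinuous_at f z.
Proof.
move=> H e e0; have [r r0 Hr] := H 1 ltr01.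
have d0 : 0 < 1 + normc l by rewrite ltr_pwDl ?ltr01 ?normc_ge0.
exists (Num.min r (e / (1 + normc l))); first by rewrite lt_min r0 divr_gt0.
move=> h; rewrite lt_min => /andP[hr he].
have -> : f (z + h) - f z = (f (z + h) - f z - l * h) + l * h by rewrite subrK.
rewrite (le_trans (le_normcD _ _))// normcM.
rewrite (le_trans (lerD (Hr h hr) (lexx _)))// -mulrDl mulrC -ler_pdivlMr//.
exact: ltW.
Qed.

Lemma cderiv_cst c z : cderiv (fun=> c) z 0.
Proof.
by move=> e e0; exists 1 => // h _; rewrite subrr mul0r subr0 normc0 mulr_ge0 ?normc_ge0// ltW.
Qed.

Lemma cderivM f g z l l' : cderiv f z l -> cderiv g z l' ->
  cderiv (fun u => f u * g u) z (l * g z + f z * l').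
Proof.
move=> df dg e e0.
(* [k] collects the coefficients of [e' * normc h] in the three error terms below; [e' <= 1] serves
   to bound the increment of [f] by (1 + |l|) |h|. *)
pose k := normc l + normc (f z) + normc (g z) + 1.
have k0 : 0 < k by rewrite ltr_wpDl ?ltr01 ?addr_ge0 ?normc_ge0.
pose e' := Num.min 1 (e / k).
have e'0 : 0 < e' by rewrite lt_min ltr01 divr_gt0.
have e'1 : e' <= 1 by rewrite ge_min lexx.
have e'k : e' * k <= e by rewrite -ler_pdivlMr// ge_min lexx orbT.
have [r1 r10 H1] := df e' e'0.
have [r2 r20 H2] := dg e' e'0.
have [r3 r30 H3] := cderiv_continuous dg e'0.
exists (Num.min r1 (Num.min r2 r3)); first by rewrite !lt_min r10 r20.
move=> h; rewrite !lt_min => /and3P[h1 h2 h3].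
have -> : f (z + h) * g (z + h) - f z * g z - (l * g z + f z * l') * h =
   (f (z + h) - f z - l * h) * g z + f z * (g (z + h) - g z - l' * h) +
   ((f (z + h) - f z - l * h) + l * h) * (g (z + h) - g z) by ring.
have {}H1 := H1 h h1; have {}H2 := H2 h h2; have {}H3 := H3 h h3.
rewrite (le_trans (le_normcD _ _))// (le_trans (lerD (le_normcD _ _) (lexx _)))//.
rewrite !normcM.
have H4 : normc (f (z + h) - f z - l * h + l * h) <= (1 + normc l) * normc h.
  rewrite (le_trans (le_normcD _ _))// normcM mulrDl lerD// (le_trans H1)//.
  by rewrite ler_wpM2r.
have := ler_wpM2r (normc_ge0 (g z)) H1.
have := ler_wpM2l (normc_ge0 (f z)) H2.
have := ler_pM (normc_ge0 _) (normc_ge0 _) H4 H3.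
have := ler_wpM2r (normc_ge0 h) e'k.
rewrite /k; lra.
Qed.

Definition seg a b (u : R) : C := a + u%:C * (b - a).

Lemma seg0 a b : seg a b 0 = a.
Proof. by rewrite /seg mul0r addr0. Qed.

Lemma seg1 a b : seg a b 1 = b.
Proof. by rewrite /seg mul1r addrC subrK. Qed.

Lemma Im_seg a b u :
  complex.Im (seg a b u) = complex.Im a + u * (complex.Im b - complex.Im a).
Proof. by rewrite /seg !ReImE mul0r addr0. Qed.

Lemma segD a b u v : seg a b (u + v) = seg a b u + v%:C * (b - a).
Proof. by rewrite /seg rmorphD mulrDl addrA. Qed.

Lemma seg_seg a b p q u : seg (seg a b p) (seg a b (p + q)) u = seg a b (p + q * u).
Proof. by rewrite /seg !rmorphD rmorphM/=; ring. Qed.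

Lemma upper_half_seg a b u : upper_half a -> upper_half b ->
  u \in `[0, 1] -> upper_half (seg a b u).
Proof.
rewrite /upper_half/= Im_seg => a0 b0; rewrite in_itv/= => /andP[u0 u1].
nra.
Qed.

Lemma ccontinuous_path f a b (u : R) : ccontinuous_at f (seg a b u) ->
  forall e : R, 0 < e -> exists2 r : R, 0 < r & forall v,
    `|v - u| < r -> normc (f (seg a b v) - f (seg a b u)) <= e.
Proof.
move=> cf e e0; have [r r0 Hr] := cf e e0.
have d0 : 0 < 1 + normc (b - a) by rewrite ltr_pwDl ?ltr01 ?normc_ge0.
exists (r / (1 + normc (b - a))) => [|v uv]; first exact: divr_gt0.
have -> : seg a b v = seg a b u + (v - u)%:C * (b - a).
  by rewrite -segD addrC subrK.
apply: Hr.
rewrite normcM normc_real (le_lt_trans (y := `|v - u| * (1 + normc (b - a))))//.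
  by rewrite ler_wpM2l// lerDr.
by rewrite -ltr_pdivlMr.
Qed.

Lemma continuous_Re_path f a b : (forall u : R, u \in `[0, 1] -> ccontinuous_at f (seg a b u)) ->
  continuous ((fun u => complex.Re (f (seg a b u))) \o @clamp R).
Proof.
move=> cf; apply: continuous_clamp_comp => x x01 e e0.
have [r r0 Hr] := ccontinuous_path (cf x x01) e0; exists r => // y _ /Hr.
by apply: le_trans; rewrite -complex_ReN -complex_ReD Re_le_normc.
Qed.

Lemma continuous_Im_path f a b : (forall u : R, u \in `[0, 1] -> ccontinuous_at f (seg a b u)) ->
  continuous ((fun u => complex.Im (f (seg a b u))) \o @clamp R).
Proof.
move=> cf; apply: continuous_clamp_comp => x x01 e e0.
have [r r0 Hr] := ccontinuous_path (cf x x01) e0; exists r => // y _ /Hr.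
by apply: le_trans; rewrite -complex_ImN -complex_ImD Im_le_normc.
Qed.

Definition path_derive F (u : R) (l : C) :=
  is_derive u 1 (fun x => complex.Re (F x)) (complex.Re l) /\
  is_derive u 1 (fun x => complex.Im (F x)) (complex.Im l).

Lemma path_deriveZ F u l (c : C) : path_derive F u l ->
  path_derive (fun x => c * F x) u (c * l).
Proof.
move=> [dR dI]; split.
  rewrite complex_ReM; under eq_fun do rewrite complex_ReM.
  exact: is_deriveB.
rewrite complex_ImM; under eq_fun do rewrite complex_ImM.
exact: is_deriveD.
Qed.

Lemma path_deriveB F G u l l' : path_derive F u l -> path_derive G u l' ->
  path_derive (fun x => F x - G x) u (l - l').
Proof.
move=> [dR dI] [dR' dI']; split; rewrite !ReImE.
  by under eq_fun do rewrite !ReImE; exact: is_deriveB.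
by under eq_fun do rewrite !ReImE; exact: is_deriveB.
Qed.

Lemma path_derive_affine_comp F (p q u : R) l : path_derive F (p + q * u) l ->
  path_derive (fun x => F (p + q * x)) u (q%:C * l).
Proof.
move=> [dR dI].
have dA := is_derive_affine p q u.
split; rewrite !ReImE mul0r ?subr0 ?addr0 mulrC.
  exact: (@is_derive1_comp R (fun y => complex.Re (F y)) (fun x => p + q * x)).
exact: (@is_derive1_comp R (fun y => complex.Im (F y)) (fun x => p + q * x)).
Qed.

(** A mean value inequality: after a rotation making the increment of [F] real and nonnegative, psi
    - Re (c F) has a nonnegative derivative. *)
Lemma path_increment_le (F : R -> C) (dF : R -> C) (psi dpsi : R -> R) (p q : R) : p <= q ->
  (forall u : R, u \in `[p, q] -> path_derive F u (dF u)) ->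
  (forall u : R, u \in `[p, q] -> is_derive u 1 psi (dpsi u)) ->
  (forall u : R, u \in `[p, q] -> normc (dF u) <= dpsi u) ->
  normc (F q - F p) <= psi q - psi p.
Proof.
move=> pq FdF psid le.
have [c [c1 cE]] := normc_rotate (F q - F p).
rewrite -cE mulrBr complex_ReD complex_ReN.
suff : psi p - complex.Re (c * F p) <= psi q - complex.Re (c * F q) by lra.
apply: (@derive_le_increment R (fun x => psi x - complex.Re (c * F x))
   (fun x => dpsi x - complex.Re (c * dF x)) p q) => // u upq.
  have [dR _] := path_deriveZ c (FdF u upq).
  by apply: is_deriveB; exact: psid.
rewrite subr_ge0 (le_trans _ (le u upq))// (le_trans (ler_norm _))//.
by rewrite (le_trans (Re_le_normc _))// normcM c1 mul1r.
Qed.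

End complex_calculus.

Section segment_integrals.
Context {R : realType}.
Local Notation C := R[i].
Implicit Types (f g : C -> C) (a b c z w l : C) (F : R -> C).

Lemma segint_FTC f a b F :
  (forall u : R, u \in `[0, 1] -> ccontinuous_at f (seg a b u)) ->
  (forall u : R, u \in `[0, 1] -> path_derive F u (f (seg a b u))) ->
  segint f a b = (b - a) * (F 1 - F 0).
Proof.
move=> cf dF; rewrite /segint; congr (_ * _).
apply/eqP; rewrite eq_complex /cintegral01/= !ReImE; apply/andP; split; apply/eqP.
  apply: (etrans _ (@FTC2_closed R (fun u => complex.Re (F u))
    ((fun u => complex.Re (f (seg a b u))) \o @clamp R) _ (continuous_Re_path cf))).
    by apply: eq_Rintegral => u; rewrite inE/= => u01; rewrite clamp_id.
  by move=> u u01; rewrite /= clamp_id//; have [] := dF u u01.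
apply: (etrans _ (@FTC2_closed R (fun u => complex.Im (F u))
  ((fun u => complex.Im (f (seg a b u))) \o @clamp R) _ (continuous_Im_path cf))).
  by apply: eq_Rintegral => u; rewrite inE/= => u01; rewrite clamp_id.
by move=> u u01; rewrite /= clamp_id//; have [] := dF u u01.
Qed.

Lemma path_antiderivative f a b :
  (forall u : R, u \in `[0, 1] -> ccontinuous_at f (seg a b u)) ->
  exists F, forall u : R, u \in `[0, 1] -> path_derive F u (f (seg a b u)).
Proof.
move=> cf.
have [Fr dFr] := antiderivative_exists (continuous_Re_path cf).
have [Fi dFi] := antiderivative_exists (continuous_Im_path cf).
exists (fun u => Fr u +i* Fi u) => u u01; split => /=.
  by have := dFr u u01; rewrite /= clamp_id.
by have := dFi u u01; rewrite /= clamp_id.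
Qed.

Lemma itv01_affine (p q u : R) : p \in `[0, 1] -> p + q \in `[0, 1] ->
  u \in `[0, 1] -> p + q * u \in `[0, 1].
Proof. by rewrite !in_itv/= => /andP[? ?] /andP[? ?] /andP[? ?]; apply/andP; split; nra. Qed.

(** Since [q] may be negative, this covers both the subdivision and the reversal of a segment. *)
Lemma segint_sub f a b F (p q : R) : q != 0 ->
  (forall u : R, u \in `[0, 1] -> ccontinuous_at f (seg a b u)) ->
  (forall u : R, u \in `[0, 1] -> path_derive F u (f (seg a b u))) ->
  p \in `[0, 1] -> p + q \in `[0, 1] ->
  segint f (seg a b p) (seg a b (p + q)) = (b - a) * (F (p + q) - F p).
Proof.
move=> q0 cf dF p01 pq01.
have qC0 : q%:C != 0 by rewrite eq_complex /= negb_and q0.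
rewrite (@segint_FTC f _ _ (fun u => q^-1%:C * F (p + q * u))).
- rewrite mulr1 mulr0 addr0 segD addrC addKr -mulrBr mulrACA -rmorphM/= mulfV//.
  by rewrite mul1r.
- by move=> u u01; rewrite seg_seg; apply: cf; exact: itv01_affine.
- move=> u u01; rewrite seg_seg.
  have := path_derive_affine_comp (dF _ (itv01_affine p01 pq01 u01)).
  move=> /(path_deriveZ (q^-1%:C)); congr (path_derive _ _ _).
  by rewrite mulrA -rmorphM/= mulVf// mul1r.
Qed.

Lemma path_derive_quadratic (k l : C) (u : R) :
  path_derive (fun x => x%:C * k + (x * x)%:C * l) u (k + (2 * u)%:C * l).
Proof.
have D (p q : R) : is_derive u 1 (fun x : R => x * p + x * x * q) (p + 2 * u * q).
  apply: is_derive_le_normP => e e0.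
  exists (e / (1 + `|q|)); first by rewrite divr_gt0// ltr_pwDl.
  move=> h he.
  have -> : (u + h) * p + (u + h) * (u + h) * q - (u * p + u * u * q)
            - (p + 2 * u * q) * h = (h * q) * h by ring.
  rewrite normrM ler_wpM2r// normrM.
  rewrite (le_trans (ler_wpM2r (normr_ge0 q) (ltW he)))//.
  by rewrite mulrAC ler_pdivrMr ?ltr_pwDl// ler_wpM2l ?lerDr// ltW.
split.
  under eq_fun do rewrite !ReImE !mul0r !subr0.
  by rewrite !ReImE mul0r subr0; exact: D.
under eq_fun do rewrite !ReImE !mul0r !addr0.
by rewrite !ReImE mul0r addr0; exact: D.
Qed.

(** The subtracted quantity is the exact integral of the affine function k + l (u - z) along the
    segment. Goursat's argument uses it with the first-order expansion of [f], the construction of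
    primitives with l = 0. *)
Lemma segint_approx f a b z (k l : C) (M : R) :
  (forall u : R, u \in `[0, 1] -> ccontinuous_at f (seg a b u)) ->
  (forall u : R, u \in `[0, 1] -> normc (f (seg a b u) - k - l * (seg a b u - z)) <= M) ->
  normc (segint f a b - ((b - a) * k + l * ((b - z) ^+ 2 - (a - z) ^+ 2) / 2%:R))
    <= normc (b - a) * M.
Proof.
move=> cf fM; have [F dF] := path_antiderivative cf.
pose P (x : R) := x%:C * (k + l * (a - z)) + (x * x)%:C * (l * (b - a) / 2%:R).
have := @path_increment_le R (fun x => F x - P x)
  (fun u => f (seg a b u) - (k + l * (a - z) + (2 * u)%:C * (l * (b - a) / 2%:R)))
  (fun x => 0 + M * x) (fun x => M) 0 1 ler01.
have -> : 0 + M * 1 - (0 + M * 0) = M by ring.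
move=> H; rewrite (segint_FTC cf dF).
have -> : (b - a) * (F 1 - F 0) -
   ((b - a) * k + l * ((b - z) ^+ 2 - (a - z) ^+ 2) / 2%:R) =
   (b - a) * (F 1 - P 1 - (F 0 - P 0)).
  by rewrite /P; field.
rewrite normcM ler_wpM2l ?normc_ge0//; apply: H => u u01.
- by apply: path_deriveB; [exact: dF|exact: path_derive_quadratic].
- exact: is_derive_affine.
- apply: le_trans (fM u u01); rewrite le_eqVlt; apply/orP; left; apply/eqP; congr normc.
  rewrite /seg rmorphM/= -[(2 : R)%:C]/(real_complex R 2%:R) rmorph_nat; by field.
Qed.

End segment_integrals.

(** * Goursat's lemma *)

Section goursat.
Context {R : realType}.
Local Notation C := R[i].
Implicit Types (f g : C -> C) (a b c z w l : C).

(** The intervals of centre x n and radius 2 D / 2^n are nested, so the supremum of their left ends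
    lies in all of them. The explicit rate serves both for shrinking triangles and for random
    series. *)
Lemma shrinking_cvg (x : nat -> R) (D : R) : 0 <= D ->
  (forall n, `|x n.+1 - x n| <= D / 2 ^+ n) ->
  exists y : R, forall n, `|x n - y| <= 2 * D / 2 ^+ n.
Proof.
move=> D0 H; pose e n : R := 2 * D / 2 ^+ n.
have eS n : e n = e n.+1 + D / 2 ^+ n.
  by rewrite /e exprS; field; rewrite expf_neq0.
have e0 n : 0 <= e n by rewrite /e divr_ge0 ?mulr_ge0 ?exprn_ge0.
have lo n k : x n - e n <= x (n + k)%N - e (n + k)%N.
  elim: k => [|k]; first by rewrite addn0.
  move=> /le_trans; apply; rewrite addnS.
  have := H (n + k)%N; have := eS (n + k)%N; rewrite ler_norml => -> /andP[]; lra.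
have up n k : x (n + k)%N + e (n + k)%N <= x n + e n.
  elim: k => [|k]; first by rewrite addn0.
  apply: le_trans; rewrite addnS.
  have := H (n + k)%N; have := eS (n + k)%N; rewrite ler_norml => -> /andP[]; lra.
have lu n m : x n - e n <= x m + e m.
  apply: le_trans (lo n m) _; rewrite addnC; apply: le_trans _ (up m n).
  by rewrite addnC lerD// ge0_cp.
pose S := range (fun n => x n - e n).
have S0 : S !=set0 by exists (x 0%N - e 0%N), 0%N.
exists (sup S) => n; rewrite ler_norml; apply/andP; split.
  rewrite lerBrDr addrC lerBlDr; apply: ge_sup => // _ [m _ <-]; exact: lu.
rewrite lerBlDr -lerBlDl; apply: ub_le_sup; last by exists n.
by exists (x 0%N + e 0%N) => _ [m _ <-].
Qed.

Definition triangle_int f a b c := segint f a b + segint f b c + segint f c a.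

Section triangle.
Variable f : C -> C.
Hypothesis cf : forall z, upper_half z -> ccontinuous_at f z.

Lemma segint_midpoint a b : upper_half a -> upper_half b ->
  segint f a ((a + b) / 2) + segint f ((a + b) / 2) b = segint f a b.
Proof.
move=> a0 b0.
have cs (u : R) : u \in `[0, 1] -> ccontinuous_at f (seg a b u).
  by move=> u01; exact/cf/upper_half_seg.
have [F dF] := path_antiderivative cs.
have mE : (a + b) / 2 = seg a b 2^-1.
  by rewrite /seg rmorphV ?unitfE//= rmorph_nat; field.
have i0 : (0 : R) \in `[0, 1] by rewrite in_itv/=; lra.
have ih : (2^-1 : R) \in `[0, 1] by rewrite in_itv/=; lra.
have i1 : (1 : R) \in `[0, 1] by rewrite in_itv/=; lra.
have hD : 2^-1 + 2^-1 = 1 :> R by field.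
have h0 : (2^-1 : R) != 0 by rewrite invr_eq0 pnatr_eq0.
have := segint_sub (p := 0) (q := 2^-1) h0 cs dF.
have := segint_sub (p := 2^-1) (q := 2^-1) h0 cs dF.
have := segint_sub (p := 0) (q := 1) (oner_neq0 _) cs dF.
by rewrite hD !add0r seg0 seg1 -mE => -> // -> // -> //; ring.
Qed.

Lemma segint_sym a b : upper_half a -> upper_half b -> segint f b a = - segint f a b.
Proof.
move=> a0 b0.
have cs (u : R) : u \in `[0, 1] -> ccontinuous_at f (seg a b u).
  by move=> u01; exact/cf/upper_half_seg.
have [F dF] := path_antiderivative cs.
have i0 : (0 : R) \in `[0, 1] by rewrite in_itv/=; lra.
have i1 : (1 : R) \in `[0, 1] by rewrite in_itv/=; lra.
have N0 : -1 != 0 :> R by rewrite oppr_eq0 oner_neq0.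
have := segint_sub (p := 0) (q := 1) (oner_neq0 _) cs dF.
have := segint_sub (p := 1) (q := -1) N0 cs dF.
by rewrite subrr !add0r seg0 seg1 => -> // -> //; ring.
Qed.

Definition triangle_size (T : C * C * C) := normc (triangle_int f T.1.1 T.1.2 T.2).

(** The bisection step of Goursat's argument: it picks a quarter triangle carrying at least a
    quarter of the integral. The middle one is the default, which [subtriangle_size] justifies. The
    orientations make the inner edges cancel. *)
Definition subtriangle (T : C * C * C) : C * C * C :=
  let: (a, b, c) := T in
  let p := (a + b) / 2 in let q := (b + c) / 2 in let r := (c + a) / 2 in
  if triangle_size T <= 4 * triangle_size (a, p, r) then (a, p, r)
  else if triangle_size T <= 4 * triangle_size (p, b, q) then (p, b, q)
  else if triangle_size T <= 4 * triangle_size (r, q, c) then (r, q, c)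
  else (q, r, p).

(** The lower bound [y] on the heights passes to the limit of the triangles, which keeps the limit
    point in the open half-plane. *)
Definition triangle_inv (y D : R) (T : C * C * C) :=
  [/\ y <= complex.Im T.1.1, y <= complex.Im T.1.2 & y <= complex.Im T.2] /\
  [/\ normc (T.1.2 - T.1.1) <= D, normc (T.2 - T.1.2) <= D & normc (T.1.1 - T.2) <= D].

Lemma Im_midpoint a b : complex.Im ((a + b) / 2) = (complex.Im a + complex.Im b) / 2.
Proof.
have -> : (2 : C)^-1 = (2^-1)%:C by rewrite rmorphV ?unitfE//= rmorph_nat.
by rewrite !ReImE mulr0 add0r.
Qed.

Lemma normc_half z : normc (z / 2) = normc z / 2.
Proof.
have -> : (2 : C)^-1 = (2^-1)%:C by rewrite rmorphV ?unitfE//= rmorph_nat.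
by rewrite normcM normc_real ger0_norm.
Qed.

Lemma subtriangle_inv (y D : R) T : triangle_inv y D T ->
  triangle_inv y (D / 2) (subtriangle T) /\
  normc ((subtriangle T).1.1 - T.1.1) <= D.
Proof.
case: T => [[a b] c] [/= [ya yb yc]] [ab bc ca].
have D0 : 0 <= D := le_trans (normc_ge0 _) ab.
have Da : normc ((a + b) / 2 - a) <= D / 2.
  have -> : (a + b) / 2 - a = (b - a) / 2 by field.
  by rewrite normc_half ler_pM2r.
have E1 : (a + b) / 2 - a = (b - a) / 2 by field.
have E2 : (c + a) / 2 - (a + b) / 2 = (c - b) / 2 by field.
have E3 : a - (c + a) / 2 = (a - c) / 2 by field.
have E4 : b - (a + b) / 2 = (b - a) / 2 by field.
have E5 : (b + c) / 2 - b = (c - b) / 2 by field.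
have E6 : (a + b) / 2 - (b + c) / 2 = (a - c) / 2 by field.
have E7 : (b + c) / 2 - (c + a) / 2 = (b - a) / 2 by field.
have E8 : c - (b + c) / 2 = (c - b) / 2 by field.
have E9 : (c + a) / 2 - c = (a - c) / 2 by field.
have E10 : (c + a) / 2 - (b + c) / 2 = (a - b) / 2 by field.
have E11 : (a + b) / 2 - (c + a) / 2 = (b - c) / 2 by field.
have E12 : (b + c) / 2 - (a + b) / 2 = (c - a) / 2 by field.
have E13 : (b + c) / 2 - a = (b - a) / 2 + (c - a) / 2 by field.
have E14 : (c + a) / 2 - a = (c - a) / 2 by field.
have ab' := ab; have bc' := bc; have ca' := ca.
rewrite normcB in ab'; rewrite normcB in bc'; rewrite normcB in ca'.
have le2 (x : R) : x <= D -> x / 2 <= D / 2 by rewrite ler_pM2r.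
have hD : D / 2 <= D by lra.
rewrite /subtriangle.
case: ifPn => _ /=; [|case: ifPn => _ /=; [|case: ifPn => _ /=]].
- rewrite subrr normc0 /triangle_inv/= E1 E2 E3 !normc_half !Im_midpoint.
  by do !split; rewrite ?le2//; lra.
- rewrite /triangle_inv/= E1 E4 E5 E6 !normc_half !Im_midpoint.
  by do !split; rewrite ?le2//; try lra; apply: le_trans hD; exact: le2.
- rewrite /triangle_inv/= E7 E8 E9 E14 !normc_half !Im_midpoint.
  by do !split; rewrite ?le2//; try lra; apply: le_trans hD; exact: le2.
- rewrite /triangle_inv/= E10 E11 E12 E13 !normc_half !Im_midpoint.
  do !split; rewrite ?le2//; try lra.
  rewrite (le_trans (le_normcD _ _))// !normc_half.
  have := le2 _ ab; have := le2 _ ca'; lra.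
Qed.

(** The inner edges cancel, so the four integrals add up to the integral over [T]. If three of them
    are too small, the fourth is not. *)
Lemma subtriangle_size (y D : R) T : 0 < y -> triangle_inv y D T ->
  triangle_size T <= 4 * triangle_size (subtriangle T).
Proof.
case: T => [[a b] c] y0 [/= [ya yb yc]] _; rewrite /subtriangle.
case: ifPn => // h1; case: ifPn => // h2; case: ifPn => // h3.
move: h1 h2 h3; rewrite -!ltNge.
set p := (a + b) / 2; set q := (b + c) / 2; set r := (c + a) / 2.
have ua : upper_half a := lt_le_trans y0 ya.
have ub : upper_half b := lt_le_trans y0 yb.
have uc : upper_half c := lt_le_trans y0 yc.
have up : upper_half p by rewrite /upper_half/= Im_midpoint; lra.
have uq : upper_half q by rewrite /upper_half/= Im_midpoint; lra.
have ur : upper_half r by rewrite /upper_half/= Im_midpoint; lra.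
have : triangle_size (a, b, c) <= triangle_size (a, p, r) + triangle_size (p, b, q) +
   triangle_size (r, q, c) + triangle_size (q, r, p).
  rewrite /triangle_size/=.
  have -> : triangle_int f a b c = triangle_int f a p r + triangle_int f p b q +
      triangle_int f r q c + triangle_int f q r p.
    rewrite /triangle_int -(segint_midpoint ua ub) -(segint_midpoint ub uc).
    rewrite -(segint_midpoint uc ua) -/p -/q -/r.
    rewrite (segint_sym ur uq) (segint_sym up ur) (segint_sym uq up); ring.
  rewrite (le_trans (le_normcD _ _))// lerD2r (le_trans (le_normcD _ _))// lerD2r.
  by rewrite (le_trans (le_normcD _ _)).
lra.
Qed.

End triangle.

Theorem goursat f a b c : (forall z, upper_half z -> exists l, cderiv f z l) ->
  upper_half a -> upper_half b -> upper_half c -> triangle_int f a b c = 0.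
Proof.
move=> df ua ub uc.
have cf z : upper_half z -> ccontinuous_at f z.
  by move=> /df[l]; exact: cderiv_continuous.
pose y := Num.min (complex.Im a) (Num.min (complex.Im b) (complex.Im c)).
have y0 : 0 < y by rewrite !lt_min; apply/and3P.
pose D := normc (b - a) + normc (c - b) + normc (a - c).
have D0 : 0 <= D by rewrite !addr_ge0// normc_ge0.
pose T n := iter n (subtriangle f) (a, b, c).
have inv n : triangle_inv y (D / 2 ^+ n) (T n).
  elim: n => [|n ih]; last first.
    rewrite exprS invfM mulrCA mulrC; exact: (subtriangle_inv f ih).1.
  rewrite expr0 divr1; split; split => /=; rewrite ?ge_min ?lexx ?orbT//.
  - by rewrite /D -addrA lerDl addr_ge0// normc_ge0.
  - by rewrite /D addrAC lerDr addr_ge0// normc_ge0.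
  - by rewrite /D lerDr addr_ge0// normc_ge0.
have sz n : triangle_size f (a, b, c) <= 4 ^+ n * triangle_size f (T n).
  elim: n => [|n]; first by rewrite mul1r.
  move=> /le_trans; apply; rewrite exprSr -mulrA ler_wpM2l ?exprn_ge0//.
  exact: subtriangle_size (inv n).
have step n : normc ((T n.+1).1.1 - (T n).1.1) <= D / 2 ^+ n.
  exact: (subtriangle_inv f (inv n)).2.
have [n|x Hx] := @shrinking_cvg (fun n => complex.Re (T n).1.1) D D0.
  by rewrite -complex_ReN -complex_ReD (le_trans (Re_le_normc _)).
have [n|v Hv] := @shrinking_cvg (fun n => complex.Im (T n).1.1) D D0.
  by rewrite -complex_ImN -complex_ImD (le_trans (Im_le_normc _)).
pose z := x +i* v.
have Hz n : normc ((T n).1.1 - z) <= 4 * D / 2 ^+ n.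
  rewrite (le_trans (normc_le_ReIm _))// !ReImE /=.
  have := Hx n; have := Hv n.
  have -> : 4 * D / 2 ^+ n = 2 * D / 2 ^+ n + 2 * D / 2 ^+ n :> R.
    by rewrite -mulrDl -mulrDl -natrD.
  lra.
have small (e : R) : 0 < e -> exists n, D / 2 ^+ n < e.
  move=> e0; exists (Num.truncn (D / e)).+1; rewrite ltr_pdivrMr ?exprn_gt0//.
  rewrite mulrC -ltr_pdivrMr// (lt_le_trans (truncnS_gt _))//.
  by rewrite -natrX ler_nat ltnW// ltn_expl.
have uz : upper_half z.
  rewrite /upper_half/=; have [//|v0] := ltP 0 v.
  have [n Hn] := small (y / 2) (divr_gt0 y0 (ltr0n _ 2)).
  have := Hv n; have [[yn _ _] _] := inv n; rewrite -mulrA.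
  by move: yn; rewrite ler_norml => ? /andP[]; lra.
have [l dl] := df z uz.
apply: eq0_normc; apply/eqP; rewrite eq_le normc_ge0 andbT.
(* With dn = D / 2^n, each of the three sides has length at most dn and its points are within 5 dn
   of z, namely 4 dn for the first vertex and dn more. The error is at most 3 dn (5 dn e), and 4^n
   dn^2 = D^2. *)
suff H (e : R) : 0 < e -> normc (triangle_int f a b c) <= 15 * D * D * e.
  apply/ler_addgt0Pr => e e0; rewrite add0r.
  have k0 : 0 < 15 * D * D + 1 by rewrite ltr_wpDl// !mulr_ge0.
  rewrite (le_trans (H (e / (15 * D * D + 1)) _)) ?divr_gt0//.
  by rewrite mulrA ler_pdivrMr// mulrC ler_wpM2l ?lerDl// ltW.
move=> e0; have [r r0 Hr] := dl e e0.
have [n Hn] := small (r / 5) (divr_gt0 r0 (ltr0n _ 5)).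
have [[yA yB yC] [AB BC CA]] := inv n.
have := Hz n; have := sz n; have := AB; have := BC; have := CA.
rewrite [triangle_size f (a, b, c)]/triangle_size/=.
case: (T n) yA yB yC AB BC CA => [[A B] G] /= yA yB yC AB BC CA _ _ _ sn Az.
set dn := D / 2 ^+ n in Hn AB BC CA.
have Az' : normc (A - z) <= 4 * dn by rewrite /dn mulrA.
have uA : upper_half A := lt_le_trans y0 yA.
have uB : upper_half B := lt_le_trans y0 yB.
have uG : upper_half G := lt_le_trans y0 yC.
have near_z w : normc (w - A) <= dn -> normc (f w - f z - l * (w - z)) <= e * (5 * dn).
  move=> wA; have wz : normc (w - z) <= 5 * dn.
    have -> : w - z = (w - A) + (A - z) by rewrite addrA subrK.
    by rewrite (le_trans (le_normcD _ _))//; lra.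
  have zw : z + (w - z) = w by rewrite addrC subrK.
  have := Hr (w - z); rewrite zw => /(_ _)/le_trans; apply.
    by apply: le_lt_trans wz _; lra.
  by rewrite ler_wpM2l// ltW.
have dn0 : 0 <= dn := le_trans (normc_ge0 _) AB.
have seg_near a' b' (u : R) : normc (a' - A) <= dn -> normc (b' - A) <= dn ->
    u \in `[0, 1] -> normc (seg a' b' u - A) <= dn.
  rewrite in_itv/= => ha hb /andP[u0 u1].
  have -> : seg a' b' u - A = (1 - u)%:C * (a' - A) + u%:C * (b' - A).
    by rewrite /seg rmorphB/=; ring.
  rewrite (le_trans (le_normcD _ _))// !normcM !normc_real !ger0_norm ?subr_ge0//.
  have := ler_wpM2l u0 hb; have : 0 <= 1 - u by lra.
  move=> /ler_wpM2l/(_ _ _ ha); lra.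
have AA : normc (A - A) <= dn by rewrite subrr normc0.
have GA : normc (G - A) <= dn by rewrite normcB.
have side a' b' : upper_half a' -> upper_half b' -> normc (a' - A) <= dn ->
  normc (b' - A) <= dn -> normc (b' - a') <= dn ->
  normc (segint f a' b' - ((b' - a') * f z + l * ((b' - z) ^+ 2 - (a' - z) ^+ 2) / 2%:R))
    <= dn * (e * (5 * dn)).
  move=> ua' ub' ha hb hab.
  apply: (@le_trans _ _ (normc (b' - a') * (e * (5 * dn)))).
    apply: segint_approx => u u01; first exact/cf/upper_half_seg.
    by apply: near_z; exact: seg_near.
  by rewrite ler_wpM2r// !mulr_ge0// ltW.
have := side _ _ uA uB AA AB AB; have := side _ _ uB uG AB GA BC.
have := side _ _ uG uA GA AA CA.
rewrite /triangle_size/= in sn => s1 s2 s3.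
apply: (le_trans sn).
have -> : 15 * D * D * e = 4 ^+ n * (dn * (e * (5 * dn)) + dn * (e * (5 * dn)) + dn * (e * (5 * dn))).
  rewrite /dn (_ : 4 = 2 ^+ 2 :> R); last by rewrite -natrX.
  by rewrite -exprM mulnC exprM; field; rewrite expf_neq0.
rewrite ler_wpM2l ?exprn_ge0//.
(* The contributions of the affine approximation telescope to zero around the triangle, so only the
   three errors are left. *)
rewrite [X in normc X](_ : _ =
  (segint f A B - ((B - A) * f z + l * ((B - z) ^+ 2 - (A - z) ^+ 2) / 2%:R)) +
  (segint f B G - ((G - B) * f z + l * ((G - z) ^+ 2 - (B - z) ^+ 2) / 2%:R)) +
  (segint f G A - ((A - G) * f z + l * ((A - z) ^+ 2 - (G - z) ^+ 2) / 2%:R))); last first.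
  by rewrite /triangle_int; field.
rewrite (le_trans (le_normcD _ _))// lerD// (le_trans (le_normcD _ _))// lerD//.
Qed.

End goursat.

(** * Primitives and power series *)

Section holomorphic.
Context {R : realType}.
Local Notation C := R[i].
Implicit Types (f g : C -> C) (a b c s z w l : C).

(** Goursat's lemma on the triangle s, z, z + h turns the increment of the primitive into the
    integral over the short side from z to z + h, where [f] is nearly constant. *)
Lemma segint_cderiv f s z : (forall w, upper_half w -> exists l, cderiv f w l) ->
  upper_half s -> upper_half z -> cderiv (fun u => segint f s u) z (f z).
Proof.
move=> df us uz e e0.
have cf w : upper_half w -> ccontinuous_at f w.
  by move=> /df[l]; exact: cderiv_continuous.
have [r r0 Hr] := cf z uz e e0.
exists (Num.min r (complex.Im z)); first by rewrite lt_min r0.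
move=> h; rewrite lt_min => /andP[hr hz].
have uh : upper_half (z + h).
  rewrite /upper_half/= complex_ImD -ltrBlDr sub0r.
  have := le_lt_trans (Im_le_normc h) hz; rewrite ltr_norml => /andP[]; lra.
have -> : segint f s (z + h) - segint f s z = segint f z (z + h).
  have := goursat df us uz uh; rewrite /triangle_int (segint_sym cf us uh).
  by move/eqP; rewrite addr_eq0 opprK => /eqP <-; ring.
have cs (u : R) : u \in `[0, 1] -> ccontinuous_at f (seg z (z + h) u).
  by move=> u01; exact/cf/upper_half_seg.
have := @segint_approx _ f z (z + h) z (f z) 0 e cs.
rewrite !mul0r addr0 [z + h]addrC addrK [h + z]addrC [h * _]mulrC [e * _]mulrC.
apply=> u; rewrite in_itv/= => /andP[u0 u1].
rewrite mul0r subr0 /seg [_ + h - z]addrC addKr; apply: Hr.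
rewrite normcM normc_real ger0_norm//.
by apply: le_lt_trans hr; rewrite ler_piMl ?normc_ge0.
Qed.

Lemma geometric_partial_sum_le2 (t : R) n : 0 <= t <= 2^-1 -> \sum_(k < n) t ^+ k <= 2.
Proof.
move=> /andP[t0 t1]; elim: n => [|n ih]; first by rewrite big_ord0.
rewrite big_ord_recl expr0; under eq_bigr do rewrite exprS.
rewrite -mulr_sumr; have : 0 <= \sum_(i < n) t ^+ i by apply: sumr_ge0 => ? _; rewrite exprn_ge0.
by move: ih; set S := \sum_(i < n) _ => S2 S0; nra.
Qed.

(** Convergence at the radius q = rho / 2 bounds |a k| q^k. For |h| <= q / 2 the terms of order at
    least two are then dominated by a geometric series, and the remainder is quadratic in h. *)
Lemma analytic_cderiv f z : analytic_at f z -> exists l, cderiv f z l.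
Proof.
move=> [rho rho0 [a Ha]]; exists (a 1%N).
have f0 : f z = a 0%N.
  have := Ha 0; rewrite normc0 => /(_ rho0) H.
  apply/eqP; rewrite -subr_eq0; apply/eqP/eq0_normc/eqP.
  rewrite eq_le normc_ge0 andbT; apply/ler_addgt0Pr => e e0.
  have /cvgrPdist_lt/(_ e e0)[N _ HN] := H; have := HN N.+1 (leqnSn N).
  rewrite /= sub0r normrN ger0_norm ?normc_ge0// addr0.
  rewrite big_ord_recl expr0 mulr1 big1 ?addr0; last by move=> i _; rewrite expr0n mulr0.
  by rewrite add0r => /ltW.
pose q := rho / 2.
have q0 : 0 < q by rewrite divr_gt0.
have qrho : normc q%:C < rho by rewrite normc_real gtr0_norm// /q; lra.
(* A term of the series is the difference of two consecutive remainders, and the remainders are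
   bounded because they converge. *)
have [M0 Mp M1] : exists2 M : R, 0 < M & forall k, normc (a k) * q ^+ k <= M.
  have /cvg_seq_bounded := cvgP _ (Ha _ qrho).
  move=> [B [Br HB]]; pose B' := Num.max B 0 + 1.
  have {}HB N : normc (f (z + q%:C) - \sum_(k < N) a k * q%:C ^+ k) <= B'.
    have BB : B < B' by rewrite /B' ltr_pwDr// le_max lexx.
    by have := HB B' BB N I; rewrite /= ger0_norm ?normc_ge0.
  exists (2 * B'); first by rewrite mulr_gt0// /B' ltr_pwDr// le_max lexx orbT.
  move=> k; have := HB k; have := HB k.+1; rewrite big_ord_recr/=.
  set S := \sum_(i < k) _ => h1 h2.
  have -> : normc (a k) * q ^+ k = normc (a k * q%:C ^+ k).
    by rewrite normcM normcX normc_real gtr0_norm.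
  have -> : a k * q%:C ^+ k = (f (z + q%:C) - S) - (f (z + q%:C) - (S + a k * q%:C ^+ k)).
    by ring.
  rewrite (le_trans (le_normcD _ _))// normcN; lra.
have quad h : normc h <= q / 2 ->
    normc (f (z + h) - f z - a 1%N * h) <= 2 * M0 * (normc h / q) ^+ 2.
  move=> hq; have hrho : normc h < rho.
    by apply: le_lt_trans hq _; rewrite /q; lra.
  set t := normc h / q; set e0 := 2 * M0 * t ^+ 2.
  have t01 : 0 <= t <= 2^-1.
    apply/andP; split; first by rewrite /t divr_ge0 ?normc_ge0// ltW.
    by rewrite /t ler_pdivrMr// mulrC.
  have t0 : 0 <= t by case/andP: t01.
  apply/ler_addgt0Pr => e ep.
  have /cvgrPdist_lt/(_ e ep)[N _ HN] := Ha h hrho.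
  have := HN (N.+2) (leqW (leqW (leqnn _))).
  rewrite /= sub0r normrN ger0_norm ?normc_ge0// => HN'.
  set S := \sum_(k < N.+2) a k * h ^+ k in HN'.
  have -> : f (z + h) - f z - a 1%N * h = (f (z + h) - S) + (S - a 0%N - a 1%N * h).
    by rewrite f0; ring.
  rewrite (le_trans (le_normcD _ _))// addrC lerD// ?(ltW HN')//.
  rewrite /S !big_ord_recl expr0 mulr1 expr1 /bump/= [a 0%N + _]addrC addrK addrC addrA.
  rewrite [- _ + _]addrC subrr add0r (le_trans (normc_sum _ xpredT _))//.
  apply: (@le_trans _ _ (\sum_(k < N) M0 * t ^+ 2 * t ^+ k)); last first.
    have Mt : 0 <= M0 * t ^+ 2 by rewrite mulr_ge0 ?exprn_ge0// ltW.
    rewrite -mulr_sumr /e0 -[2 * M0 * _]mulrA [leRHS]mulrC.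
    by rewrite ler_wpM2l// geometric_partial_sum_le2.
  apply: ler_sum => k _; rewrite normcM normcX.
  have -> : normc h = q * t by rewrite /t mulrC divfK// gt_eqF.
  rewrite /bump/= !add1n -mulrA -exprD add2n exprMn mulrA ler_wpM2r ?exprn_ge0 ?M1//.
move=> e e0.
have k0 : 0 < 2 * M0 / q ^+ 2 by rewrite divr_gt0 ?mulr_gt0 ?exprn_gt0.
exists (Num.min (q / 2) (e / (2 * M0 / q ^+ 2))).
  by rewrite lt_min (divr_gt0 q0)//= (divr_gt0 e0 k0).
move=> h; rewrite lt_min => /andP[h1 h2]; rewrite (le_trans (quad h (ltW h1)))//.
rewrite expr_div_n mulrA mulrAC expr2 mulrA ler_wpM2r ?normc_ge0//.
by rewrite mulrC -ler_pdivlMr// ltW.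
Qed.

End holomorphic.

(** * Pathwise bounds for iterated integrals *)

Section iterated_integrals.
Context {R : realType}.
Local Notation C := R[i].
Local Notation mu := (@lebesgue_measure R).
Variables (d : nat) (f : 'I_d -> C -> C).
Hypothesis df : forall i w, upper_half w -> exists l, cderiv (f i) w l.
Implicit Types (a b c s t z : C) (I : seq 'I_d).

Lemma path_derive_cderiv (g : C -> C) a b (u : R) l : cderiv g (seg a b u) l ->
  path_derive (fun x => g (seg a b x)) u ((b - a) * l).
Proof.
move=> dg; have H (e : R) : 0 < e -> exists2 r : R, 0 < r & forall h, `|h| < r ->
    normc (g (seg a b (u + h)) - g (seg a b u) - (b - a) * l * h%:C) <= e * `|h|.
  move=> e0; pose k := 1 + normc (b - a).
  have k0 : 0 < k by rewrite ltr_pwDl ?ltr01 ?normc_ge0.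
  have [r r0 Hr] := dg (e / k) (divr_gt0 e0 k0).
  exists (r / k); first exact: divr_gt0.
  move=> h hr; rewrite segD.
  have hk : normc (h%:C * (b - a)) <= `|h| * k.
    by rewrite normcM normc_real ler_wpM2l// lerDr.
  have -> : (b - a) * l * h%:C = l * (h%:C * (b - a)) by ring.
  rewrite (le_trans (Hr _ _))//.
    by rewrite (le_lt_trans hk)// -ltr_pdivlMr.
  apply: (le_trans (ler_wpM2l (ltW (divr_gt0 e0 k0)) hk)).
  by rewrite le_eqVlt; apply/orP; left; apply/eqP; field; rewrite gt_eqF.
split; apply: is_derive_le_normP => e /H[r r0 Hr]; exists r => // h /Hr; apply: le_trans.
  apply: le_trans (Re_le_normc _); rewrite !ReImE;
    rewrite le_eqVlt; apply/orP; left; apply/eqP; congr `|_|; ring.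
by apply: le_trans (Im_le_normc _); rewrite !ReImE;
    rewrite le_eqVlt; apply/orP; left; apply/eqP; congr `|_|; ring.
Qed.

Lemma iterint_holomorphic I s z : upper_half s -> upper_half z ->
  exists l, cderiv (fun u => iterint f I u s) z l.
Proof.
move=> us; elim: I z => [|i I ih] z uz /=; first by exists 0; exact: cderiv_cst.
exists (f i z * iterint f I z s).
apply: (segint_cderiv (f := fun u => f i u * iterint f I u s)) => // w uw.
have [l fl] := df i uw; have [l' Il] := ih w uw.
by exists (l * iterint f I w s + f i w * l'); exact: cderivM.
Qed.

Lemma iterint_cderiv i I s z : upper_half s -> upper_half z ->
  cderiv (fun u => iterint f (i :: I) u s) z (f i z * iterint f I z s).
Proof.
move=> us uz.
apply: (segint_cderiv (f := fun u => f i u * iterint f I u s)) => // w uw.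
have [l fl] := df i uw; have [l' Il] := iterint_holomorphic I us uw.
by exists (l * iterint f I w s + f i w * l'); exact: cderivM.
Qed.

(** The sum over all indices gives a single cost for all words, whichever letter comes first. *)
Definition speed (z : C) : R := \sum_i normc (f i z).

Definition cost a b : R := normc (b - a) * \int[mu]_(u in `[0, 1]) speed (seg a b u).

Lemma speed_ge0 z : 0 <= speed z.
Proof. by apply: sumr_ge0 => i _; exact: normc_ge0. Qed.

Lemma cost_ge0 a b : 0 <= cost a b.
Proof.
by rewrite mulr_ge0 ?normc_ge0// Rintegral_ge0// => u _; exact: speed_ge0.
Qed.

Lemma continuous_speed_path a b : upper_half a -> upper_half b ->
  continuous ((fun u => speed (seg a b u)) \o @clamp R).
Proof.
move=> ua ub.
pose G i := (fun u => normc (f i (seg a b u))) \o @clamp R.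
suff cG i : continuous (G i).
  exact: (@continuous_big R _ +%R 0 xpredT
    (@pseudometric_normed_Zmodule.add_continuous R R) R (index_enum _) G (fun i _ => cG i)).
apply: continuous_clamp_comp => x x01 e e0.
have uz := upper_half_seg ua ub x01; have [l fl] := df i uz.
have [r r0 Hr] := ccontinuous_path (cderiv_continuous fl) e0.
exists r => // y _ /Hr; apply: le_trans.
move: (f i _) (f i _) => w v.
have h1 : normc v <= normc (v - w) + normc w by rewrite (le_trans _ (le_normcD _ _))// subrK.
have h2 : normc w <= normc (v - w) + normc v.
  by rewrite normcB (le_trans _ (le_normcD _ _))// subrK.
rewrite ler_norml; apply/andP; split; lra.
Qed.

Lemma iterint_step a b s (L : R) : upper_half a -> upper_half b -> upper_half s -> 0 <= L ->
  (forall I, normc (iterint f I a s) <= L ^+ size I / (size I)`!%:R) ->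
  forall I, normc (iterint f I b s - iterint f I a s) <=
    ((L + cost a b) ^+ size I - L ^+ size I) / (size I)`!%:R.
Proof.
move=> ua ub us L0 HL.
have cg := continuous_speed_path ua ub.
have [Q dQ] := antiderivative_exists cg.
pose k := normc (b - a).
(* [Lam u] is [L] plus the cost of the part of the segment already travelled. The derivative of
   Lam^(n+1) / (n+1)! is Lam^n / n! times that of Lam, which dominates the speed of the iterated
   integral by the induction hypothesis. *)
pose Lam (u : R) := L + k * (Q u - Q 0).
have dLam (u : R) : u \in `[0, 1] -> is_derive u 1 Lam (k * speed (seg a b u)).
  move=> u01; have := dQ u u01; rewrite /= clamp_id// => dQu.
  have -> : Lam = (fun u => (L - k * Q 0) + k * u) \o Q.
    by apply/funext => v; rewrite /Lam/=; ring.
  apply: is_derive1_comp; exact: is_derive_affine.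
have Lam0 : Lam 0 = L by rewrite /Lam subrr mulr0 addr0.
have Lam1 : Lam 1 = L + cost a b.
  rewrite /Lam /cost -/k; congr (_ + _ * _).
  rewrite -(FTC2_closed dQ cg); apply: eq_Rintegral => u; rewrite inE/= => u01.
  by rewrite clamp_id.
have i0 (u v : R) : u \in `[0, 1] -> v \in `[0, u] -> v \in `[0, 1].
  by rewrite !in_itv/= => /andP[? ?] /andP[-> /le_trans]; apply.
(* The bound is proved at every point of the segment, since the induction on the word integrates the
   bound for the shorter word. *)
suff H I (u : R) : u \in `[0, 1] -> normc (iterint f I (seg a b u) s - iterint f I a s) <=
    (Lam u ^+ size I - L ^+ size I) / (size I)`!%:R.
  by move=> I; have := H I 1; rewrite seg1 Lam1; apply; rewrite in_itv/= ler01 lexx.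
elim: I u => [|i I ih] u u01.
  have -> : iterint f [::] (seg a b u) s - iterint f [::] a s = 0 by rewrite subrr.
  by rewrite normc0 !expr0 subrr mul0r.
pose n := size I; rewrite [size _]/=.
have fn0 m : (m`!%:R : R) != 0 by rewrite pnatr_eq0 gtn_eqF// fact_gt0.
have := @path_increment_le R (fun x => iterint f (i :: I) (seg a b x) s)
  (fun x => (b - a) * (f i (seg a b x) * iterint f I (seg a b x) s))
  (fun x => Lam x ^+ n.+1 / (n.+1)`!%:R) (fun x => Lam x ^+ n / n`!%:R * (k * speed (seg a b x)))
  0 u.
rewrite seg0 Lam0 -mulrBl; apply.
- by move: u01; rewrite in_itv/= => /andP[].
- move=> v /(i0 _ _ u01) v01; apply: path_derive_cderiv; apply: iterint_cderiv => //.
  exact: upper_half_seg.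
- move=> v /(i0 _ _ u01) v01.
  have dn := is_deriveX n.+1 (dLam v v01).
  have -> : (fun x => Lam x ^+ n.+1 / (n.+1)`!%:R) =
      (fun x => 0 + (n.+1)`!%:R^-1 * x) \o ((Lam : R -> R) ^+ n.+1).
    by apply/funext => x; rewrite /= add0r mulrC; congr (_ * _); elim: n.+1 => [|m im]//;
       rewrite !exprS im.
  have := @is_derive1_comp R (fun x => 0 + (n.+1)`!%:R^-1 * x) (Lam ^+ n.+1) v _ _
    (is_derive_affine 0 (n.+1)`!%:R^-1 _) dn.
  congr (is_derive _ _ _ _); rewrite /GRing.scale/=.
  have c0 : (n.+1%:R : R) != 0 by rewrite pnatr_eq0.
  rewrite factS natrM/=; move: (fn0 n) c0; move: (n`!%:R) (n.+1%:R) => x y x0 y0.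
  by field; rewrite x0 y0.
- move=> v /(i0 _ _ u01) v01; rewrite !normcM -/k.
  rewrite [leRHS]mulrCA ler_wpM2l ?normc_ge0// mulrC ler_pM ?normc_ge0//.
    have -> : iterint f I (seg a b v) s =
      (iterint f I (seg a b v) s - iterint f I a s) + iterint f I a s by rewrite subrK.
    rewrite (le_trans (le_normcD _ _))// (le_trans (lerD (ih v v01) (HL I)))//.
    by rewrite -mulrDl subrK.
  by rewrite /speed (bigD1 i)//= lerDl sumr_ge0// => j _; exact: normc_ge0.
Qed.

(** The factor [y] is split off because it will be the cost between the two end points of an
    increment, the source of |t - s|^(2 alpha). *)
Lemma sub_exprD_le (x y : R) n : 0 <= x -> 0 <= y ->
  (x + y) ^+ n.+1 - x ^+ n.+1 <= n.+1%:R * (y * (x + y) ^+ n).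
Proof.
move=> x0 y0; elim: n => [|n ih]; first by rewrite !expr1 expr0; lra.
rewrite [in leLHS]exprS [x ^+ n.+2]exprS -(natr1 n.+1) [(n.+1%:R + 1) * _]mulrDl mul1r.
have -> : (x + y) * (x + y) ^+ n.+1 - x * x ^+ n.+1 =
  (x + y) * ((x + y) ^+ n.+1 - x ^+ n.+1) + y * x ^+ n.+1 by ring.
apply: lerD.
  rewrite (le_trans (ler_wpM2l (addr_ge0 x0 y0) ih))// [(x + y) ^+ n.+1]exprS.
  by rewrite le_eqVlt; apply/orP; left; apply/eqP; ring.
by rewrite ler_wpM2l// lerXn2r ?nnegrE ?addr_ge0// lerDl.
Qed.

(* Follow the path s0 -> p -> s -> q -> t, whose second half carries the increment. *)
Lemma iterint_increment I s0 p s q t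
    (A := cost s0 p + cost p s) (B := cost s q + cost q t) :
  upper_half s0 -> upper_half p -> upper_half s -> upper_half q -> upper_half t -> I != [::] ->
  normc (iterint f I t s0 - iterint f I s s0) <=
    B * (A + B) ^+ (size I).-1 / ((size I).-1)`!%:R.
Proof.
move=> us0 up us uq ut I0.
have cA := cost_ge0; have fn0 m : (0 : R) < m`!%:R by rewrite ltr0n fact_gt0.
pose bnd L a := forall J, normc (iterint f J a s0) <= L ^+ size J / (size J)`!%:R.
have next L a b : upper_half a -> upper_half b -> 0 <= L -> bnd L a -> bnd (L + cost a b) b.
  move=> ua ub L0 H J.
  have -> : iterint f J b s0 = (iterint f J b s0 - iterint f J a s0) + iterint f J a s0.
    by rewrite subrK.
  rewrite (le_trans (le_normcD _ _))//.
  rewrite (le_trans (lerD (iterint_step ua ub us0 L0 H J) (H J)))//.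
  by rewrite -mulrDl subrK.
(* At the base point [L = 0] is allowed: the empty word gives 1 = 0^0 / 0!, and all other integrals
   vanish. *)
have b0 : bnd 0 s0.
  case=> [|i J]; first by rewrite expr0 divr1 [iterint _ _ _ _]/= normc1.
  have -> : iterint f (i :: J) s0 s0 = 0 by rewrite /= /segint subrr mul0r.
  by rewrite normc0 exprS !mul0r.
have bp : bnd (0 + cost s0 p) p by exact: next.
have bs : bnd A s by rewrite /A -[cost s0 p]add0r; apply: next; rewrite // add0r.
have A0 : 0 <= A by rewrite /A addr_ge0.
have B0 : 0 <= B by rewrite /B addr_ge0.
have bq : bnd (A + cost s q) q by exact: next.
have h1 := iterint_step us uq us0 A0 bs I.
have h2 := iterint_step uq ut us0 (addr_ge0 A0 (cA _ _)) bq I.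
have -> : iterint f I t s0 - iterint f I s s0 =
  (iterint f I t s0 - iterint f I q s0) + (iterint f I q s0 - iterint f I s s0) by ring.
rewrite (le_trans (le_normcD _ _))// (le_trans (lerD h2 h1))//.
rewrite -addrA -/B -mulrDl addrA subrK.
case: I I0 {h1 h2} => // i I _; rewrite [size _]/= [_.-1]/=.
rewrite ler_pdivrMr// (le_trans (sub_exprD_le _ A0 B0))// factS natrM.
rewrite le_eqVlt; apply/orP; left; apply/eqP.
move: (fn0 (size I)); move: ((size I)`!%:R : R) => x x0.
by field; rewrite gt_eqF.
Qed.

End iterated_integrals.

(** * Measurability of parametric integrals *)

Section caratheodory.
Context {d0 : measure_display} {T : measurableType d0} {R : realType}.
Local Notation mu := (@lebesgue_measure R).

Lemma measurable_clamp : measurable_fun setT (@clamp R).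
Proof.
apply: continuous_measurable_fun.
apply: (@continuous_clamp_comp R id) => x _ e e0; exists e => // y _ /ltW; apply.
Qed.

(* Caratheodory functions are limits of functions that are piecewise constant
   in the second variable. *)
Lemma measurable_caratheodory (h : T -> R -> R) :
  (forall u : R, u \in `[0, 1] -> measurable_fun setT (h ^~ u)) ->
  (forall x, continuous (h x \o @clamp R)) ->
  measurable_fun setT (fun z : T * R => h z.1 (clamp z.2)).
Proof.
move=> mh ch; pose k (n : nat) (u : R) := Num.truncn (n.+1%:R * clamp u).
have k1 n u : (k n u)%:R / n.+1%:R \in `[0, (1 : R)].
  have := clamp_itv u; rewrite !in_itv/= => /andP[u0 u1].
  rewrite divr_ge0// ler_pdivrMr// mul1r.
  apply: (@le_trans _ _ (n.+1%:R * clamp u)); first by rewrite truncn_le mulr_ge0.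
  by rewrite ler_piMr.
apply: (@measurable_fun_cvg _ _ _ setT
  (fun n (z : T * R) => h z.1 ((k n z.2)%:R / n.+1%:R))).
  move=> n _ B mB; rewrite setTI.
  have -> : (fun z : T * R => h z.1 ((k n z.2)%:R / n.+1%:R)) @^-1` B =
    \bigcup_j ([set x | (j <= n.+1)%N /\ B (h x (j%:R / n.+1%:R))] `*` [set u | k n u = j]).
    apply/seteqP; split => [[x u]/= Bx|[x u] [j _ /= [[_ Bx]] ->//]].
    exists (k n u) => //=; split => //; split => //.
    have := k1 n u; rewrite in_itv/= => /andP[_].
    by rewrite ler_pdivrMr// mul1r ler_nat.
  apply: bigcupT_measurable => j; apply: measurableX.
    case: (leqP j n.+1) => jn; last first.
      by rewrite (_ : [set _ | _] = set0)//; apply/seteqP; split => // x [].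
    rewrite (_ : [set _ | _] = setT `&` (h ^~ (j%:R / n.+1%:R)) @^-1` B).
      apply: mh => //; rewrite in_itv/= divr_ge0// ler_pdivrMr// mul1r.
      by rewrite ler_nat.
    by apply/seteqP; split => x //= [].
  rewrite (_ : [set _ | _] = setT `&` (fun u => n.+1%:R * clamp u) @^-1` `[j%:R, j.+1%:R[).
    have mc : measurable_fun setT (fun u : R => n.+1%:R * clamp u).
      by apply: measurable_funM => //; exact: measurable_clamp.
    exact: mc.
  apply/seteqP; split => u /=; rewrite ?setTI in_itv/=.
    move=> <-; split => //; rewrite truncn_le ?truncnS_gt//.
    by rewrite mulr_ge0//; have := clamp_itv u; rewrite in_itv/= => /andP[].
  by move=> [_ H]; apply/truncn_def.
move=> [x u] _ /=; have := ch x (clamp u); rewrite /continuous_at /= (clamp_id (clamp_itv u)) => cx.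
have -> : (fun n => h x ((k n u)%:R / n.+1%:R)) =
    (h x \o @clamp R) \o (fun n => (k n u)%:R / n.+1%:R).
  by apply/funext => n /=; rewrite clamp_id.
apply: (@cvg_comp _ _ _ (fun n => (k n u)%:R / n.+1%:R) (h x \o @clamp R) \oo
  (nbhs (clamp u)) _ _ cx); apply/cvgrPdist_lt => e e0.
near=> n; have n0 : (0 : R) < n.+1%:R by rewrite ltr0n.
have c0 : 0 <= n.+1%:R * clamp u.
  by rewrite mulr_ge0//; have := clamp_itv u; rewrite in_itv/= => /andP[].
have /andP[h1 h2] := truncn_itv c0; rewrite -/(k n u) in h1 h2.
have -> : clamp u - (k n u)%:R / n.+1%:R = (n.+1%:R * clamp u - (k n u)%:R) / n.+1%:R.
  by rewrite mulrBl mulrAC divff ?mul1r// gt_eqF.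
rewrite ger0_norm ?divr_ge0 ?subr_ge0//.
apply: (@le_lt_trans _ _ (n.+1%:R^-1)).
  by rewrite ler_pdivrMr// mulVf ?gt_eqF// lerBlDr addrC natr1 ltW.
by near: n; exact: near_infty_natSinv_lt (PosNum e0).
Unshelve. all: by end_near. Qed.

Lemma measurable_Rintegral_param (h : T -> R -> R) :
  (forall u : R, u \in `[0, 1] -> measurable_fun setT (h ^~ u)) ->
  (forall x, continuous (h x \o @clamp R)) ->
  measurable_fun setT (fun x => \int[mu]_(u in `[0, 1]) h x u).
Proof.
move=> mh ch; have mH := measurable_caratheodory mh ch.
(* Tonelli's theorem is about nonnegative integrands. The positive and negative parts are written
   (|v| + v) / 2 and (|v| - v) / 2, which makes their continuity immediate. *)
suff pos (g : T -> R -> R) : measurable_fun setT (fun z : T * R => g z.1 (clamp z.2)) ->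
    (forall x u, 0 <= g x u) ->
    measurable_fun setT (fun x => \int[mu]_(u in `[0, 1]) g x (clamp u)).
  pose p (v : R) := (`|v| + v) / 2; pose m (v : R) := (`|v| - v) / 2.
  have p0 v : 0 <= p v by rewrite divr_ge0// -lerBlDr sub0r -normrN ler_norm.
  have m0 v : 0 <= m v by rewrite divr_ge0// subr_ge0 ler_norm.
  have -> : (fun x => \int[mu]_(u in `[0, 1]) h x u) = (fun x =>
     \int[mu]_(u in `[0, 1]) p (h x (clamp u)) -
     \int[mu]_(u in `[0, 1]) m (h x (clamp u))).
    apply/funext => x; rewrite -RintegralB//.
    - apply: eq_Rintegral => u; rewrite inE/= => u01; rewrite clamp_id//.
      by rewrite /p /m; field.
    - apply: integrable01 => u; apply: cvgM; last exact: cvg_cst.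
      by apply: cvgD; [apply: cvg_norm|]; exact: ch.
    - apply: integrable01 => u; apply: cvgM; last exact: cvg_cst.
      by apply: cvgB; [apply: cvg_norm|]; exact: ch.
  apply: measurable_funB.
    apply: (pos (fun x u => p (h x u))) => // .
    apply: measurable_funM => //; apply: measurable_funD => //.
    by apply: measurableT_comp.
  apply: (pos (fun x u => m (h x u))) => //.
  apply: measurable_funM => //; apply: measurable_funB => //.
  by apply: measurableT_comp.
move=> mg g0; rewrite /Rintegral.
have mi : measurable_fun setT (fun z : T * R => ((g z.1 (clamp z.2) * \1_`[0, (1:R)] z.2)%:E)).
  apply/measurable_EFinP; apply: measurable_funM => //.
  by apply: measurableT_comp => //; exact: measurable_snd.
have := @measurable_fun_fubini_tonelli_F _ _ T (measurableTypeR R) R lebesgue_measure _ mi.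
rewrite /fubini_F /= => H.
apply: measurableT_comp; first exact: fine_measurable.
rewrite [X in measurable_fun _ X](_ : _ =
  (fun x => \int[mu]_y ((g x (clamp y) * \1_`[0, (1:R)] y)%:E))%E).
  apply: H => -[x u]; rewrite lee_fin mulr_ge0//.
apply/funext => x; rewrite integral_mkcond; apply: eq_integral => u _.
by rewrite patchE indicE; case: ifPn => _; rewrite ?mulr1 ?mulr0.
Qed.

End caratheodory.

(** * Gaussian exponential moments *)

Section gaussian.
Context {R : realType}.
Local Notation mu := (@lebesgue_measure R).

(** The Gaussian density agrees almost everywhere with the Radon-Nikodym derivative, since both have
    the same integrals over measurable sets. *)
Lemma ge0_integral_normal (s : R) (f : R -> \bar R) : s != 0 ->
  measurable_fun setT f -> (forall x, 0 <= f x)%E ->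
  (\int[normal_prob 0 s]_x f x = \int[mu]_x (f x * (normal_pdf 0 s x)%:E))%E.
Proof.
move=> s0 mf f0.
have dom := @normal_prob_dominates R 0 s.
rewrite -(Radon_Nikodym_SigmaFinite.change_of_variables dom)//.
have ri := Radon_Nikodym_SigmaFinite.f_integrable dom.
apply: ae_eq_integral => //.
- by apply: emeasurable_funM => //; exact: (measurable_int mu).
- apply: emeasurable_funM => //; apply/measurable_EFinP; exact: measurable_normal_pdf.
apply: ae_eqe_mul2l => /=; apply: integral_ae_eq => //.
  by apply/measurable_EFinP; exact: measurable_normal_pdf.
by move=> E _ mE; rewrite -Radon_Nikodym_SigmaFinite.f_integral.
Qed.

(* The density of N(0, s^2) times exp((1 - k^-2) x^2 / (2 s^2)) is k times the
   density of N(0, (k s)^2). *)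
Lemma integral_normal_expR_sqr (s k : R) : s != 0 -> 0 < k ->
  (\int[normal_prob 0 s]_x (expR ((1 - k ^- 2) / (2 * s ^+ 2) * x ^+ 2))%:E = k%:E)%E.
Proof.
move=> s0 k0; rewrite ge0_integral_normal//.
- transitivity (\int[mu]_x (k%:E * (normal_pdf 0 (k * s) x)%:E))%E; last first.
    rewrite ge0_integralZl//.
    + by rewrite integral_normal_pdf mule1.
    + by apply/measurable_EFinP; exact: measurable_normal_pdf.
    + by move=> x _; rewrite lee_fin normal_pdf_ge0.
    + by rewrite lee_fin ltW.
  apply: eq_integral => x _; rewrite -!EFinM; congr EFin.
  have ks0 : k * s != 0 by rewrite mulf_neq0// gt_eqF.
  rewrite /normal_pdf (negbTE s0) (negbTE ks0) /= /normal_fun !subr0.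
  have -> : normal_peak (k * s) = k^-1 * normal_peak s.
    rewrite /normal_peak exprMn -mulrA -mulrnAr sqrtrM ?sqr_ge0// sqrtr_sqr.
    by rewrite gtr0_norm// invfM.
  rewrite -[k^-1 * _ * _]mulrA mulVKf ?gt_eqF// [LHS]mulrCA -expRD; congr (_ * expR _).
  have kn0 : k != 0 by rewrite gt_eqF.
  by rewrite -[(k * s) ^+ 2 *+ 2]mulr_natr -[s ^+ 2 *+ 2]mulr_natr; field; rewrite s0 kn0.
- by apply/measurable_EFinP; apply: measurableT_comp => //; exact: measurable_funM.
Qed.

End gaussian.

Section centered_normal.
Context {d0 : measure_display} {T : measurableType d0} {R : realType}.
Variable P : probability T R.

(** The first alternative is the degenerate law at 0. In the second one k < 1 makes the exponent
    negative; both signs are used to compare [s] with the second moment. *)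
Lemma centered_normal_expR (X : T -> R) : centered_normal P X ->
  (forall k, \int[P]_x (expR (k * X x ^+ 2))%:E = 1%E)%E \/
  exists2 s : R, s != 0 & forall k, 0 < k ->
    (\int[P]_x (expR ((1 - k ^- 2) / (2 * s ^+ 2) * X x ^+ 2))%:E = k%:E)%E.
Proof.
move=> [mX [s Hs]].
pose g (l : R) (y : measurableTypeR R) : \bar R := (expR (l * (y : R) ^+ 2))%:E.
have mg l : measurable_fun setT (g l).
  by apply/measurable_EFinP; apply: measurableT_comp => //; apply: measurable_funM.
have g0 l y : (0 <= g l y)%E by rewrite lee_fin expR_ge0.
have E l : (\int[P]_x (expR (l * X x ^+ 2))%:E =
  \int[pushforward P (X : T -> measurableTypeR R)]_y g l y)%E.
  by rewrite ge0_integral_pushforward.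
have [s0|s0] := eqVneq s 0; [left => k|right; exists s => // k k0]; rewrite E.
  rewrite (eq_measure_integral (\d_(0 : measurableTypeR R)))/=; last first.
    by move=> A mA _; have := Hs A mA; rewrite s0 eqxx.
  by rewrite integral_dirac// diracT mul1e /g expr0n mulr0 expR0.
rewrite (eq_measure_integral (normal_prob 0 s))/=; last first.
  by move=> A mA _; have := Hs A mA; rewrite (negbTE s0).
exact: integral_normal_expR_sqr.
Qed.

Lemma le_expR (x : R) : x <= expR x.
Proof. by have := expR_ge1Dx x; lra. Qed.

(** Needed because [cmean] is built on real-valued integrals, which take a default value when the
    integral is infinite: a covariance identity bounds the variance only once finiteness is
    known. *)
Lemma centered_normal_sqr_lty (X : T -> R) : centered_normal P X ->
  (\int[P]_x (X x ^+ 2)%:E < +oo)%E.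
Proof.
move=> nX; have [mX _] := nX.
have mX2 : measurable_fun setT (fun x => X x ^+ 2) by exact: measurable_funX.
have [H|[s s0 H]] := centered_normal_expR nX.
  apply: (@le_lt_trans _ _ (\int[P]_x (expR (1 * X x ^+ 2))%:E)%E); last by rewrite H ltry.
  apply: ge0_le_integral => //.
  - by move=> x _; rewrite lee_fin sqr_ge0.
  - exact/measurable_EFinP.
  - by apply/measurable_EFinP; apply: measurableT_comp => //; exact: measurable_funM.
  - by move=> x _; rewrite lee_fin mul1r le_expR.
pose l : R := (1 - 2 ^- 2) / (2 * s ^+ 2).
have l0 : 0 < l.
  apply: divr_gt0; last by rewrite mulr_gt0// exprn_even_gt0.
  have -> : 2 ^- 2 = 4^-1 :> R by rewrite -natrX.
  lra.
apply: (@le_lt_trans _ _ (\int[P]_x ((l^-1)%:E * (expR (l * X x ^+ 2))%:E))%E).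
  apply: ge0_le_integral => //.
  - by move=> x _; rewrite lee_fin sqr_ge0.
  - exact/measurable_EFinP.
  - apply/measurable_EFinP; apply: measurable_funM => //.
    by apply: measurableT_comp => //; exact: measurable_funM.
  - move=> x _; rewrite -EFinM lee_fin -(ler_pM2l l0) mulVKf ?gt_eqF//.
    exact: le_expR.
rewrite ge0_integralZl//.
- by rewrite H// -EFinM ltry.
- apply/measurable_EFinP; apply: measurableT_comp => //; exact: measurable_funM.
- by rewrite lee_fin invr_ge0 ltW.
Qed.

Lemma centered_normal_expR_le2 (X : T -> R) (v w : R) : centered_normal P X ->
  (\int[P]_x (X x ^+ 2)%:E <= v%:E)%E -> 8 * v <= w ^+ 2 ->
  (\int[P]_x (expR ((X x / w) ^+ 2))%:E <= 2%:E)%E.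
Proof.
move=> nX Xv vw; have [mX _] := nX.
have mX2 : measurable_fun setT (fun x => X x ^+ 2) by exact: measurable_funX.
have me (l : R) : measurable_fun setT (fun x => (expR (l * X x ^+ 2))%:E).
  by apply/measurable_EFinP; apply: measurableT_comp => //; exact: measurable_funM.
have -> : (\int[P]_x (expR ((X x / w) ^+ 2))%:E =
           \int[P]_x (expR (w ^- 2 * X x ^+ 2))%:E)%E.
  by apply: eq_integral => x _; rewrite exprMn exprVn mulrC.
have [H|[s s0 H]] := centered_normal_expR nX; first by rewrite H lee_fin ler1n.
have s2 : 0 < s ^+ 2 by rewrite exprn_even_gt0.
have q0 : 0 < Num.sqrt 2 :> R by rewrite sqrtr_gt0.
have q2 : Num.sqrt 2 ^+ 2 = 2 :> R by rewrite sqr_sqrtr.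
(* Integrate 2 s^2 <= X^2 + 2 s^2 exp (- X^2 / (2 s^2)), an instance of 1 + x <= exp x. For k = 1 /
   sqrt 2 the exponential has mean 1 / sqrt 2 <= 3 / 4, so at least s^2 / 2 is left for the second
   moment. *)
have sv : s ^+ 2 <= 2 * v.
  have k0 : 0 < (Num.sqrt 2)^-1 :> R by rewrite invr_gt0.
  have Hk := H _ k0; rewrite exprVn q2 invrK in Hk.
  have : ((2 * s ^+ 2)%:E <= v%:E + (2 * s ^+ 2)%:E * ((Num.sqrt 2)^-1)%:E :> \bar R)%E.
    rewrite -Hk -ge0_integralZl//.
    - apply: (@le_trans _ _ (\int[P]_x ((X x ^+ 2)%:E + ((2 * s ^+ 2)%:E *
        (expR ((1 - 2) / (2 * s ^+ 2) * X x ^+ 2))%:E)))%E).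
        rewrite -[leLHS]mule1 -(@probability_setT _ _ _ P) -integral_cst//.
        apply: ge0_le_integral => //.
        + by move=> x _; rewrite lee_fin mulr_ge0// ltW.
        + by apply: emeasurable_funD; [exact/measurable_EFinP|exact: measurable_funeM].
        + move=> x _; rewrite -EFinM -EFinD lee_fin.
          have := ler_wpM2l (ltW (mulr_gt0 (ltr0n _ 2) s2))
            (expR_ge1Dx ((1 - 2) / (2 * s ^+ 2) * X x ^+ 2)).
          rewrite [2 * s ^+ 2 * (1 + _)]mulrDr.
          have <- : - X x ^+ 2 = 2 * s ^+ 2 * ((1 - 2) / (2 * s ^+ 2) * X x ^+ 2).
            by field.
          lra.
      rewrite ge0_integralD//.
      + by rewrite leeD2r.
      + by move=> x _; rewrite lee_fin sqr_ge0.
      + exact/measurable_EFinP.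
      + by move=> x _; rewrite mule_ge0// lee_fin ?expR_ge0// mulr_ge0// ltW.
      + exact: measurable_funeM.
    - by rewrite lee_fin mulr_ge0// ltW.
  rewrite -EFinM -EFinD lee_fin => h.
  have : (Num.sqrt 2)^-1 <= 3 / 4 :> R.
    rewrite -(@ler_pXn2r _ 2)// ?nnegrE ?divr_ge0 ?(ltW k0)// exprVn q2 expr_div_n.
    lra.
  move=> /(ler_wpM2l (ltW s2)); lra.
have w0 : 0 < w ^+ 2 by lra.
(* For k = sqrt 2 the exponent is X^2 / (4 s^2), and w^2 >= 8 v >= 4 s^2. *)
apply: (@le_trans _ _ (Num.sqrt 2)%:E); last first.
  by rewrite lee_fin -(@ler_pXn2r _ 2)// ?nnegrE ?(ltW q0)// q2; lra.
rewrite -(H _ q0) q2; apply: ge0_le_integral => //.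
- move=> x _; rewrite lee_fin ler_expR ler_wpM2r ?sqr_ge0//.
  have -> : (1 - 2^-1) / (2 * s ^+ 2) = (4 * s ^+ 2)^-1 :> R by field.
  have s4 : 0 < 4 * s ^+ 2 by rewrite mulr_gt0.
  rewrite lef_pV2 ?posrE//; lra.
Qed.

End centered_normal.

(** * Exponential moments of the speed of the afBm *)

Section afbm_speed.
Context {d0 : measure_display} {T : measurableType d0} {R : realType}.
Variable P : probability T R.
Local Notation C := R[i].

Lemma integral_cst_probability (c : \bar R) : (\int[P]_x c = c)%E.
Proof.
by rewrite integral_cst// -[RHS]mule1; congr (_ * _)%E; exact: probability_setT.
Qed.

(** An upper bound for the variance at height [y]; the absolute value avoids discussing the sign of
    the prefactor. *)
Definition afbm_variance (alpha y : R) : R :=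
  `|afbm_const alpha| * (2 * y) `^ (2 * alpha - 2).

(** On the diagonal the base of the power is the positive real number 2 Im u, so its argument is
    0. *)
Lemma Re_afbm_kernel_diag (alpha : R) (u : C) : upper_half u ->
  complex.Re (afbm_kernel alpha u u) =
  afbm_const alpha * (2 * complex.Im u) `^ (2 * alpha - 2).
Proof.
move=> uu; have y0 : 0 < complex.Im u := uu; rewrite /afbm_kernel.
have -> : - (0 +i* 1) * (u - conjc u) = (2 * complex.Im u)%:C.
  by case: (u) => x y; apply/eqP; rewrite eq_complex /=; apply/andP; split; apply/eqP; ring.
have y2 : 0 < 2 * complex.Im u by rewrite mulr_gt0.
rewrite complex_ReM mul0r subr0; congr (_ * _).
rewrite /cpow normc_real gtr0_norm// complex_ReM mul0r subr0.
by rewrite /carg normc_real gtr0_norm//= lexx divff ?gt_eqF// acos1 mulr0 cos0 mulr1.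
Qed.

Lemma afbm1_centered_normal (alpha : R) (X' X : C -> T -> C) (u : C) :
  afbm1 P alpha X' X -> upper_half u ->
  centered_normal P (fun x => complex.Re (X' u x)) /\
  centered_normal P (fun x => complex.Im (X' u x)).
Proof.
move=> H uu; split.
  have := afbm1_gaussian H (n := 1%N) (z := fun=> u) (fun=> 1) (fun=> uu).
  by under eq_fun do rewrite big_ord1 mul1r.
have := afbm1_gaussian H (n := 1%N) (z := fun=> u) (fun=> - (0 +i* 1)) (fun=> uu).
under eq_fun do rewrite big_ord1 complex_ReM /=.
by under eq_fun do rewrite oppr0 mul0r sub0r mulN1r opprK.
Qed.

(** On the diagonal the covariance is the sum of the second moments of the real and imaginary parts,
    both nonnegative and finite. *)
Lemma afbm1_variance_le (alpha : R) (X' X : C -> T -> C) (u : C) :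
  afbm1 P alpha X' X -> upper_half u ->
  (\int[P]_x (complex.Re (X' u x) ^+ 2)%:E <= (afbm_variance alpha (complex.Im u))%:E)%E /\
  (\int[P]_x (complex.Im (X' u x) ^+ 2)%:E <= (afbm_variance alpha (complex.Im u))%:E)%E.
Proof.
move=> H uu; have [nR nI] := afbm1_centered_normal H uu.
have mR : measurable_fun setT (fun x => (complex.Re (X' u x) ^+ 2)%:E).
  by apply/measurable_EFinP/measurable_funX; exact: nR.1.
have mI : measurable_fun setT (fun x => (complex.Im (X' u x) ^+ 2)%:E).
  by apply/measurable_EFinP/measurable_funX; exact: nI.1.
have pR x : (0 <= (complex.Re (X' u x) ^+ 2)%:E)%E by rewrite lee_fin sqr_ge0.
have pI x : (0 <= (complex.Im (X' u x) ^+ 2)%:E)%E by rewrite lee_fin sqr_ge0.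
set A := (\int[P]_x (complex.Re (X' u x) ^+ 2)%:E)%E.
set B := (\int[P]_x (complex.Im (X' u x) ^+ 2)%:E)%E.
have A0 : (0 <= A)%E by exact: integral_ge0.
have B0 : (0 <= B)%E by exact: integral_ge0.
have Aoo := centered_normal_sqr_lty nR; have Boo := centered_normal_sqr_lty nI.
suff AB : (A + B <= (afbm_variance alpha (complex.Im u))%:E)%E.
  by split; apply: le_trans AB; [exact: leeDl|exact: leeDr].
have fAB : (A + B)%E \is a fin_num.
  by rewrite ge0_fin_numE; [apply: lte_add_pinfty|apply: adde_ge0].
rewrite -(fineK fAB) lee_fin.
have := congr1 (@complex.Re R) (afbm1_cov H uu uu).
rewrite Re_afbm_kernel_diag//= /Rintegral.
under eq_integral do rewrite complex_ReM.
have -> : (\int[P]_x (complex.Re (X' u x) * complex.Re (conjc (X' u x)) -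
    complex.Im (X' u x) * complex.Im (conjc (X' u x)))%:E = A + B)%E.
  rewrite -ge0_integralD//; apply: eq_integral => x _; rewrite -EFinD; congr EFin.
  by case: (X' u x) => a b /=; ring.
by move=> ->; rewrite ler_wpM2r ?powR_ge0// ler_norm.
Qed.

(** The sum is at most n times its largest term, whose exponential is one of those on the right. The
    1 covers n = 0. *)
Lemma expR_sqr_sum_le (n : nat) (y : 'I_n -> R) : (forall i, 0 <= y i) ->
  expR ((\sum_i y i) ^+ 2) <= 1 + \sum_i expR ((n%:R * y i) ^+ 2).
Proof.
move=> y0; have [n0|] := posnP n.
  rewrite big1 ?expr0n ?expR0; last by move=> i; have := ltn_ord i; rewrite {2}n0.
  by rewrite lerDl sumr_ge0// => i _; exact: expR_ge0.
case: n y y0 => // n y y0 _.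
pose j := [arg max_(i > ord0) y i]%O.
have yj i : y i <= y j by rewrite /j; case: arg_maxP => // k _; apply.
apply: (@le_trans _ _ (expR ((n.+1%:R * y j) ^+ 2))).
  rewrite ler_expR lerXn2r ?nnegrE ?sumr_ge0 ?mulr_ge0//.
  apply: (le_trans (ler_sum _ (fun i _ => yj i))).
  by rewrite sumr_const card_ord mulr_natl.
rewrite (bigD1 j)//= addrCA lerDl addr_ge0// sumr_ge0// => i _; exact: expR_ge0.
Qed.

(** The product after 1 + is what 16 d^2 times the variance leaves once the power of the height is
    removed. Adding 1 makes the scale positive and its square at least that product. *)
Definition speed_scale (alpha : R) (d : nat) : R :=
  1 + 16 * d%:R ^+ 2 * `|afbm_const alpha| * 2 `^ (2 * alpha - 2).

Lemma speed_scale_gt0 (alpha : R) (d : nat) : 0 < speed_scale alpha d.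
Proof. by rewrite ltr_pwDl// !mulr_ge0 ?powR_ge0// exprn_ge0. Qed.

Lemma speed_scale_ge (alpha : R) (d : nat) (y : R) : 0 < y ->
  16 * d%:R ^+ 2 * afbm_variance alpha y <= (speed_scale alpha d * y `^ (alpha - 1)) ^+ 2.
Proof.
move=> y0; rewrite /afbm_variance powRM ?(ltW y0)// exprMn.
have -> : (y `^ (alpha - 1)) ^+ 2 = y `^ (2 * alpha - 2).
  by rewrite -powR_mulrn ?powR_ge0// -powRrM; congr (_ `^ _); ring.
rewrite 2!mulrA ler_wpM2r ?powR_ge0// /speed_scale.
set k := 16 * _ * _ * _; have k0 : 0 <= k by rewrite !mulr_ge0 ?powR_ge0// exprn_ge0.
nra.
Qed.

(** Each of the d components contributes 2 for its real and 2 for its imaginary part; the remaining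
    1 comes from [expR_sqr_sum_le]. *)
Lemma afbm_speed_expR (alpha : R) (d : nat) (Gamma : afBm P alpha d) (u : C) : upper_half u ->
  (\int[P]_x (expR ((speed (fun i z => afbm_deriv Gamma i z x) u /
      (speed_scale alpha d * complex.Im u `^ (alpha - 1))) ^+ 2))%:E <= (1 + 4 * d%:R)%:E)%E.
Proof.
move=> uu; set w := speed_scale alpha d * _.
have w0 : 0 < w by rewrite mulr_gt0 ?speed_scale_gt0 ?powR_gt0.
have uy : 0 < complex.Im u := uu.
have nG i := afbm1_centered_normal (afbm_component Gamma i) uu.
have vG i := afbm1_variance_le (afbm_component Gamma i) uu.
pose Re_ i x := complex.Re (afbm_deriv Gamma i u x).
pose Im_ i x := complex.Im (afbm_deriv Gamma i u x).
have mR i : measurable_fun setT (Re_ i) := (nG i).1.1.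
have mI i : measurable_fun setT (Im_ i) := (nG i).2.1.
have [d0'|d1] := posnP d.
  rewrite (eq_integral (fun=> 1%:E)) ?integral_cst_probability.
    by rewrite lee_fin lerDl mulr_ge0.
  move=> x _; rewrite /speed big1 ?mul0r ?expr0n ?expR0//.
  by move=> i; have := ltn_ord i; rewrite {2}d0'.
(* The factor d is the one of [expR_sqr_sum_le]. The factor sqrt 2 makes the rescaled squared
   modulus the mean of two squares, hence at most the larger one. Then 8 v <= l^2 amounts to 16 d^2
   v <= w^2. *)
pose l : R := w / (Num.sqrt 2 * d%:R).
have q0 : 0 < Num.sqrt 2 :> R by rewrite sqrtr_gt0.
have q2 : Num.sqrt 2 ^+ 2 = 2 :> R by rewrite sqr_sqrtr.
have d0R : (0 : R) < d%:R by rewrite ltr0n.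
have dd : (Num.sqrt 2 * d%:R) ^+ 2 = 2 * d%:R ^+ 2 :> R by rewrite exprMn q2.
have l2 : 8 * afbm_variance alpha (complex.Im u) <= l ^+ 2.
  have := speed_scale_ge alpha d uy; rewrite -/w /l expr_div_n dd.
  rewrite ler_pdivlMr ?mulr_gt0 ?exprn_gt0//; apply: le_trans.
  by rewrite le_eqVlt; apply/orP; left; apply/eqP; ring.
have ER i := centered_normal_expR_le2 (nG i).1 (vG i).1 l2.
have EI i := centered_normal_expR_le2 (nG i).2 (vG i).2 l2.
have m1 i : measurable_fun setT (fun x => (expR ((Re_ i x / l) ^+ 2))%:E).
  apply/measurable_EFinP; apply: measurableT_comp => //.
  by apply: measurable_funX; exact: measurable_funM.
have m2 i : measurable_fun setT (fun x => (expR ((Im_ i x / l) ^+ 2))%:E).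
  apply/measurable_EFinP; apply: measurableT_comp => //.
  by apply: measurable_funX; exact: measurable_funM.
pose g x : \bar R := (1%:E + \sum_(i < d) ((expR ((Re_ i x / l) ^+ 2))%:E +
   (expR ((Im_ i x / l) ^+ 2))%:E))%E.
have mg : measurable_fun setT g.
  apply: emeasurable_funD => //; apply: emeasurable_sum => i.
  exact: emeasurable_funD.
have p0 i x : (0%:E <= (expR ((Re_ i x / l) ^+ 2))%:E + (expR ((Im_ i x / l) ^+ 2))%:E)%E.
  by rewrite adde_ge0// lee_fin expR_ge0.
have mnorm i : measurable_fun setT (fun x => normc (afbm_deriv Gamma i u x)).
  rewrite (_ : (fun x => _) = (fun x => Num.sqrt (Re_ i x ^+ 2 + Im_ i x ^+ 2))).
    apply: (measurableT_comp (continuous_measurable_fun (@sqrt_continuous R))).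
    by apply: measurable_funD; exact: measurable_funX.
  by apply/funext => x; rewrite -normc_sqr sqrtr_sqr ger0_norm ?normc_ge0.
apply: (@le_trans _ _ (\int[P]_x g x)%E).
  apply: ge0_le_integral => //.
  - apply/measurable_EFinP; apply: measurableT_comp => //.
    apply: measurable_funX; apply: measurable_funM => //.
    by apply: measurable_sum => i.
  - move=> x _; rewrite /g.
    under eq_bigr do rewrite -EFinD.
    rewrite sumEFin -EFinD lee_fin /speed big_distrl/=.
    apply: (le_trans (expR_sqr_sum_le _)).
      by move=> i; rewrite divr_ge0 ?normc_ge0// ltW.
    rewrite lerD2l; apply: ler_sum => i _.
    have -> : (d%:R * (normc (afbm_deriv Gamma i u x) / w)) ^+ 2 =
        ((Re_ i x / l) ^+ 2 + (Im_ i x / l) ^+ 2) / 2.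
      rewrite exprMn !expr_div_n normc_sqr -/(Re_ i x) -/(Im_ i x) dd.
      by field; rewrite !gt_eqF.
    set a := (Re_ i x / l) ^+ 2; set b := (Im_ i x / l) ^+ 2.
    have [ab|ba] := leP a b.
      by rewrite (@le_trans _ _ (expR b))// ?ler_expR ?lerDr ?expR_ge0//; lra.
    by rewrite (@le_trans _ _ (expR a))// ?ler_expR ?lerDl ?expR_ge0//; lra.
rewrite /g ge0_integralD//; last 2 first.
- by move=> x _; rewrite sume_ge0.
- by apply: emeasurable_sum => i; exact: emeasurable_funD.
rewrite integral_cst_probability EFinD leeD2l//.
rewrite ge0_integral_sum//; last by move=> i; exact: emeasurable_funD.
apply: (@le_trans _ _ (\sum_(i < d) 4%:E)%E); last first.
  by rewrite sumEFin lee_fin sumr_const card_ord -[_ *+ d]mulr_natr.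
apply: lee_sum => i _; rewrite ge0_integralD//.
rewrite (_ : 4%:E = 2%:E + 2%:E :> \bar R)%E; first exact: (leeD (ER i) (EI i)).
by rewrite -EFinD -natrD.
Qed.

End afbm_speed.

(** * Subgaussian costs of paths *)

Section jensen.
Context {R : realType}.
Local Notation mu := (@lebesgue_measure R).

Lemma EFin_Rintegral01 (f : R -> R) : continuous f ->
  (\int[mu]_(u in `[0, 1]) f u)%:E = (\int[mu]_(u in `[0%R, 1%R]) (f u)%:E)%E.
Proof. by move=> cf; rewrite /Rintegral fineK//; exact/integrable_fin_num/integrable01. Qed.

(* Integrate the tangent line of y |-> exp (y ^ 2) at the mean. *)
Lemma jensen_expR_sqr (s rho : R -> R) (W := \int[mu]_(u in `[0, 1]) rho u) :
  continuous s -> continuous rho -> (forall u, 0 < rho u) -> 0 < W ->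
  expR (((\int[mu]_(u in `[0, 1]) s u) / W) ^+ 2) <=
    \int[mu]_(u in `[0, 1]) (rho u / W * expR ((s u / rho u) ^+ 2)).
Proof.
move=> cs crho rho0 W0; set S := \int[mu]_(u in _) s u.
set l := S / W; set e := expR (l ^+ 2).
have ccst (k : R) (f : R -> R) : continuous f -> continuous (fun u => k * f u).
  by move=> cf u; apply: cvgM; [exact: cvg_cst|exact: cf].
have cinv : continuous (fun u => (rho u)^-1).
  by move=> u; apply: cvgV; [rewrite gt_eqF|exact: crho].
have cr : continuous (fun u => rho u / W * expR ((s u / rho u) ^+ 2)).
  move=> u; apply: cvgM; first by apply: cvgM; [exact: crho|exact: cvg_cst].
  apply: (@cvg_comp _ _ _ (fun u => (s u / rho u) ^+ 2) expR); last exact: continuous_expR.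
  rewrite expr2; under eq_cvg do rewrite expr2.
  by apply: cvgM; apply: cvgM; [exact: cs|exact: cinv|exact: cs|exact: cinv].
have int f (cf : continuous f) := integrable01 cf.
have -> : e = \int[mu]_(u in `[0, 1]) (e * (1 - 2 * l ^+ 2) / W * rho u + e * 2 * l / W * s u).
  rewrite RintegralD//; [|exact/int/ccst|exact/int/ccst].
  rewrite !RintegralZl//; [|exact/int|exact/int].
  by rewrite -/W -/S /l; field; rewrite gt_eqF.
apply: le_Rintegral => //.
- apply: int => u; apply: cvgD; exact: ccst.
- exact: int.
move=> u _; set y := s u / rho u.
have -> : s u = y * rho u by rewrite /y divfK// gt_eqF.
rewrite /e.
have h : expR (l ^+ 2) * (1 + 2 * l * (y - l)) <= expR (y ^+ 2).
  have -> : y ^+ 2 = l ^+ 2 + (y ^+ 2 - l ^+ 2) by ring.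
  rewrite expRD ler_wpM2l ?expR_ge0//; apply: le_trans (expR_ge1Dx _).
  by have := sqr_ge0 (y - l); rewrite !expr2; lra.
have rW : 0 <= rho u / W by rewrite divr_ge0// ltW.
have := ler_wpM2l rW h.
by apply: le_trans; rewrite le_eqVlt; apply/orP; left; apply/eqP; ring.
Qed.

Lemma ler_powR_neg (x y a : R) : 0 < x -> x <= y -> a <= 0 -> y `^ a <= x `^ a.
Proof.
move=> x0 xy a0; rewrite -[a]opprK !(powRN _ (- a)).
have y0 : 0 < y := lt_le_trans x0 xy.
rewrite lef_pV2 ?posrE ?powR_gt0//.
by rewrite ge0_ler_powR ?oppr_ge0// nnegrE ltW.
Qed.

(** Split (x + y)^a as (x + y) (x + y)^(a - 1) and use that the power a - 1 <= 0 is
    nonincreasing. *)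
Lemma powRD_le (x y a : R) : 0 < x -> 0 < y -> 0 < a -> a <= 1 ->
  (x + y) `^ a <= x `^ a + y `^ a.
Proof.
move=> x0 y0 a0 a1; have xy0 : 0 < x + y by rewrite addr_gt0.
rewrite -(mulr_powRB1 (ltW xy0) a0) -(mulr_powRB1 (ltW x0) a0) -(mulr_powRB1 (ltW y0) a0).
have a10 : a - 1 <= 0 by rewrite subr_le0.
rewrite mulrDl lerD// ler_wpM2l ?(ltW x0) ?(ltW y0)//; apply: ler_powR_neg => //.
  by rewrite lerDl ltW.
by rewrite lerDr ltW.
Qed.

Lemma exprn_le_fact_expR (x : R) n : 0 <= x -> x ^+ n <= n`!%:R * expR x.
Proof.
move=> x0; have f0 : (0 : R) < n`!%:R by rewrite ltr0n fact_gt0.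
rewrite -ler_pdivrMl// mulrC; case: n f0 => [|n] f0.
  by rewrite expr0 divr1 -expR0 ler_expR.
by apply: le_trans (expR_ge1Dxn n x0); rewrite lerDr.
Qed.

End jensen.

Section segment_weight.
Context {R : realType}.
Local Notation C := R[i].
Local Notation mu := (@lebesgue_measure R).
Variables (alpha kappa : R).
Hypotheses (alpha0 : 0 < alpha) (alpha1 : alpha < 1) (kappa0 : 0 < kappa).

(** The scale of the speed at a point of the segment. Normalized, it is the probability density used
    in Jensen's inequality. *)
Definition weight (a b : C) (u : R) := kappa * complex.Im (seg a b (clamp u)) `^ (alpha - 1).

Lemma weight_gt0 a b u : upper_half a -> upper_half b -> 0 < weight a b u.
Proof.
by move=> ua ub; rewrite mulr_gt0// powR_gt0//; exact/upper_half_seg/clamp_itv.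
Qed.

Lemma continuous_clamp : continuous (@clamp R).
Proof.
by apply: (@continuous_clamp_comp R id) => x _ e e0; exists e => // y _ /ltW; apply.
Qed.

Lemma continuous_weight a b : upper_half a -> upper_half b -> continuous (weight a b).
Proof.
move=> ua ub u; apply: cvgM; first exact: cvg_cst.
pose p := complex.Im a; pose q := complex.Im b - p.
have -> : (fun u => complex.Im (seg a b (clamp u)) `^ (alpha - 1)) =
    (fun y => y `^ (alpha - 1)) \o (fun u => p + q * clamp u).
  by apply/funext => v /=; rewrite Im_seg mulrC.
have pos : 0 < p + q * clamp u.
  by have := upper_half_seg ua ub (clamp_itv u); rewrite /upper_half/= Im_seg mulrC.
apply: (@cvg_comp _ _ _ (fun u => p + q * clamp u) (fun y => y `^ (alpha - 1)) _
   (nbhs (p + q * clamp u))).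
  apply: cvgD; first exact: cvg_cst.
  by apply: cvgM; [exact: cvg_cst|exact: continuous_clamp].
rewrite Im_seg -/p -/q.
have [d _] := is_derive1_powR (alpha - 1) pos.
have cf : {for (p + q * clamp u), continuous (fun y : R => y `^ (alpha - 1))}.
  by apply/differentiable_continuous/derivable1_diffP.
by rewrite /continuous_at in cf; rewrite [clamp u * q]mulrC; exact: cf.
Qed.

(** With p = Im a the integral equals kappa ((p + Q)^alpha - p^alpha) / (alpha Q). Subadditivity of
    the power removes p, so the bound is uniform up to the boundary. *)
Lemma integral_weight_le a b (Q := complex.Im b - complex.Im a) :
  upper_half a -> upper_half b -> Q != 0 ->
  0 < \int[mu]_(u in `[0, 1]) weight a b u <= kappa * `|Q| `^ (alpha - 1) / alpha.
Proof.
move=> ua ub Q0; pose p := complex.Im a.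
have p0 : 0 < p := ua.
have pQ0 : 0 < p + Q by rewrite /p /Q addrC subrK.
have an0 : alpha != 0 by rewrite gt_eqF.
have -> : \int[mu]_(u in `[0, 1]) weight a b u =
    kappa / (alpha * Q) * ((p + Q) `^ alpha - p `^ alpha).
  pose G (x : R) := 0 + kappa / (alpha * Q) * x.
  pose H := G \o ((fun y => y `^ alpha) \o (fun u => p + Q * u)).
  transitivity (H 1 - H 0); last by rewrite /H /G /= mulr0 mulr1 addr0; ring.
  apply: FTC2_closed; last exact: continuous_weight.
  move=> u u01; rewrite /weight clamp_id//.
  have uu : 0 < p + Q * u.
    by have := upper_half_seg ua ub u01; rewrite /upper_half/= Im_seg mulrC.
  have d1 := @is_derive1_comp R (fun y => y `^ alpha) (fun x => p + Q * x) u _ _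
    (is_derive1_powR alpha uu) (is_derive_affine p Q u).
  have := @is_derive1_comp R G _ u _ _ (is_derive_affine 0 (kappa / (alpha * Q)) _) d1.
  congr (is_derive _ _ _ _); rewrite Im_seg -/p -/Q [u * Q]mulrC.
  by field; rewrite Q0.
have sub (x y : R) : 0 < x -> 0 < y -> (x + y) `^ alpha <= x `^ alpha + y `^ alpha.
  by move=> x0 y0; apply: powRD_le => //; exact: ltW.
have mono (x y : R) : 0 < x -> 0 < y -> x `^ alpha < (x + y) `^ alpha.
  move=> x0 y0; apply: gt0_ltr_powR => //; rewrite ?nnegrE ?(ltW x0) ?addr_ge0 ?ltW//.
  by rewrite ltrDl.
have aQ z : 0 < z -> z * z `^ (alpha - 1) = z `^ alpha.
  by move=> z0; rewrite mulr_powRB1// ltW.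
have ka : 0 < kappa / alpha by rewrite divr_gt0.
have [Qp|Qn|/eqP] := ltgtP 0 Q; last by rewrite eq_sym (negbTE Q0).
- rewrite gtr0_norm//.
  have -> : kappa / (alpha * Q) * ((p + Q) `^ alpha - p `^ alpha) =
     kappa / alpha * (((p + Q) `^ alpha - p `^ alpha) / Q) by field; rewrite Q0.
  have -> : kappa * Q `^ (alpha - 1) / alpha = kappa / alpha * Q `^ (alpha - 1) by ring.
  have h : 0 < (p + Q) `^ alpha - p `^ alpha by rewrite subr_gt0 mono.
  rewrite pmulr_rgt0// ler_pM2l// divr_gt0//=.
  by rewrite ler_pdivrMr// mulrC aQ// lerBlDl sub.
- rewrite ltr0_norm//.
  have NQ : 0 < - Q by rewrite oppr_gt0.
  have -> : kappa / (alpha * Q) * ((p + Q) `^ alpha - p `^ alpha) =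
     kappa / alpha * ((p `^ alpha - (p + Q) `^ alpha) / - Q) by field; rewrite Q0.
  have -> : kappa * (- Q) `^ (alpha - 1) / alpha = kappa / alpha * (- Q) `^ (alpha - 1) by ring.
  have pE : p = (p + Q) + - Q by rewrite addrK.
  have h : 0 < p `^ alpha - (p + Q) `^ alpha by rewrite subr_gt0 [in ltRHS]pE mono.
  rewrite pmulr_rgt0// ler_pM2l// divr_gt0//=.
  by rewrite ler_pdivrMr// mulrC aQ// lerBlDl [in leLHS]pE sub.
Qed.

End segment_weight.

Section subgaussian.
Context {d0 : measure_display} {T : measurableType d0} {R : realType}.
Variable P : probability T R.

(** A majorant [xi] is exhibited, rather than a tail bound, so that pathwise inequalities can be
    multiplied and raised to powers before expectations are taken. *)
Definition subgaussian (X : T -> R) (b M : R) := exists xi : T -> R,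
  [/\ measurable_fun setT xi, (forall x, 0 <= xi x),
      (forall x, X x <= b * xi x) &
      (\int[P]_x (expR (xi x ^+ 2))%:E <= M%:E)%E].

Lemma measurable_expR_sqr (xi : T -> R) : measurable_fun setT xi ->
  measurable_fun setT (fun x => (expR (xi x ^+ 2))%:E).
Proof.
by move=> mx; apply/measurable_EFinP; apply: measurableT_comp => //; exact: measurable_funX.
Qed.

Lemma integral_expR_sqr_max (xi eta : T -> R) (M N : R) :
  measurable_fun setT xi -> measurable_fun setT eta ->
  (\int[P]_x (expR (xi x ^+ 2))%:E <= M%:E)%E ->
  (\int[P]_x (expR (eta x ^+ 2))%:E <= N%:E)%E ->
  (\int[P]_x (expR ((Num.max (xi x) (eta x)) ^+ 2))%:E <= (M + N)%:E)%E.
Proof.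
move=> mx me xM eN.
have e1 := measurable_expR_sqr mx; have e2 := measurable_expR_sqr me.
apply: (@le_trans _ _ (\int[P]_x ((expR (xi x ^+ 2))%:E + (expR (eta x ^+ 2))%:E))%E).
  apply: ge0_le_integral => //.
  - by apply: measurable_expR_sqr; exact: measurable_maxr.
  - exact: emeasurable_funD.
  - move=> x _; rewrite -EFinD lee_fin /Num.max; case: ifP => _.
      by rewrite lerDr expR_ge0.
    by rewrite lerDl expR_ge0.
by rewrite ge0_integralD// EFinD leeD.
Qed.

Lemma subgaussian_le (X : T -> R) (b c M : R) :
  subgaussian X b M -> b <= c -> subgaussian X c M.
Proof.
move=> [xi [mx x0 Xx xM]] bc; exists xi; split => // x.
by apply: le_trans (Xx x) _; rewrite ler_wpM2r.
Qed.

(** The maximum of the two majorants serves for the sum: the exponential of its square is at most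
    the sum of the two exponentials, so the scales add and only the moment bound grows. *)
Lemma subgaussianD (X Y : T -> R) (b c M N : R) : 0 <= b -> 0 <= c ->
  subgaussian X b M -> subgaussian Y c N -> subgaussian (fun x => X x + Y x) (b + c) (M + N).
Proof.
move=> b0 c0 [xi [mx x0 Xx xM]] [eta [me e0 Ye eN]].
exists (fun x => Num.max (xi x) (eta x)); split.
- exact: measurable_maxr.
- by move=> x; rewrite le_max x0.
- move=> x; rewrite mulrDl lerD//.
    by apply: le_trans (Xx x) _; rewrite ler_wpM2l// le_max lexx.
  by apply: le_trans (Ye x) _; rewrite ler_wpM2l// le_max lexx orbT.
- exact: integral_expR_sqr_max.
Qed.

End subgaussian.

Section holomorphic_process.
Context {d0 : measure_display} {T : measurableType d0} {R : realType}.
Variable P : probability T R.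
Local Notation C := R[i].
Local Notation mu := (@lebesgue_measure R).
Variables (d : nat) (F : 'I_d -> C -> T -> C) (alpha kappa M : R).
Hypotheses (alpha0 : 0 < alpha) (alpha1 : alpha < 1) (kappa0 : 0 < kappa) (M1 : 1 <= M).
Hypothesis dF : forall i x w, upper_half w -> exists l, cderiv (fun z => F i z x) w l.
Hypothesis mF : forall i w, upper_half w -> cmeasurable (F i w).

Let path x (i : 'I_d) (z : C) := F i z x.

Hypothesis expF : forall u, upper_half u ->
  (\int[P]_x (expR ((speed (path x) u /
      (kappa * complex.Im u `^ (alpha - 1))) ^+ 2))%:E <= M%:E)%E.

Lemma cmeasurableM (X Y : T -> C) : cmeasurable X -> cmeasurable Y ->
  cmeasurable (fun x => X x * Y x).
Proof.
move=> [mXr mXi] [mYr mYi]; split.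
  under eq_fun do rewrite complex_ReM.
  by apply: measurable_funB; exact: measurable_funM.
under eq_fun do rewrite complex_ImM.
by apply: measurable_funD; exact: measurable_funM.
Qed.

Lemma cmeasurableD (X Y : T -> C) : cmeasurable X -> cmeasurable Y ->
  cmeasurable (fun x => X x + Y x).
Proof.
move=> [mXr mXi] [mYr mYi]; split.
  by under eq_fun do rewrite complex_ReD; exact: measurable_funD.
by under eq_fun do rewrite complex_ImD; exact: measurable_funD.
Qed.

Lemma cmeasurableN (X : T -> C) : cmeasurable X -> cmeasurable (fun x => - X x).
Proof.
move=> [mXr mXi]; split.
  by under eq_fun do rewrite complex_ReN; exact: measurable_funN.
by under eq_fun do rewrite complex_ImN; exact: measurable_funN.
Qed.

Lemma cmeasurable_cst (c : C) : cmeasurable (fun _ : T => c).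
Proof. by split; exact: measurable_cst. Qed.

Lemma measurable_normc (X : T -> C) : cmeasurable X ->
  measurable_fun setT (fun x => normc (X x)).
Proof.
move=> [mXr mXi].
rewrite (_ : (fun x => _) = (fun x => Num.sqrt (complex.Re (X x) ^+ 2 + complex.Im (X x) ^+ 2))).
  apply: (measurableT_comp (continuous_measurable_fun (@sqrt_continuous R))).
  by apply: measurable_funD; exact: measurable_funX.
by apply/funext => x; rewrite -normc_sqr sqrtr_sqr ger0_norm ?normc_ge0.
Qed.

Lemma cmeasurable_iterint I s t : upper_half s -> upper_half t ->
  cmeasurable (fun x => iterint (path x) I t s).
Proof.
move=> us; elim: I t => [|i I ih] t ut; first exact: cmeasurable_cst.
rewrite /=; pose G x (z : C) := path x i z * iterint (path x) I z s.
have mG (u : R) : u \in `[0, 1] -> cmeasurable (fun x => G x (seg s t u)).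
  move=> u01; have uu := upper_half_seg us ut u01.
  by apply: cmeasurableM; [exact: mF|exact: ih].
have cG x (u : R) : u \in `[0, 1] -> ccontinuous_at (G x) (seg s t u).
  move=> u01; have uu := upper_half_seg us ut u01.
  have [l1 h1] := dF i x uu.
  have [l2 h2] := iterint_holomorphic (fun i w uw => dF i x uw) I us uu.
  exact: cderiv_continuous (cderivM h1 h2).
rewrite /segint; apply: cmeasurableM; first exact: cmeasurable_cst.
split => /=.
  apply: (@measurable_Rintegral_param _ T R (fun x u => complex.Re (G x (seg s t u)))).
    by move=> u u01; exact: (mG u u01).1.
  by move=> x; exact: continuous_Re_path (cG x).
apply: (@measurable_Rintegral_param _ T R (fun x u => complex.Im (G x (seg s t u)))).
  by move=> u u01; exact: (mG u u01).2.
by move=> x; exact: continuous_Im_path (cG x).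
Qed.

Lemma measurable_speed z : upper_half z -> measurable_fun setT (fun x => speed (path x) z).
Proof. by move=> uz; apply: measurable_sum => i; apply: measurable_normc; exact: mF. Qed.

(** The majorant is the integral of the speed divided by that of the weight. Jensen's inequality and
    Tonelli's theorem reduce its exponential moment to [expF] at each point, and [M] is preserved
    because the normalized weight has integral 1. *)
Lemma cost_subgaussian a b (Q := complex.Im b - complex.Im a) :
  upper_half a -> upper_half b -> Q != 0 ->
  subgaussian P (fun x => cost (path x) a b)
    (normc (b - a) * (kappa * `|Q| `^ (alpha - 1) / alpha)) M.
Proof.
move=> ua ub Q0; set rho := weight alpha kappa a b.
have crho : continuous rho by exact: continuous_weight.
have rho0 u : 0 < rho u by exact: weight_gt0.
have /andP[W0 Wle] := integral_weight_le alpha0 alpha1 kappa0 ua ub Q0.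
set W := \int[mu]_(u in _) weight alpha kappa a b u in W0 Wle.
pose s x (u : R) := speed (path x) (seg a b u).
have cs x : continuous (s x \o @clamp R) by exact: (continuous_speed_path (dF ^~ x)).
have ms (u : R) : u \in `[0, 1] -> measurable_fun setT (s ^~ u).
  by move=> u01; apply: measurable_speed; exact: upper_half_seg.
have jms := measurable_caratheodory ms cs.
have s0 x u : 0 <= s x u by exact: speed_ge0.
exists (fun x => \int[mu]_(u in `[0, 1]) s x u / W); split.
- by apply: measurable_funM => //; exact: measurable_Rintegral_param.
- by move=> x; rewrite divr_ge0 ?(ltW W0)// Rintegral_ge0.
- move=> x; rewrite /cost -[leRHS]mulrA ler_wpM2l ?normc_ge0//.
  rewrite [leRHS]mulrA ler_pdivlMr// mulrC ler_wpM2r// Rintegral_ge0// => u _.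
  exact: s0.
pose H (z : T * measurableTypeR R) : \bar R :=
  (rho z.2 / W * expR ((s z.1 (clamp z.2) / rho z.2) ^+ 2) * \1_`[0, (1:R)] z.2)%:E.
have mrho : measurable_fun setT (fun z : T * R => rho z.2).
  apply: measurableT_comp; last exact: measurable_snd.
  exact: continuous_measurable_fun.
have rW u : 0 <= rho u / W by rewrite divr_ge0// ltW.
have H0 z : (0 <= H z)%E.
  rewrite lee_fin; apply: mulr_ge0 => //.
  by apply: mulr_ge0; [exact: rW|exact: expR_ge0].
have mirho : measurable_fun setT (fun z : T * R => (rho z.2)^-1).
  apply: (@measurableT_comp _ _ _ _ _ _ (fun u : R => (rho u)^-1)); last exact: measurable_snd.
  apply: continuous_measurable_fun => u.
  by apply: cvgV; [rewrite gt_eqF|exact: crho].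
have mH : measurable_fun setT H.
  apply/measurable_EFinP; apply: measurable_funM.
    apply: measurable_funM; first exact: measurable_funM.
    apply: measurableT_comp => //; apply: measurable_funX.
    exact: measurable_funM.
  by apply: measurableT_comp => //; exact: measurable_snd.
apply: (@le_trans _ _ (\int[P]_x \int[mu]_y H (x, y))%E).
  apply: ge0_le_integral => //.
  - apply: measurable_expR_sqr; apply: measurable_funM => //.
    exact: measurable_Rintegral_param.
  - exact: (measurable_fun_fubini_tonelli_F H).
  - move=> x _.
    have := jensen_expR_sqr (cs x) crho rho0 W0.
    have -> : \int[mu]_(u in `[0, 1]) s x u = \int[mu]_(u in `[0, 1]) (s x \o @clamp R) u.
      by apply: eq_Rintegral => u; rewrite inE/= => u01; rewrite clamp_id.
    rewrite -lee_fin => h; apply: (le_trans h).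
    rewrite EFin_Rintegral01.
      rewrite integral_mkcond le_eqVlt; apply/orP; left; apply/eqP.
      apply: eq_integral => u _; rewrite /H patchE indicE.
      by case: ifPn => _; rewrite ?mulr1 ?mulr0.
    move=> u; apply: cvgM; first by apply: cvgM; [exact: crho|exact: cvg_cst].
    apply: (@cvg_comp _ _ _ (fun u => (s x (clamp u) / rho u) ^+ 2) expR);
      last exact: continuous_expR.
    have cq : (s x (clamp u) / rho u) @[u --> u] --> s x (clamp u) / rho u.
      by apply: cvgM; [exact: cs|apply: cvgV; [rewrite gt_eqF|exact: crho]].
    by under eq_cvg do rewrite expr2; rewrite expr2; exact: cvgM.
rewrite (fubini_tonelli H)//.
apply: (@le_trans _ _ (\int[mu]_(y in `[0%R, 1%R]) (rho y / W * M)%:E)%E).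
  rewrite [leRHS]integral_mkcond; apply: ge0_le_integral => //.
  - by move=> y _; apply: integral_ge0.
  - exact: (measurable_fun_fubini_tonelli_G H).
  - apply/(measurable_restrictT _ _).1 => //; apply/measurable_EFinP.
    apply: measurable_funM => //; apply: measurable_funM => //.
    by apply: measurable_funTS; exact: continuous_measurable_fun.
  - move=> y _; rewrite patchE; case: ifPn => y01; last first.
      rewrite integral0_eq// => x _; rewrite /H indicE/= (negbTE y01).
      by rewrite mulr0.
    have y01' : y \in `[0, (1:R)] by move: y01; rewrite inE.
    have uy := upper_half_seg ua ub y01'.
    have -> : (\int[P]_x H (x, y) = (rho y / W)%:E *
       \int[P]_x (expR ((s x y / rho y) ^+ 2))%:E)%E.
      rewrite -ge0_integralZl//.
      + apply: eq_integral => x _; rewrite /H/= indicE y01 mulr1 clamp_id//.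
      + apply: measurable_expR_sqr; apply: measurable_funM => //; exact: ms.
      + by rewrite lee_fin rW.
    rewrite [leRHS]EFinM lee_wpmul2l//; first by rewrite lee_fin rW.
    by have := expF uy; rewrite /rho /weight clamp_id.
rewrite -EFin_Rintegral01; last first.
  by move=> u; apply: cvgM; [apply: cvgM; [exact: crho|exact: cvg_cst]|exact: cvg_cst].
under eq_Rintegral do rewrite -mulrA mulrC.
rewrite RintegralZl//; last exact: integrable01.
by rewrite -/W lee_fin mulrAC mulVf ?gt_eqF// mul1r.
Qed.

End holomorphic_process.

(** * Second moments of increments of iterated integrals *)

Section holomorphic_process_increment.
Context {d0 : measure_display} {T : measurableType d0} {R : realType}.
Variable P : probability T R.
Local Notation C := R[i].
Variables (d : nat) (F : 'I_d -> C -> T -> C) (alpha kappa M : R).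
Hypotheses (alpha0 : 0 < alpha) (alpha1 : alpha < 1) (kappa0 : 0 < kappa) (M1 : 1 <= M).
Hypothesis dF : forall i x w, upper_half w -> exists l, cderiv (fun z => F i z x) w l.
Hypothesis mF : forall i w, upper_half w -> cmeasurable (F i w).

Let path x (i : 'I_d) (z : C) := F i z x.

Hypothesis expF : forall u, upper_half u ->
  (\int[P]_x (expR ((speed (path x) u /
      (kappa * complex.Im u `^ (alpha - 1))) ^+ 2))%:E <= M%:E)%E.

(** Each of the two segments through the apex has length at most 3/2 |t - s| and changes height by
    at least |t - s| / 2; the two bounds add up to this constant times |t - s|^alpha. *)
Definition path_const : R := 3 * kappa * 2^-1 `^ (alpha - 1) / alpha.

Lemma path_const_ge0 : 0 <= path_const.
Proof. by rewrite divr_ge0 ?(ltW alpha0)// !mulr_ge0 ?powR_ge0// ltW. Qed.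

Lemma path_subgaussian s t : upper_half s -> upper_half t ->
  exists2 p, upper_half p & subgaussian P
    (fun x => cost (path x) s p + cost (path x) p t)
    (path_const * normc (t - s) `^ alpha) (M + M).
Proof.
move=> us ut; have [->|st] := eqVneq s t.
  exists t => //; exists (fun=> 0); split => //.
  - by move=> x; rewrite /cost subrr normc0 !mul0r addr0 mulr0.
  - rewrite expr0n expR0 integral_cst_probability lee_fin (le_trans M1)// lerDl (le_trans _ M1)//.
set dl := normc (t - s).
have dl0 : 0 < dl.
  rewrite lt_def normc_ge0 andbT; apply: contraNneq st => /eq0_normc/eqP.
  by rewrite subr_eq0 eq_sym.
(* The heights of s and t differ from their mean by at most dl / 2, so both segments change height
   by at least dl / 2. *)
pose p := (s + t) / 2 + (0 +i* dl).
have ImP : complex.Im p = (complex.Im s + complex.Im t) / 2 + dl.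
  by rewrite /p complex_ImD Im_midpoint.
have s0 : 0 < complex.Im s := us; have t0 : 0 < complex.Im t := ut.
have up : upper_half p by rewrite /upper_half/= ImP; lra.
have := Im_le_normc (t - s); rewrite complex_ImD complex_ImN -/dl ler_norml => /andP[h1 h2].
have nI : normc (0 +i* dl) = dl by rewrite /= expr0n/= add0r sqrtr_sqr gtr0_norm.
have nh : normc ((t - s) / 2) = dl / 2 by exact: normc_half.
have n1 : normc (p - s) <= 3 / 2 * dl.
  have -> : p - s = (t - s) / 2 + (0 +i* dl) by rewrite /p; field.
  by rewrite (le_trans (le_normcD _ _))// nI nh; lra.
have n2 : normc (t - p) <= 3 / 2 * dl.
  have -> : t - p = (t - s) / 2 - (0 +i* dl) by rewrite /p; field.
  by rewrite (le_trans (le_normcD _ _))// normcN nI nh; lra.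
have q1 : dl / 2 <= `|complex.Im p - complex.Im s|.
  by rewrite (le_trans _ (ler_norm _))// ImP; lra.
have q2 : dl / 2 <= `|complex.Im t - complex.Im p|.
  by rewrite distrC (le_trans _ (ler_norm _))// ImP; lra.
have d20 : 0 < dl / 2 by rewrite divr_gt0.
have nz (q : R) : dl / 2 <= `|q| -> q != 0.
  by move=> /(lt_le_trans d20); rewrite normr_gt0.
have bnd (k q : R) : 0 <= k -> k <= 3 / 2 * dl -> dl / 2 <= `|q| ->
    k * (kappa * `|q| `^ (alpha - 1) / alpha) <= path_const / 2 * dl `^ alpha.
  move=> k0 kd qd.
  have -> : path_const / 2 * dl `^ alpha =
      (3 / 2 * dl) * (kappa * (dl / 2) `^ (alpha - 1) / alpha).
    rewrite powRM ?(ltW dl0)// -(mulr_powRB1 (ltW dl0) alpha0) /path_const.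
    by field; rewrite gt_eqF.
  apply: ler_pM => //.
    by rewrite divr_ge0 ?(ltW alpha0)// mulr_ge0 ?powR_ge0// ltW.
  rewrite ler_pM2r ?invr_gt0// ler_pM2l//.
  by apply: ler_powR_neg => //; rewrite subr_le0 ltW.
exists p => //.
have -> : path_const * dl `^ alpha = path_const / 2 * dl `^ alpha + path_const / 2 * dl `^ alpha.
  by field.
have c0 : 0 <= path_const / 2 * dl `^ alpha.
  by rewrite mulr_ge0 ?powR_ge0// divr_ge0// path_const_ge0.
apply: subgaussianD => //.
  apply: subgaussian_le (bnd _ _ (normc_ge0 _) n1 q1).
  exact: (cost_subgaussian alpha0 alpha1 kappa0 dF mF expF us up (nz _ q1)).
apply: subgaussian_le (bnd _ _ (normc_ge0 _) n2 q2).
exact: (cost_subgaussian alpha0 alpha1 kappa0 dF mF expF up ut (nz _ q2)).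
Qed.

Lemma iterint_increment_moment I s0 s t
    (b := path_const * normc (t - s) `^ alpha)
    (a := path_const * normc (s - s0) `^ alpha + b) :
  upper_half s0 -> upper_half s -> upper_half t -> I != [::] ->
  (csqmean P (fun x => iterint (path x) I t s0 - iterint (path x) I s s0)%R <=
   (4 * M * (b ^+ 2 * a ^+ 2 ^+ (size I).-1) * (size I)%:R / ((size I).-1)`!%:R)%:E)%E.
Proof.
move=> us0 us ut I0.
have [p up [xi [mx x0 Xx xM]]] := path_subgaussian us0 us.
have [q uq [eta [me e0 Ye eM]]] := path_subgaussian us ut.
(* One variable for both paths, so that the whole pathwise bound becomes a constant times a power of
   [zeta]. Each path has exponential moment 2 M, hence the factor 4 M. *)
pose zeta x := Num.max (xi x) (eta x).
have mz : measurable_fun setT zeta by exact: measurable_maxr.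
have zM := integral_expR_sqr_max mx me xM eM.
have z0 x : 0 <= zeta x by rewrite le_max x0.
have b0 : 0 <= b by rewrite mulr_ge0 ?powR_ge0// path_const_ge0.
have a0' : 0 <= path_const * normc (s - s0) `^ alpha.
  by rewrite mulr_ge0 ?powR_ge0// path_const_ge0.
have a0 : 0 <= a by rewrite addr_ge0.
set m := (size I).-1; have nE : size I = m.+1 by rewrite /m prednK// lt0n size_eq0.
have f0 : (0 : R) < m`!%:R by rewrite ltr0n fact_gt0.
have key x : normc (iterint (path x) I t s0 - iterint (path x) I s s0) <=
    b * a ^+ m / m`!%:R * zeta x ^+ m.+1.
  pose A := cost (path x) s0 p + cost (path x) p s.
  pose B := cost (path x) s q + cost (path x) q t.
  have h : normc (iterint (path x) I t s0 - iterint (path x) I s s0) <=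
      B * (A + B) ^+ m / m`!%:R.
    exact: (iterint_increment (fun i w uw => dF i x uw) us0 up us uq ut I0).
  have A0 : 0 <= A by rewrite addr_ge0// cost_ge0.
  have B0 : 0 <= B by rewrite addr_ge0// cost_ge0.
  have Bb : B <= b * zeta x.
    by apply: le_trans (Ye x) _; rewrite ler_wpM2l// le_max lexx orbT.
  have Aa : A + B <= a * zeta x.
    rewrite mulrDl lerD//.
    by apply: le_trans (Xx x) _; rewrite ler_wpM2l// le_max lexx.
  apply: le_trans h _.
  have -> : b * a ^+ m / m`!%:R * zeta x ^+ m.+1 =
      (b * zeta x) * (a * zeta x) ^+ m / m`!%:R.
    by rewrite exprS exprMn; ring.
  rewrite ler_pM2r ?invr_gt0//; apply: ler_pM => //; first by rewrite exprn_ge0// addr_ge0.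
  have AB0 : 0 <= A + B by rewrite addr_ge0.
  have az0 : 0 <= a * zeta x by rewrite mulr_ge0.
  by rewrite lerXn2r.
(* The square of the pathwise bound contains (zeta^2)^(m+1), at most (m+1)! exp (zeta^2). *)
pose K := (b * a ^+ m / m`!%:R) ^+ 2 * (m.+1)`!%:R.
have K0 : 0 <= K by rewrite mulr_ge0// exprn_ge0// divr_ge0// mulr_ge0 ?exprn_ge0.
apply: (@le_trans _ _ (\int[P]_x (K%:E * (expR (zeta x ^+ 2))%:E))%E).
  apply: ge0_le_integral => //.
  - by move=> x _; rewrite lee_fin exprn_ge0 ?normc_ge0.
  - apply/measurable_EFinP; apply: measurable_funX; apply: measurable_normc.
    by apply: cmeasurableD; [|apply: cmeasurableN]; apply: cmeasurable_iterint.
  - by apply: measurable_funeM; exact: measurable_expR_sqr.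
  - move=> x _; rewrite -EFinM lee_fin /K.
    have kz : 0 <= b * a ^+ m / m`!%:R * zeta x ^+ m.+1.
      by rewrite mulr_ge0 ?exprn_ge0// divr_ge0// mulr_ge0 ?exprn_ge0.
    apply: (@le_trans _ _ ((b * a ^+ m / m`!%:R * zeta x ^+ m.+1) ^+ 2)).
      by rewrite lerXn2r// ?nnegrE ?normc_ge0//; exact: key.
    rewrite exprMn -[leRHS]mulrA ler_wpM2l ?sqr_ge0//.
    by rewrite exprAC; apply: exprn_le_fact_expR; rewrite sqr_ge0.
rewrite ge0_integralZl//; [|exact: measurable_expR_sqr].
apply: (@le_trans _ _ (K%:E * (M + M + (M + M))%:E)%E).
  by rewrite lee_wpmul2l.
rewrite -EFinM lee_fin le_eqVlt; apply/orP; left; apply/eqP; rewrite /K nE factS natrM.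
rewrite [a ^+ 2 ^+ m]exprAC; move: (a ^+ m) (m.+1%:R : R) (m`!%:R : R) f0 => u v w w0.
by field; rewrite gt_eqF.
Qed.

End holomorphic_process_increment.

(** * Series in L2 *)

Section L2.
Context {d0 : measure_display} {T : measurableType d0} {R : realType}.
Variable P : probability T R.
Local Notation C := R[i].

Lemma normcD_sqr_le (z w : C) :
  normc (z + w) ^+ 2 <= 2 * normc z ^+ 2 + 2 * normc w ^+ 2.
Proof.
rewrite !normc_sqr !ReImE.
have := sqr_ge0 (complex.Re z - complex.Re w); have := sqr_ge0 (complex.Im z - complex.Im w).
by rewrite !expr2; lra.
Qed.

Lemma measurable_normc_sqr (X : T -> C) : cmeasurable X ->
  measurable_fun setT (fun x => (normc (X x) ^+ 2)%:E).
Proof. by move=> mX; apply/measurable_EFinP; apply: measurable_funX; exact: measurable_normc. Qed.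

Lemma normc_sqr_EFin_ge0 (z : C) : (0 <= (normc z ^+ 2)%:E)%E.
Proof. by rewrite lee_fin exprn_ge0// normc_ge0. Qed.

Lemma csqmean_ge0 (X : T -> C) : (0 <= csqmean P X)%E.
Proof. by apply: integral_ge0 => x _; exact: normc_sqr_EFin_ge0. Qed.

Lemma csqmeanD_le (X Y : T -> C) : cmeasurable X -> cmeasurable Y ->
  (csqmean P (fun x => X x + Y x)%R <= 2%:E * csqmean P X + 2%:E * csqmean P Y)%E.
Proof.
move=> mX mY; rewrite /csqmean.
have nX x := normc_sqr_EFin_ge0 (X x); have nY x := normc_sqr_EFin_ge0 (Y x).
have qX := measurable_normc_sqr mX; have qY := measurable_normc_sqr mY.
rewrite -!ge0_integralZl//.
rewrite -ge0_integralD//; last 4 first.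
- by move=> x _; rewrite mule_ge0// lee_fin.
- exact: measurable_funeM.
- by move=> x _; rewrite mule_ge0// lee_fin.
- exact: measurable_funeM.
apply: ge0_le_integral => //.
- by move=> x _; exact: normc_sqr_EFin_ge0.
- exact/measurable_normc_sqr/cmeasurableD.
- by apply: emeasurable_funD; exact: measurable_funeM.
- by move=> x _; rewrite -!EFinM -EFinD lee_fin normcD_sqr_le.
Qed.

Lemma csqmeanN (X : T -> C) : csqmean P (fun x => - X x) = csqmean P X.
Proof. by apply: eq_integral => x _; rewrite normcN. Qed.

Lemma csqmeanM_cst (c : C) (X : T -> C) : cmeasurable X ->
  csqmean P (fun x => X x * c) = ((normc c ^+ 2)%:E * csqmean P X)%E.
Proof.
move=> mX; rewrite /csqmean -ge0_integralZl//.
- by apply: eq_integral => x _; rewrite normcM exprMn mulrC EFinM.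
- exact: measurable_normc_sqr.
- by move=> x _; exact: normc_sqr_EFin_ge0.
- exact: normc_sqr_EFin_ge0.
Qed.

Lemma csqmean_cst (c : C) : csqmean P (fun=> c) = (normc c ^+ 2)%:E.
Proof. exact: integral_cst_probability. Qed.

Lemma cmeasurable_sum (I : Type) (r : seq I) (X : I -> T -> C) :
  (forall i, cmeasurable (X i)) -> cmeasurable (fun x => \sum_(i <- r) X i x).
Proof.
move=> mX; elim: r => [|i r ih].
  by under eq_fun do rewrite big_nil; exact: cmeasurable_cst.
by under eq_fun do rewrite big_cons; exact: cmeasurableD.
Qed.

Lemma sqr_sum_le (I : Type) (r : seq I) (x : I -> R) :
  (\sum_(i <- r) x i) ^+ 2 <= (size r)%:R * \sum_(i <- r) x i ^+ 2.
Proof.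
elim: r => [|i r ih]; first by rewrite !big_nil expr0n mulr0.
rewrite !big_cons [size _]/=; case: r ih => [|j r] ih.
  by rewrite !big_nil !addr0 mul1r.
move: ih; rewrite [size (j :: r)]/= -(natr1 (size r).+1).
set S := \sum_(k <- _) x k; set Q := \sum_(k <- _) x k ^+ 2; set n : R := _%:R => ih.
have n0 : 0 < n by rewrite ltr0n.
rewrite -(ler_pM2l n0).
have := sqr_ge0 (n * x i - S); rewrite !expr2; rewrite expr2 in ih; nra.
Qed.

Lemma csqmean_sum_le (I : Type) (r : seq I) (X : I -> T -> C) (B : R) :
  (forall i, cmeasurable (X i)) -> (forall i, csqmean P (X i) <= B%:E)%E ->
  (csqmean P (fun x => \sum_(i <- r) X i x)%R <= ((size r)%:R ^+ 2 * B)%:E)%E.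
Proof.
move=> mX XB.
have qX i := measurable_normc_sqr (mX i).
have nX i x := normc_sqr_EFin_ge0 (X i x).
apply: (@le_trans _ _ (\int[P]_x ((size r)%:R%:E * \sum_(i <- r) (normc (X i x) ^+ 2)%:E))%E).
  apply: ge0_le_integral => //.
  - by move=> x _; exact: normc_sqr_EFin_ge0.
  - exact/measurable_normc_sqr/cmeasurable_sum.
  - by apply: measurable_funeM; exact: emeasurable_sum.
  - move=> x _; rewrite sumEFin -EFinM lee_fin.
    apply: le_trans (sqr_sum_le _ _).
    rewrite lerXn2r ?nnegrE ?normc_ge0 ?sumr_ge0//.
      by move=> i _; exact: normc_ge0.
    exact: normc_sum.
rewrite ge0_integralZl//; last 2 first.
- exact: emeasurable_sum.
- by move=> x _; rewrite sume_ge0.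
rewrite ge0_integral_sum// expr2 -mulrA EFinM lee_wpmul2l//.
apply: (@le_trans _ _ (\sum_(i <- r) B%:E)%E); first by apply: lee_sum => i _; exact: XB.
by rewrite sumEFin lee_fin big_const_seq count_predT iter_addr_0 mulr_natl.
Qed.

(** * Random series with factorially decreasing terms *)

Section series.
Variables (b : nat -> T -> C) (c q : R).
Hypotheses (mb : forall k, cmeasurable (b k)) (c0 : 0 <= c) (q0 : 0 <= q).
Hypothesis csqb : forall k, (csqmean P (b k) <= (c * q ^+ k / k`!%:R)%:E)%E.

Let S N x := \sum_(k < N) b k x.
(** The factorial in [csqb] leaves room for geometric weights. Where the sum [W] of these terms is
    finite, |b k| <= sqrt W / 2^k, so the series converges geometrically; and E W <= 4 c exp (4
    q). *)
Let w k x : \bar R := (4 ^+ k.+1 * normc (b k x) ^+ 2)%:E.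
Let W x : \bar R := (\sum_(0 <= k <oo) w k x)%E.

Let w0 k x : (0 <= w k x)%E.
Proof. by rewrite /w lee_fin !mulr_ge0 ?exprn_ge0 ?normc_ge0. Qed.

Let mw k : measurable_fun setT (w k).
Proof.
apply/measurable_EFinP; apply: measurable_funM => //.
by apply: measurable_funX; exact: measurable_normc.
Qed.

Let mW : measurable_fun setT W.
Proof. by apply: ge0_emeasurable_sum => // k x _ _; exact: w0. Qed.

Let W0 x : (0 <= W x)%E.
Proof. by apply: nneseries_ge0 => k _ _; exact: w0. Qed.

Let series_bound : R := 4 * c * expR (4 * q).

Let integral_W_le : (\int[P]_x W x <= series_bound%:E)%E.
Proof.
rewrite integral_nneseries//.
apply: lime_le; first by apply: is_cvg_nneseries => k _ _; exact: integral_ge0.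
apply: nearW => N.
apply: (@le_trans _ _ (\sum_(0 <= k < N) (4 * c * exp_coeff (4 * q) k)%:E)%E).
  apply: lee_sum => k _.
  have -> : (\int[P]_x w k x = (4 ^+ k.+1)%:E * csqmean P (b k))%E.
    rewrite -ge0_integralZl//.
    - exact: measurable_normc_sqr.
    - by move=> x _; exact: normc_sqr_EFin_ge0.
  apply: (@le_trans _ _ ((4 ^+ k.+1)%:E * (c * q ^+ k / k`!%:R)%:E)%E).
    by rewrite lee_wpmul2l// lee_fin exprn_ge0.
  rewrite -EFinM lee_fin /exp_coeff/= exprMn exprS le_eqVlt; apply/orP; left; apply/eqP.
  by field; rewrite pnatr_eq0 gtn_eqF// fact_gt0.
rewrite sumEFin lee_fin -mulr_sumr ler_wpM2l// ?mulr_ge0//.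
have q4 : 0 <= 4 * q by rewrite mulr_ge0.
apply: (@nondecreasing_cvgn_le _ (series (exp_coeff (4 * q)))).
  by apply: nondecreasing_series => k _ _; exact: exp_coeff_ge0.
exact: is_cvg_series_exp_coeff.
Qed.

Let term_le N x : ((\sum_(k < N) 4 ^+ k.+1 * normc (b k x) ^+ 2)%:E <= W x)%E.
Proof.
rewrite -sumEFin -(big_mkord xpredT (fun k => (4 ^+ k.+1 * normc (b k x) ^+ 2)%:E)).
by apply: (@nneseries_lim_ge _ (w ^~ x)) => k _ _; exact: w0.
Qed.

(** Iterating |z + w|^2 <= 2 |z|^2 + 2 |w|^2 from the first term on gives weights that do not depend
    on N. *)
Lemma partial_sum_sqr_le (z : nat -> C) N :
  normc (\sum_(k < N) z k) ^+ 2 <= \sum_(k < N) 2 ^+ k.+1 * normc (z k) ^+ 2.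
Proof.
elim: N z => [|N ih] z; first by rewrite !big_ord0 normc0 expr0n.
rewrite !big_ord_recl /=; apply: le_trans (normcD_sqr_le _ _) _.
rewrite expr1 lerD2l; have := ih (fun k => z k.+1).
move=> /(ler_wpM2l (ler0n _ 2))/le_trans; apply.
rewrite mulr_sumr; apply: ler_sum => k _.
by rewrite /bump/= add1n mulrA -exprS.
Qed.

Lemma csqmean_partial_sum_le N : (csqmean P (S N) <= (4 * c * expR (4 * q))%:E)%E.
Proof.
apply: le_trans integral_W_le; apply: ge0_le_integral => //.
- by move=> x _; exact: normc_sqr_EFin_ge0.
- by apply: measurable_normc_sqr; exact: cmeasurable_sum.
- move=> x _; apply: le_trans (term_le N x); rewrite lee_fin.
  apply: (le_trans (partial_sum_sqr_le (b ^~ x) N)).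
  apply: ler_sum => k _; rewrite ler_wpM2r ?exprn_ge0 ?normc_ge0//.
  by rewrite lerXn2r ?nnegrE// ler_nat.
Qed.

Let term_fin k x : (W x < +oo)%E -> normc (b k x) <= Num.sqrt (fine (W x)) / 2 ^+ k.
Proof.
move=> Woo; have Wf : W x \is a fin_num by rewrite ge0_fin_numE.
have F0 : 0 <= fine (W x) by rewrite fine_ge0.
have := term_le k.+1 x; rewrite -(fineK Wf) lee_fin => h.
rewrite ler_pdivlMr ?exprn_gt0// -(@ler_pXn2r _ 2)// ?nnegrE ?mulr_ge0 ?exprn_ge0 ?normc_ge0 ?sqrtr_ge0//.
rewrite sqr_sqrtr//; apply: le_trans h; rewrite big_ord_recr/=.
apply: (@le_trans _ _ (4 ^+ k.+1 * normc (b k x) ^+ 2)).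
  rewrite exprMn mulrC ler_wpM2r ?exprn_ge0 ?normc_ge0//.
  have -> : 2 ^+ k ^+ 2 = 4 ^+ k :> R.
    by rewrite -exprM mulnC exprM; congr (_ ^+ k); rewrite expr2 -natrM.
  by rewrite exprS ler_peMl ?exprn_ge0// ler1n.
by rewrite lerDr sumr_ge0// => i _; rewrite mulr_ge0 ?exprn_ge0// normc_ge0.
Qed.

(** The limit is built pointwise where [W] is finite, and the pointwise rate is integrated against
    [W]. The constant 32 is 8 times the 4 in the bound on E W. *)
Lemma L2_series_cvg : exists Y : T -> C, [/\ cmeasurable Y,
  (csqmean P Y < +oo)%E &
  forall N, (csqmean P (fun x => S N x - Y x)%R <= (32 * c * expR (4 * q) / 4 ^+ N)%:E)%E].
Proof.
pose A := [set x | (W x < +oo)%E].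
have mA : measurable A.
  by rewrite -[A]setTI; exact: (emeasurable_fun_infty_o measurableT mW).
have lim (g : C -> R) : (forall z y, g (z + y) = g z + g y) -> (forall z, `|g z| <= normc z) ->
    measurable_fun setT (fun x => g (b 0%N x)) ->
    (forall k, measurable_fun setT (fun x => g (b k x))) ->
    exists2 y : T -> R, measurable_fun setT y & forall N x, (W x < +oo)%E ->
      `|g (S N x) - y x| <= 2 * Num.sqrt (fine (W x)) / 2 ^+ N.
  move=> gD gn _ mg.
  have g0 : g 0 = 0 by apply: (addrI (g 0)); rewrite -gD !addr0.
  have gS N x : g (S N x) = \sum_(k < N) g (b k x).
    by rewrite /S; elim/big_ind2 : _ => // z1 r1 z2 r2 <- <-.
  (* Cutting off outside [A] makes the sequence converge everywhere, so its limit is measurable. *)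
  pose u N x := g (S N x) * \1_A x.
  have ex x : exists y, forall N, `|u N x - y| <= 2 * (Num.sqrt (fine (W x)) * \1_A x) / 2 ^+ N.
    apply: shrinking_cvg; first by rewrite mulr_ge0 ?sqrtr_ge0.
    move=> N; rewrite /u -mulrBl !gS big_ord_recr/= [_ + _ - _]addrAC subrr add0r indicE.
    case: (boolP (x \in A)) => xA; last by rewrite !mulr0 normr0 mul0r.
    rewrite !mulr1; apply: (le_trans (gn _)); apply: term_fin.
    by rewrite inE in xA.
  have [y Hy] := choice ex.
  exists y.
    apply: (@measurable_fun_cvg _ _ _ setT u).
      move=> N; apply: measurable_funM => //.
      under eq_fun do rewrite gS.
      exact: measurable_sum.
    move=> x _; apply/cvgrPdist_le => e e0.
    set D := 2 * (Num.sqrt (fine (W x)) * \1_A x).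
    have D0 : 0 <= D by rewrite !mulr_ge0 ?sqrtr_ge0.
    near=> N; rewrite distrC; apply: (le_trans (Hy x N)).
    rewrite -/D ler_pdivrMr ?exprn_gt0// [e * _]mulrC -ler_pdivrMr//.
    apply: (@le_trans _ _ N%:R).
      near: N; exists (Num.truncn (D / e)).+1 => // n /= hn.
      apply: ltW; apply: (lt_le_trans (truncnS_gt _)); by rewrite ler_nat.
    by rewrite -natrX ler_nat ltnW// ltn_expl.
  move=> N x Woo; have := Hy x N.
  by rewrite /u indicE mem_set// !mulr1.
have [yr myr Hr] := lim (@complex.Re R) (@complex_ReD R) (@Re_le_normc R) (mb 0).1 (fun k => (mb k).1).
have [yi myi Hi] := lim (@complex.Im R) (@complex_ImD R) (@Im_le_normc R) (mb 0).2 (fun k => (mb k).2).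
pose Y x : C := yr x +i* yi x.
have mY : cmeasurable Y by split.
have mS N : cmeasurable (S N) by exact: cmeasurable_sum.
have mSY N : cmeasurable (fun x => S N x - Y x).
  by apply: cmeasurableD => //; exact: cmeasurableN.
(* Each of the two coordinates contributes (2 sqrt W / 2^N)^2 = 4 W / 4^N. Where [W] is infinite the
   pointwise bound is trivial. *)
have dist N : (csqmean P (fun x => S N x - Y x)%R <= (8 / 4 ^+ N * series_bound)%:E)%E.
  apply: (@le_trans _ _ (\int[P]_x ((8 / 4 ^+ N)%:E * W x))%E); last first.
    have k0 : (0 <= (8 / 4 ^+ N : R)%:E)%E by rewrite lee_fin divr_ge0// exprn_ge0.
    by rewrite ge0_integralZl// [leRHS]EFinM lee_wpmul2l.
  apply: ge0_le_integral => //.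
  - by move=> x _; exact: normc_sqr_EFin_ge0.
  - exact: measurable_normc_sqr.
  - exact: measurable_funeM.
  - move=> x _; have [Woo|] := ltP (W x) +oo%E; last first.
      by rewrite leye_eq => /eqP ->; rewrite gt0_muley ?leey// lte_fin divr_gt0// exprn_gt0.
    have Wf : W x \is a fin_num by rewrite ge0_fin_numE.
    rewrite -(fineK Wf) -EFinM lee_fin normc_sqr !ReImE.
    have h1 := Hr N x Woo; have h2 := Hi N x Woo.
    have F0 : 0 <= fine (W x) by rewrite fine_ge0.
    have -> : 8 / 4 ^+ N * fine (W x) = (2 * Num.sqrt (fine (W x)) / 2 ^+ N) ^+ 2 *+ 2.
      have e4 : 2 ^+ N ^+ 2 = 4 ^+ N :> R.
        by rewrite -exprM mulnC exprM; congr (_ ^+ N); rewrite expr2 -natrM.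
      rewrite expr_div_n exprMn sqr_sqrtr// e4 mulr2n.
      by field; rewrite expf_neq0.
    have sq (r D : R) : `|r| <= D -> r ^+ 2 <= D ^+ 2.
      move=> h; rewrite -[r ^+ 2]real_normK ?num_real// lerXn2r// nnegrE.
      exact: le_trans (normr_ge0 _) h.
    by rewrite mulr2n; apply: lerD; exact: sq.
exists Y; split => //.
  have := dist 0%N; rewrite /S; under eq_fun do rewrite big_ord0 sub0r.
  by rewrite csqmeanN => /le_lt_trans; apply; exact: ltry.
move=> N; have := dist N; congr (_ <= _%:E)%E.
by rewrite /series_bound; field; rewrite expf_neq0.
Unshelve. all: by end_near. Qed.

End series.

Lemma geometric_squeeze (u : nat -> \bar R) (K : R) :
  (forall N, (0 <= u N)%E) -> (forall N, (u N <= (K / 4 ^+ N)%:E)%E) -> u N @[N --> \oo] --> 0%E.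
Proof.
move=> u0 uK; apply: (@squeeze_cvge _ _ _ _ (fun=> 0%E) _ (fun N => (K / 4 ^+ N)%:E)).
- by apply: nearW => N; rewrite u0 uK.
- exact: cvg_cst.
apply: cvg_EFin; first exact: nearW.
have -> : (fine \o fun N => (K / 4 ^+ N)%:E) = (fun N => K * 4^-1 ^+ N).
  by apply/funext => N /=; rewrite exprVn.
rewrite -[0](mulr0 K); apply: cvgM; first exact: cvg_cst.
by apply: cvg_expr; rewrite ger0_norm// invf_lt1// ltr1n.
Qed.

End L2.

(** * Iterated integrals of the afBm *)

Section afbm_iterated_integrals.
Context {d0 : measure_display} {T : measurableType d0} {R : realType}.
Variable P : probability T R.
Local Notation C := R[i].
Variables (alpha : R) (d : nat) (Gamma : afBm P alpha d).
Hypotheses (alpha0 : 0 < alpha) (alpha1 : alpha < 1).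
Implicit Types (I : seq 'I_d) (s t z : C).

Let F (i : 'I_d) (z : C) (x : T) := afbm_deriv Gamma i z x.

Let dF i x w : upper_half w -> exists l, cderiv (fun z => F i z x) w l.
Proof. by move=> uw; exact/analytic_cderiv/(afbm1_analytic (afbm_component Gamma i)). Qed.

Let mF i w : upper_half w -> cmeasurable (F i w).
Proof.
by move=> uw; have [[m1 _] [m2 _]] := afbm1_centered_normal (afbm_component Gamma i) uw.
Qed.

Definition afbm_exp_moment : R := 1 + 4 * d%:R.
Definition afbm_path_scale : R := path_const alpha (speed_scale alpha d).

Lemma afbm_exp_moment_ge1 : 1 <= afbm_exp_moment.
Proof. by rewrite lerDl mulr_ge0. Qed.

Lemma afbm_path_scale_ge0 : 0 <= afbm_path_scale.
Proof. exact: (path_const_ge0 alpha0 (speed_scale_gt0 alpha d)). Qed.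

Lemma cmeasurable_afbm_iterint I t s : upper_half s -> upper_half t ->
  cmeasurable (afbm_iterint Gamma I t s).
Proof. by move=> us ut; exact: (cmeasurable_iterint dF mF). Qed.

(** The free bound [A] on the total scale will allow one constant for all end points in a bounded
    region. *)
Lemma afbm_iterint_increment_moment I s0 s t (A : R)
    (b := afbm_path_scale * normc (t - s) `^ alpha) :
  upper_half s0 -> upper_half s -> upper_half t -> I != [::] ->
  afbm_path_scale * normc (s - s0) `^ alpha + b <= A ->
  (csqmean P (fun x => afbm_iterint Gamma I t s0 x - afbm_iterint Gamma I s s0 x)%R <=
   (4 * afbm_exp_moment * (b ^+ 2 * A ^+ 2 ^+ (size I).-1) * (size I)%:R / ((size I).-1)`!%:R)%:E)%E.
Proof.
move=> us0 us ut I0 aA; have expF := afbm_speed_expR Gamma.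
apply: le_trans (iterint_increment_moment alpha0 alpha1 (speed_scale_gt0 alpha d)
  afbm_exp_moment_ge1 dF mF expF us0 us ut I0) _.
have f0 : (0 : R) < ((size I).-1)`!%:R by rewrite ltr0n fact_gt0.
have k0 := afbm_path_scale_ge0.
have a0 : 0 <= afbm_path_scale * normc (s - s0) `^ alpha + b.
  by rewrite addr_ge0// mulr_ge0// powR_ge0.
rewrite lee_fin ler_pM2r ?invr_gt0// ler_wpM2r//.
rewrite ler_wpM2l ?mulr_ge0 ?(le_trans ler01 afbm_exp_moment_ge1)//.
rewrite ler_wpM2l ?sqr_ge0//.
have A0 : 0 <= A by exact: le_trans aA.
by rewrite lerXn2r ?nnegrE ?sqr_ge0// lerXn2r.
Qed.

(** The factor 2 comes from |z + w|^2 <= 2 |z|^2 + 2 |w|^2. It is harmless because only the growth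
    in the word length matters. Two nested uses of the inequality explain e / 8. *)
Lemma csqmean_limit_le (Z1 Z2 : R -> T -> C) (X1 X2 : T -> C) (B : R) :
  (forall e, 0 < e -> cmeasurable (Z1 e)) -> (forall e, 0 < e -> cmeasurable (Z2 e)) ->
  cmeasurable X1 -> cmeasurable X2 ->
  csqmean P (fun x => Z1 e x - X1 x) @[e --> (0 : R)^'+] --> 0%E ->
  csqmean P (fun x => Z2 e x - X2 x) @[e --> (0 : R)^'+] --> 0%E ->
  (forall e, 0 < e -> (csqmean P (fun x => Z1 e x - Z2 e x)%R <= B%:E)%E) ->
  (csqmean P (fun x => X1 x - X2 x)%R <= (2 * B)%:E)%E.
Proof.
move=> mZ1 mZ2 mX1 mX2 c1 c2 ZB; apply/lee_addgt0Pr => e e0.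
have e8 : (0 < (e / 8)%:E)%E by rewrite lte_fin divr_gt0.
have n1 : \forall u \near (0 : R)^'+,
    (csqmean P (fun x => Z1 u x - X1 x)%R < (e / 8)%:E)%E := c1 _ (open_ereal_lt' e8).
have n2 : \forall u \near (0 : R)^'+,
    (csqmean P (fun x => Z2 u x - X2 x)%R < (e / 8)%:E)%E := c2 _ (open_ereal_lt' e8).
near (0 : R)^'+ => eps.
have h0 : 0 < eps by near: eps; exact: nbhs_right_gt.
have h1 : (csqmean P (fun x => Z1 eps x - X1 x)%R < (e / 8)%:E)%E by near: eps.
have h2 : (csqmean P (fun x => Z2 eps x - X2 x)%R < (e / 8)%:E)%E by near: eps.
have m1 : cmeasurable (fun x => Z1 eps x - X1 x).
  by apply: cmeasurableD; [exact: mZ1|exact: cmeasurableN].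
have m2 : cmeasurable (fun x => Z2 eps x - X2 x).
  by apply: cmeasurableD; [exact: mZ2|exact: cmeasurableN].
have m12 : cmeasurable (fun x => Z1 eps x - Z2 eps x).
  by apply: cmeasurableD; [exact: mZ1|apply: cmeasurableN; exact: mZ2].
have -> : (fun x => X1 x - X2 x) = (fun x => (Z1 eps x - Z2 eps x) +
    (- (Z1 eps x - X1 x) + (Z2 eps x - X2 x))).
  by apply/funext => x; ring.
have mm : cmeasurable (fun x => - (Z1 eps x - X1 x) + (Z2 eps x - X2 x)).
  by apply: cmeasurableD => //; exact: cmeasurableN.
apply: (le_trans (csqmeanD_le P m12 mm)).
have hh := csqmeanD_le P (cmeasurableN m1) m2.
rewrite csqmeanN in hh.
have {}hh : (csqmean P (fun x => - (Z1 eps x - X1 x) + (Z2 eps x - X2 x))%R <= (e / 2)%:E)%E.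
  apply: (le_trans hh).
  apply: (@le_trans _ _ (2%:E * (e / 8)%:E + 2%:E * (e / 8)%:E)%E).
    by apply: leeD; rewrite lee_wpmul2l// ltW.
  by rewrite -!EFinM -EFinD lee_fin; lra.
apply: (@le_trans _ _ (2%:E * B%:E + 2%:E * (e / 2)%:E)%E).
  by apply: leeD; rewrite lee_wpmul2l//; exact: ZB.
by rewrite -!EFinM -!EFinD lee_fin; lra.
Unshelve. all: by end_near. Qed.

Variable GG : seq 'I_d -> C -> C -> T -> C.
Hypothesis GG_iterint : is_afbm_iterint Gamma GG.

(** Here [n] is the length of the word minus one, and 8 is the 4 of the open half-plane doubled by
    the passage to the limit. *)
Definition moment_bound (b A : R) (n : nat) : R :=
  8 * afbm_exp_moment * (b ^+ 2 * A ^+ 2 ^+ n) * n.+1%:R / n`!%:R.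

Let shift (z : C) (e : R) : C := z + (0 +i* e).

Let upper_half_shift z (e : R) : closed_upper_half z -> 0 < e -> upper_half (shift z e).
Proof.
by rewrite /closed_upper_half /upper_half/= complex_ImD/= => z0 e0; rewrite ltr_wpDl.
Qed.

Let shiftB z w (e : R) : shift z e - shift w e = z - w.
Proof. by rewrite /shift; ring. Qed.

(** Shifting all points by i eps does not change their differences, so the bound in the open
    half-plane is uniform in eps. *)
Lemma closed_iterint_increment_moment I s0 s t (A : R) :
  closed_upper_half s0 -> closed_upper_half s -> closed_upper_half t -> I != [::] ->
  afbm_path_scale * normc (s - s0) `^ alpha + afbm_path_scale * normc (t - s) `^ alpha <= A ->
  (csqmean P (fun x => GG I t s0 x - GG I s s0 x)%R <=
   (moment_bound (afbm_path_scale * normc (t - s) `^ alpha) A (size I).-1)%:E)%E.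
Proof.
move=> us0 us ut I0 aA.
have [mt ct] := GG_iterint I ut us0; have [ms cs] := GG_iterint I us us0.
have m (z : C) (uz : closed_upper_half z) (e : R) : 0 < e ->
    cmeasurable (afbm_iterint Gamma I (shift z e) (shift s0 e)).
  by move=> e0; apply: cmeasurable_afbm_iterint; exact: upper_half_shift.
apply: (le_trans (csqmean_limit_le (m t ut) (m s us) mt ms ct cs _)).
  move=> e e0; have := @afbm_iterint_increment_moment I (shift s0 e) (shift s e) (shift t e) A.
  rewrite !shiftB; apply => //; exact: upper_half_shift.
rewrite lee_fin /moment_bound prednK ?lt0n ?size_eq0// le_eqVlt; apply/orP; left; apply/eqP.
by field; rewrite pnatr_eq0 gtn_eqF// fact_gt0.
Qed.

(** The case s0 = s. In the open half-plane the integral between equal points is 0, so the constant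
    0 serves as the second family in the limit and nothing has to be known about the version
    [GG I s s]. *)
Lemma closed_iterint_moment I s t (A : R) :
  closed_upper_half s -> closed_upper_half t -> I != [::] ->
  afbm_path_scale * normc (t - s) `^ alpha <= A ->
  (csqmean P (GG I t s) <=
   (moment_bound (afbm_path_scale * normc (t - s) `^ alpha) A (size I).-1)%:E)%E.
Proof.
move=> us ut I0 aA.
have [mt ct] := GG_iterint I ut us.
have m (e : R) : 0 < e -> cmeasurable (afbm_iterint Gamma I (shift t e) (shift s e)).
  by move=> e0; apply: cmeasurable_afbm_iterint; exact: upper_half_shift.
have -> : GG I t s = (fun x => GG I t s x - 0) by apply/funext => x; rewrite subr0.
have c0 : csqmean P (fun x : T => (0 : C) - 0) @[e --> (0 : R)^'+] --> 0%E.
  rewrite (_ : csqmean _ _ = 0%E); first exact: cvg_cst.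
  by rewrite subr0 csqmean_cst normc0 expr0n.
apply: (le_trans (csqmean_limit_le (Z2 := fun _ _ => 0) m (fun _ _ => cmeasurable_cst 0)
  mt (cmeasurable_cst 0) ct c0 _)).
  move=> e e0.
  have := @afbm_iterint_increment_moment I (shift s e) (shift s e) (shift t e) A.
  cbv zeta; rewrite !shiftB subrr normc0 powR0 ?gt_eqF// mulr0 add0r => H.
  have -> : (fun x => afbm_iterint Gamma I (shift t e) (shift s e) x - 0) =
     (fun x => afbm_iterint Gamma I (shift t e) (shift s e) x -
        afbm_iterint Gamma I (shift s e) (shift s e) x).
    apply/funext => x; congr (_ - _); rewrite /afbm_iterint.
    by case: I I0 {mt ct m H} => // i I _; rewrite /= /segint subrr mul0r.
  by apply: H => //; exact: upper_half_shift.
rewrite lee_fin /moment_bound prednK ?lt0n ?size_eq0// le_eqVlt; apply/orP; left; apply/eqP.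
by field; rewrite pnatr_eq0 gtn_eqF// fact_gt0.
Qed.

End afbm_iterated_integrals.

(** * Linear differential equations *)

Section words.
Context {d0 : measure_display} {T : measurableType d0} {R : realType}.
Variable P : probability T R.
Local Notation C := R[i].
Variables (alpha : R) (d r : nat) (V : 'I_d -> 'M[C]_r).

Definition vsum (y : 'cV[C]_r) : R := \sum_j normc (y j 0).
(** A crude common bound for all the matrices, so that all words of one length share the estimate
    [vsum_word]. *)
Definition Vsum : R := \sum_i \sum_j \sum_k normc (V i j k).

Lemma vsum_ge0 y : 0 <= vsum y.
Proof. by apply: sumr_ge0 => j _; exact: normc_ge0. Qed.

Lemma Vsum_ge0 : 0 <= Vsum.
Proof. by do 3 (apply: sumr_ge0 => ? _); exact: normc_ge0. Qed.

Lemma vsum_mulmx i y : vsum (V i *m y) <= Vsum * vsum y.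
Proof.
apply: (@le_trans _ _ ((\sum_j \sum_k normc (V i j k)) * vsum y)); last first.
  rewrite ler_wpM2r ?vsum_ge0// /Vsum [leRHS](bigD1 i)//= lerDl.
  by do 3 (apply: sumr_ge0 => ? _); exact: normc_ge0.
rewrite /vsum mulr_suml; apply: ler_sum => j _.
rewrite mxE; apply: (le_trans (normc_sum _ xpredT _)).
rewrite mulr_suml; apply: ler_sum => k _; rewrite normcM ler_wpM2l ?normc_ge0//.
by rewrite (bigD1 k)//= lerDl; apply: sumr_ge0 => ? _; exact: normc_ge0.
Qed.

Definition word_mx (I : seq 'I_d) : 'M[C]_r := \big[mulmx/1%:M]_(i <- I) V i.

Lemma vsum_word I y : vsum (word_mx I *m y) <= Vsum ^+ size I * vsum y.
Proof.
elim: I => [|i I ih]; first by rewrite /word_mx big_nil mul1mx expr0 mul1r.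
rewrite /word_mx big_cons -mulmxA (le_trans (vsum_mulmx _ _))// exprS -mulrA.
by rewrite ler_wpM2l ?Vsum_ge0.
Qed.

Lemma normc_le_vsum (y : 'cV[C]_r) j : normc (y j 0) <= vsum y.
Proof. by rewrite /vsum (bigD1 j)//= lerDl; apply: sumr_ge0 => ? _; exact: normc_ge0. Qed.

(** One coordinate of the term of order k + 1. [X] stands for the iterated integrals in the
    convergence proof and for their increments in the Hoelder estimate. *)
Definition word_term (X : seq 'I_d -> T -> C) (y : 'cV[C]_r) (j : 'I_r) (k : nat) (x : T) : C :=
  \sum_(I : k.+1.-tuple 'I_d) X I x * (word_mx I *m y) j 0.

(** There are d^(k+1) words of length k + 1, and squaring their sum costs the square of this number;
    one factor d^2 goes here, the rest into [word_ratio], whose factor 2 absorbs k + 1 <= 2^k. *)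
Definition word_coef (b : R) (y : 'cV[C]_r) : R :=
  (d%:R * Vsum * vsum y) ^+ 2 * (8 * afbm_exp_moment d * b ^+ 2).
Definition word_ratio (A : R) : R := 2 * (d%:R * Vsum * A) ^+ 2.

Variable X : seq 'I_d -> T -> C.
Variables (b A : R).
Hypothesis mX : forall I, cmeasurable (X I).
Hypothesis XB : forall I, I != [::] ->
  (csqmean P (X I) <= (moment_bound d b A (size I).-1)%:E)%E.

Lemma cmeasurable_word_term y j k : cmeasurable (word_term X y j k).
Proof.
by apply: cmeasurable_sum => I; apply: cmeasurableM => //; exact: cmeasurable_cst.
Qed.

Lemma word_coef_ge0 y : 0 <= word_coef b y.
Proof.
have m0 : 0 <= afbm_exp_moment d :> R := le_trans ler01 (afbm_exp_moment_ge1 d).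
apply: mulr_ge0; first exact: sqr_ge0.
apply: mulr_ge0; last exact: sqr_ge0.
by apply: mulr_ge0.
Qed.

Lemma word_ratio_ge0 : 0 <= word_ratio A.
Proof. by rewrite mulr_ge0// sqr_ge0. Qed.

Lemma csqmean_word_term y j k :
  (csqmean P (word_term X y j k) <= (word_coef b y * word_ratio A ^+ k / k`!%:R)%:E)%E.
Proof.
pose B := (Vsum ^+ k.+1 * vsum y) ^+ 2 * moment_bound d b A k.
have mB0 : 0 <= moment_bound d b A k.
  have m0 : 0 <= afbm_exp_moment d :> R := le_trans ler01 (afbm_exp_moment_ge1 d).
  rewrite /moment_bound; apply: divr_ge0 => //; apply: mulr_ge0 => //.
  apply: mulr_ge0; first exact: mulr_ge0.
  by apply: mulr_ge0; [exact: sqr_ge0|rewrite exprn_ge0 ?sqr_ge0].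
have H (I : k.+1.-tuple 'I_d) :
    (csqmean P (fun x => X I x * (word_mx I *m y) j 0)%R <= B%:E)%E.
  rewrite csqmeanM_cst// /B [leRHS]EFinM.
  have I0 : tval I != [::] by rewrite -size_eq0 size_tuple.
  have := XB I0; rewrite size_tuple [k.+1.-1]/= => h.
  apply: lee_pmul => //; [exact: normc_sqr_EFin_ge0|exact: csqmean_ge0|].
  rewrite lee_fin lerXn2r ?nnegrE ?normc_ge0// ?mulr_ge0 ?exprn_ge0 ?Vsum_ge0 ?vsum_ge0//.
  by rewrite (le_trans (normc_le_vsum _ _))// (le_trans (vsum_word _ _))// size_tuple.
have mH (I : k.+1.-tuple 'I_d) : cmeasurable (fun x => X I x * (word_mx I *m y) j 0).
  by apply: cmeasurableM => //; exact: cmeasurable_cst.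
have := csqmean_sum_le (index_enum (k.+1.-tuple 'I_d : finType)) mH H.
have -> : size (index_enum (k.+1.-tuple 'I_d : finType)) = (d ^ k.+1)%N.
  by rewrite -[in RHS](card_ord d) -card_tuple cardE enumT.
move=> h; apply: (@le_trans _ _ _ _ _ h).
have f0 : (0 : R) < k`!%:R by rewrite ltr0n fact_gt0.
have kk : k.+1%:R <= 2 ^+ k :> R by rewrite -natrX ler_nat ltn_expl.
pose Z := word_coef b y * ((d%:R * Vsum * A) ^+ 2) ^+ k.
have Z0 : 0 <= Z.
  by apply: mulr_ge0; [exact: (word_coef_ge0 y)|rewrite exprn_ge0 ?sqr_ge0].
rewrite lee_fin.
have -> : (d ^ k.+1)%:R ^+ 2 * B = Z * k.+1%:R / k`!%:R.
  have e : ((d%:R * Vsum * A) ^+ 2) ^+ k = (d%:R ^+ k * Vsum ^+ k * A ^+ k) ^+ 2.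
    by rewrite exprAC !exprMn.
  rewrite /B /moment_bound /Z /word_coef e [A ^+ 2 ^+ k]exprAC natrX.
  rewrite (exprS d%:R k) (exprS Vsum k).
  move: (d%:R ^+ k) (Vsum ^+ k) (A ^+ k) (k.+1%:R : R) (k`!%:R : R) f0 => u1 u2 u3 u4 u5 u50.
  by field; rewrite gt_eqF.
have -> : word_coef b y * word_ratio A ^+ k / k`!%:R = Z * 2 ^+ k / k`!%:R.
  by rewrite /word_ratio exprMn /Z; ring.
by rewrite ler_pM2r ?invr_gt0// ler_wpM2l.
Qed.

End words.

Section vector_L2.
Context {d0 : measure_display} {T : measurableType d0} {R : realType}.
Variables (P : probability T R) (r : nat).
Local Notation C := R[i].
Implicit Types X Y : T -> 'cV[C]_r.

Lemma vmeasurableD X Y : vmeasurable X -> vmeasurable Y -> vmeasurable (fun x => X x + Y x).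
Proof. by move=> mX mY j; under eq_fun do rewrite mxE; exact: cmeasurableD. Qed.

Lemma vmeasurableN X : vmeasurable X -> vmeasurable (fun x => - X x).
Proof. by move=> mX j; under eq_fun do rewrite mxE; exact: cmeasurableN. Qed.

Lemma vmeasurableB X Y : vmeasurable X -> vmeasurable Y -> vmeasurable (fun x => X x - Y x).
Proof. by move=> mX mY; apply: vmeasurableD => //; exact: vmeasurableN. Qed.

Lemma vsqmeanE X : vmeasurable X ->
  vsqmean P X = (\sum_(j < r) csqmean P (fun x => X x j ord0))%E.
Proof.
move=> mX; rewrite /csqmean -ge0_integral_sum//.
- by apply: eq_integral => x _; rewrite sumEFin.
- by move=> j; exact: measurable_normc_sqr.
- by move=> j x _; exact: normc_sqr_EFin_ge0.
Qed.

Lemma vsqmean_ge0 X : (0 <= vsqmean P X)%E.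
Proof.
apply: integral_ge0 => x _; rewrite lee_fin sumr_ge0// => j _.
by rewrite exprn_ge0// normc_ge0.
Qed.

Lemma vsqmeanN X : vsqmean P (fun x => - X x) = vsqmean P X.
Proof.
apply: eq_integral => x _; congr EFin; apply: eq_bigr => j _.
by rewrite mxE normcN.
Qed.

Lemma vsqmeanD_le X Y : vmeasurable X -> vmeasurable Y ->
  (vsqmean P (fun x => X x + Y x)%R <= 2%:E * vsqmean P X + 2%:E * vsqmean P Y)%E.
Proof.
move=> mX mY; rewrite !vsqmeanE//; last exact: vmeasurableD.
rewrite !ge0_sume_distrr; [|by move=> j _; exact: csqmean_ge0..].
rewrite -big_split/=; apply: lee_sum => j _.
by under eq_fun do rewrite mxE; exact: csqmeanD_le.
Qed.

Lemma vsqmeanB_le X Y : vmeasurable X -> vmeasurable Y ->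
  (vsqmean P (fun x => X x - Y x)%R <= 2%:E * vsqmean P X + 2%:E * vsqmean P Y)%E.
Proof.
by move=> mX mY; rewrite -(vsqmeanN Y); apply: vsqmeanD_le => //; exact: vmeasurableN.
Qed.

Lemma vsqmean_le X (B : R) : vmeasurable X ->
  (forall j, csqmean P (fun x => X x j ord0) <= B%:E)%E -> (vsqmean P X <= (r%:R * B)%:E)%E.
Proof.
move=> mX XB; rewrite vsqmeanE//; apply: (@le_trans _ _ (\sum_(j < r) B%:E)%E).
  by apply: lee_sum => j _; exact: XB.
by rewrite sumEFin lee_fin sumr_const card_ord mulr_natl.
Qed.

End vector_L2.

Lemma series_sum_entry (R : realType) (d0 : measure_display) (T : measurableType d0)
    (d r : nat) (V : 'I_d -> 'M[R[i]]_r)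
    (GG : seq 'I_d -> R[i] -> R[i] -> T -> R[i]) t s y N x (j : 'I_r) :
  series_sum V GG t s y N x j ord0 =
  y j ord0 + \sum_(k < N) \sum_(I : k.+1.-tuple 'I_d) GG I t s x * (word_mx V I *m y) j ord0.
Proof.
rewrite /series_sum mxE summxE big_add1/= big_mkord; congr (_ + _).
by apply: eq_bigr => k _; rewrite summxE; apply: eq_bigr => I _; rewrite mxE.
Qed.

(** * Convergence of the series and Hoelder estimate *)

Section linear_equation.
Context {d0 : measure_display} {T : measurableType d0} {R : realType}.
Variable P : probability T R.
Local Notation C := R[i].
Variables (alpha : R) (d r : nat) (Gamma : afBm P alpha d).
Hypotheses (alpha0 : 0 < alpha) (alpha1 : alpha < 1).
Variable GG : seq 'I_d -> C -> C -> T -> C.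
Hypothesis GG_iterint : is_afbm_iterint Gamma GG.
Variable V : 'I_d -> 'M[C]_r.

Lemma closed_upper_half0 : closed_upper_half (0 : C).
Proof. by rewrite /closed_upper_half/=. Qed.

Lemma vmeasurable_series_sum t s y N : closed_upper_half t -> closed_upper_half s ->
  vmeasurable (series_sum V GG t s y N).
Proof.
move=> ut us j; under eq_fun do rewrite series_sum_entry.
apply: cmeasurableD; first exact: cmeasurable_cst.
apply: cmeasurable_sum => k; apply: cmeasurable_sum => I.
apply: cmeasurableM; last exact: cmeasurable_cst.
by have [] := GG_iterint I ut us.
Qed.

Lemma L2_convergent_series_sum s t y : closed_upper_half s -> closed_upper_half t ->
  L2_convergent P (series_sum V GG t s y).
Proof.
move=> us ut; pose b := afbm_path_scale alpha d * normc (t - s) `^ alpha.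
pose X I := GG I t s.
have mX I : cmeasurable (X I) by have [] := GG_iterint I ut us.
have XB I : I != [::] -> (csqmean P (X I) <= (moment_bound d b b (size I).-1)%:E)%E.
  by move=> I0; exact: (closed_iterint_moment alpha0 alpha1 GG_iterint us ut I0 (lexx _)).
have c0 := word_coef_ge0 V b y; have q0 := word_ratio_ge0 V b.
have mt j := cmeasurable_word_term V mX y j.
have tB j := csqmean_word_term V mX XB y j.
have mS := fun N => vmeasurable_series_sum y N ut us.
have sumoo j N : (csqmean P (fun x => series_sum V GG t s y N x j ord0) < +oo)%E.
  under eq_fun do rewrite series_sum_entry.
  have h := csqmeanD_le P (cmeasurable_cst (y j ord0))
    (cmeasurable_sum (index_enum 'I_N) (fun k : 'I_N => mt j k)).
  apply: (le_lt_trans h); rewrite csqmean_cst -EFinM lte_add_pinfty ?ltry//.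
  apply: (@le_lt_trans _ _ (2%:E * (4 * word_coef V b y * expR (4 * word_ratio V b))%:E)%E).
    by rewrite lee_wpmul2l//; exact: (csqmean_partial_sum_le (mt j) c0 q0 (tB j) N).
  by rewrite -EFinM ltry.
split=> [N|].
  by split; [exact: mS|rewrite vsqmeanE//; apply: lte_sum_pinfty => j _; exact: sumoo].
have [Y HY] := choice (fun j => L2_series_cvg (mt j) c0 q0 (tB j)).
pose Z x : 'cV[C]_r := \col_j (y j ord0 + Y j x).
have mZ : vmeasurable Z.
  move=> j; under eq_fun do rewrite mxE; apply: cmeasurableD; first exact: cmeasurable_cst.
  by have [] := HY j.
exists Z; split=> //.
  rewrite vsqmeanE//; apply: lte_sum_pinfty => j _; under eq_fun do rewrite mxE.
  have [mY Yoo _] := HY j.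
  apply: (le_lt_trans (csqmeanD_le P (cmeasurable_cst (y j ord0)) mY)).
  by rewrite csqmean_cst -EFinM lte_add_pinfty ?ltry// lte_mul_pinfty.
pose K := r%:R * (32 * word_coef V b y * expR (4 * word_ratio V b)).
apply: (@geometric_squeeze _ _ K) => N; first exact: vsqmean_ge0.
rewrite /K -mulrA; apply: vsqmean_le; first exact: vmeasurableB.
move=> j; have [_ _ /(_ N)] := HY j; congr (csqmean P _ <= _)%E.
by apply/funext => x; rewrite [in RHS]mxE series_sum_entry !mxE; ring.
Qed.

(** Some partial sum, itself square integrable, is at squared distance less than 1 from the
    limit. *)
Lemma solution_square_integrable y0 (y : C -> T -> 'cV[C]_r) t :
  is_solution P V GG y0 y -> closed_upper_half t -> square_integrable P (y t).
Proof.
move=> sol ut; have [my cy] := sol t ut; split => //.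
have [S _] := L2_convergent_series_sum y0 closed_upper_half0 ut.
have e1 : (0 < 1%:E :> \bar R)%E by rewrite lte01.
have : \forall N \near \oo, (vsqmean P (fun x => series_sum V GG t 0 y0 N x - y t x)%R < 1%:E)%E
  := cy _ (open_ereal_lt' e1).
move=> [N _ /(_ N (leqnn N)) /= HN]; have [mS Soo] := S N.
have -> : y t = (fun x => series_sum V GG t 0 y0 N x - (series_sum V GG t 0 y0 N x - y t x)).
  by apply/funext => x; rewrite opprB addrC subrK.
apply: (le_lt_trans (vsqmeanB_le P mS (vmeasurableB mS my))).
by apply: lte_add_pinfty; rewrite lte_mul_pinfty// (lt_trans HN) ?ltry.
Qed.

(** [word_coef] is quadratic in its scale, so |t - s|^(2 alpha) factors out of it. The 8 is the 4 of
    [csqmean_partial_sum_le] doubled by the passage to the limit. *)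
Definition holder_const (y0 : 'cV[C]_r) (A : R) : R :=
  8 * r%:R * word_coef V (afbm_path_scale alpha d) y0 * expR (4 * word_ratio V A).

(** Both solutions start from y0 at 0, so y0 cancels and the difference of partial sums is again a
    sum over words, weighted by increments of iterated integrals with base point 0. It is bounded
    uniformly in N before the limit is taken. *)
Lemma solution_holder y0 (y : C -> T -> 'cV[C]_r) s t (A : R) :
  is_solution P V GG y0 y -> closed_upper_half s -> closed_upper_half t ->
  afbm_path_scale alpha d * normc s `^ alpha + afbm_path_scale alpha d * normc (t - s) `^ alpha <= A ->
  (vsqmean P (fun x => y t x - y s x)%R <=
     (holder_const y0 A * normc (t - s) `^ (2 * alpha))%:E)%E.
Proof.
move=> sol us ut aA; set b := afbm_path_scale alpha d * normc (t - s) `^ alpha in aA.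
have u0 := closed_upper_half0.
pose X I x := GG I t 0 x - GG I s 0 x.
have mX I : cmeasurable (X I).
  have [m1 _] := GG_iterint I ut u0; have [m2 _] := GG_iterint I us u0.
  by apply: cmeasurableD => //; exact: cmeasurableN.
have XB I : I != [::] -> (csqmean P (X I) <= (moment_bound d b A (size I).-1)%:E)%E.
  move=> I0; apply: (closed_iterint_increment_moment alpha0 alpha1 GG_iterint) => //.
  by rewrite subr0.
have c0 := word_coef_ge0 V b y0; have q0 := word_ratio_ge0 V A.
have mt j := cmeasurable_word_term V mX y0 j.
have tB j := csqmean_word_term V mX XB y0 j.
set K := 4 * word_coef V b y0 * expR (4 * word_ratio V A).
have SK N : (vsqmean P (fun x => series_sum V GG t 0 y0 N x - series_sum V GG s 0 y0 N x)%R
    <= (r%:R * K)%:E)%E.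
  apply: vsqmean_le; first by apply: vmeasurableB; exact: vmeasurable_series_sum.
  move=> j; have := csqmean_partial_sum_le (mt j) c0 q0 (tB j) N.
  congr (csqmean P _ <= _)%E; apply/funext => x.
  rewrite [in RHS]mxE [X in _ = _ + X]mxE !series_sum_entry opprD addrACA subrr add0r -sumrB.
  apply: eq_bigr => k _; rewrite /word_term -sumrB; apply: eq_bigr => I _.
  by rewrite /X mulrBl.
have -> : (holder_const y0 A * normc (t - s) `^ (2 * alpha)) = 2 * (r%:R * K).
  have -> : normc (t - s) `^ (2 * alpha) = (normc (t - s) `^ alpha) ^+ 2.
    by rewrite mulrC powRrM powR_mulrn ?powR_ge0.
  rewrite /holder_const /K /word_coef /b; ring.
have [my cy] := sol t ut; have [ms cs] := sol s us.
apply/lee_addgt0Pr => e e0.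
have e8 : (0 < (e / 8)%:E)%E by rewrite lte_fin divr_gt0.
have nt : \forall N \near \oo,
    (vsqmean P (fun x => series_sum V GG t 0 y0 N x - y t x)%R < (e / 8)%:E)%E
  := cy _ (open_ereal_lt' e8).
have ns : \forall N \near \oo,
    (vsqmean P (fun x => series_sum V GG s 0 y0 N x - y s x)%R < (e / 8)%:E)%E
  := cs _ (open_ereal_lt' e8).
have [N [ht hs]] := filter_ex (filterI nt ns).
have mSt := vmeasurable_series_sum y0 N ut u0; have mSs := vmeasurable_series_sum y0 N us u0.
have -> : (fun x => y t x - y s x) = (fun x =>
   (series_sum V GG t 0 y0 N x - series_sum V GG s 0 y0 N x) -
   ((series_sum V GG t 0 y0 N x - y t x) - (series_sum V GG s 0 y0 N x - y s x))).
  by apply/funext => x; apply/colP => j; rewrite !mxE; ring.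
have mD1 := vmeasurableB mSt mSs.
have mD2 := vmeasurableB (vmeasurableB mSt my) (vmeasurableB mSs ms).
apply: (le_trans (vsqmeanB_le P mD1 mD2)).
have hh : (vsqmean P (fun x => (series_sum V GG t 0 y0 N x - y t x) -
    (series_sum V GG s 0 y0 N x - y s x))%R <= (e / 2)%:E)%E.
  apply: (le_trans (vsqmeanB_le P (vmeasurableB mSt my) (vmeasurableB mSs ms))).
  apply: (@le_trans _ _ (2%:E * (e / 8)%:E + 2%:E * (e / 8)%:E)%E).
    by apply: leeD; rewrite lee_wpmul2l// ltW.
  by rewrite -!EFinM -EFinD lee_fin; lra.
apply: (@le_trans _ _ (2%:E * (r%:R * K)%:E + 2%:E * (e / 2)%:E)%E).
  by apply: leeD; apply: lee_wpmul2l => //; exact: (SK N).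
by rewrite -!EFinM -!EFinD lee_fin; lra.
Qed.

End linear_equation.

Unset Implicit Arguments.

Theorem mainTheorem1 (R : realType) (d0 : measure_display)
    (T : measurableType d0) (P : probability T R)
    (P_complete : measure_is_complete P)
    (alpha : R) (alpha_gt0 : 0 < alpha) (alpha_lt1 : alpha < 1)
    (d r : nat) (Gamma : afBm P alpha d)
    (GG : seq 'I_d -> R[i] -> R[i] -> T -> R[i])
    (GG_iterint : is_afbm_iterint Gamma GG)
    (V : 'I_d -> 'M[R[i]]_r) :
  (forall (s t : R[i]) (ys : 'cV[R[i]]_r),
      closed_upper_half s -> closed_upper_half t ->
      L2_convergent P (series_sum V GG t s ys)) /\
  (forall (y0 : 'cV[R[i]]_r) (y : R[i] -> T -> 'cV[R[i]]_r),
      is_solution P V GG y0 y ->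
      (forall t, closed_upper_half t -> square_integrable P (y t)) /\
      (forall M : R, exists K : R, forall s t : R[i],
          closed_upper_half s -> closed_upper_half t ->
          normc s <= M -> normc t <= M ->
          (vsqmean P (fun x => (y t x - y s x)%R)
             <= (K * normc (t - s) `^ (2 * alpha))%R%:E)%E)).
Proof.
split=> [s t ys us ut|y0 y sol].
  exact: (L2_convergent_series_sum alpha_gt0 alpha_lt1 GG_iterint V ys us ut).
split=> [t ut|M].
  exact: (solution_square_integrable alpha_gt0 alpha_lt1 GG_iterint sol ut).
(* For |s|, |t| <= M the path from 0 to s has scale at most the first summand, and |t - s| <= 2 M
   gives the second. *)
pose A := afbm_path_scale alpha d * M `^ alpha + afbm_path_scale alpha d * (M + M) `^ alpha.
exists (holder_const alpha V y0 A) => s t us ut sM tM.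
apply: (solution_holder alpha_gt0 alpha_lt1 GG_iterint sol us ut).
have M0 : 0 <= M := le_trans (normc_ge0 s) sM.
have k0 : 0 <= afbm_path_scale alpha d := afbm_path_scale_ge0 d alpha_gt0.
have tsM : normc (t - s) <= M + M.
  by rewrite (le_trans (le_normcD _ _))// normcN lerD.
by rewrite /A lerD// ler_wpM2l// ge0_ler_powR ?nnegrE ?normc_ge0 ?addr_ge0// ltW.
Qed.
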